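(* Let $p$ be a prime and let $H$ be a finite abelian $p$-group. (a) Let $p$ be odd, and for each $n$ let $A_n$ be a Haar-random matrix in one of $\mathrm{O}_n(\mathbb{Z}_p)$, $\mathrm{SO}_n(\mathbb{Z}_p)$ or $\mathrm{O}_n^-(\mathbb{Z}_p)$. Then for all sufficiently large $n$ (depending on $H$), $$\mathbb{E}\bigl(\#\mathrm{Sur}(\mathrm{cok}(A_n-I_n),H)\bigr)=|\mathrm{Sym}^2H|.$$ (b) Let $p=2$, and for each $n$ let $A_n$ be a Haar-random matrix in one of $\mathrm{O}_n(\mathbb{Z}_2)$, $\mathrm{SO}_n(\mathbb{Z}_2)$ or $\mathrm{O}_n^-(\mathbb{Z}_2)$. Then for all sufficiently large $n$ (depending on $H$), $$\mathbb{E}\bigl(\#\mathrm{Sur}(\mathrm{cok}(A_n-I_n),H)\bigr)=|\Gamma(H)|\left(\frac{3}{2}-2^{-t(H)-2}-2^{-d(H)-2}\right).$$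
   Context: $\mathrm{O}_n(\mathbb{Z}_p)=\{A\in\mathrm{GL}_n(\mathbb{Z}_p):A^TA=I_n\}$, $\mathrm{SO}_n(\mathbb{Z}_p)=\{A\in \mathrm{O}_n(\mathbb{Z}_p):\det A=1\}$, $\mathrm{O}_n^-(\mathbb{Z}_p)=\{A\in\mathrm{O}_n(\mathbb{Z}_p):\det A=-1\}$. ''Haar-random'' means distributed according to Haar probability measure; on $\mathrm{O}_n^-(\mathbb{Z}_p)$ this is the normalized restriction of the Haar measure of $\mathrm{O}_n(\mathbb{Z}_p)$. For $A\in \mathrm{M}_n(\mathbb{Z}_p)$, $\mathrm{cok}(A)=\mathbb{Z}_p^n/A\mathbb{Z}_p^n$. $\mathrm{Sur}(X,H)$ is the set of surjective group homomorphisms $X\to H$. A finite abelian $p$-group is regarded as a $\mathbb{Z}_p$-module. $\mathrm{Sym}^2H=(H\otimes_{\mathbb{Z}}H)/\langle x\otimes y-y\otimes x: x,y\in H\rangle$. $d(H)=\dim_{\mathbb{F}_p}(H/pH)$. For a finite abelian $2$-group $H$, $t(H)=\dim_{\mathbb{F}_2}(H[2]/(H[2]\cap 2H))$, i.e. the number of summands isomorphic to $\mathbb{Z}/2\mathbb{Z}$ in the elementary-divisor decomposition of $H$; here $H[2]=\{h\in H:2h=0\}$. $\Gamma(H)$ is Whitehead's universal quadratic group: a map $q:H\to A$ of abelian groups is homogeneous quadratic if $(x,y)\mapsto q(x+y)-q(x)-q(y)$ is biadditive and $q(kx)=k^2q(x)$ for all $k\in\mathbb{Z}$; $\Gamma(H)$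 is the abelian group with a homogeneous quadratic map $\gamma:H\to\Gamma(H)$ such that every homogeneous quadratic map $q:H\to A$ factors as $q=\tilde q\circ\gamma$ for a unique group homomorphism $\tilde q:\Gamma(H)\to A$. *)

(* Defs.v *)
From HB Require Import structures.
From mathcomp Require Import all_boot all_order all_algebra.
From mathcomp Require Import generic_quotient ring_quotient.
From mathcomp Require Import all_classical all_reals all_analysis.

Set Implicit Arguments.
Unset Strict Implicit.
Unset Printing Implicit Defensive.

Import Order.TTheory GRing.Theory Num.Theory.
Local Open Scope classical_set_scope.
Local Open Scope ring_scope.

(* Z_p is the inverse limit of the rings Z/p^(k+1), k >= 0. Exponents start at
   1 because ['Z_1] denotes Z/2. The type and its ring structure make sense for
   every [p : nat], but it is only Z_p when [p] is prime. *)
Definition padic_red (p k : nat) (a : 'Z_(p ^ k.+2)) : 'Z_(p ^ k.+1) := inZp a.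

Record padic_int (p : nat) := PadicInt {
  padic_coord :> forall k : nat, 'Z_(p ^ k.+1);
  padic_coordP : forall k, padic_coord k = padic_red (padic_coord k.+1) }.

Lemma padic_intP (p : nat) (x y : padic_int p) : (forall k, x k = y k) -> x = y.
Proof.
case: x y => [x xP] [y yP] /= xy.
have {}xy : x = y by apply: functional_extensionality_dep.
by subst y; congr PadicInt; apply: Prop_irrelevance.
Qed.

Section PadicRing.
Variable p : nat.

Lemma padic_modulus_dvd k :
  ((Zp_trunc (p ^ k.+1)).+2 %| (Zp_trunc (p ^ k.+2)).+2)%N.
Proof.
case: p => [|[|q]]; first by rewrite !exp0n.
  by rewrite !exp1n.
have m1 j : (1 < q.+2 ^ j.+1)%N by rewrite -(exp1n j.+1) ltn_exp2r.
by rewrite !Zp_cast ?dvdn_exp2l.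
Qed.

Lemma padic_redD k : {morph @padic_red p k : a b / a + b}.
Proof.
by move=> a b; apply: val_inj; rewrite /= modn_dvdm ?padic_modulus_dvd ?modnDm.
Qed.

Lemma padic_redM k : {morph @padic_red p k : a b / a * b}.
Proof.
by move=> a b; apply: val_inj; rewrite /= modn_dvdm ?padic_modulus_dvd ?modnMm.
Qed.

Lemma padic_red1 k : padic_red (1 : 'Z_(p ^ k.+2)) = 1.
Proof. by apply: val_inj; rewrite /= modn_dvdm ?padic_modulus_dvd. Qed.

Lemma padic_red0 k : padic_red (0 : 'Z_(p ^ k.+2)) = 0.
Proof. by apply: val_inj; rewrite /= mod0n. Qed.

Lemma padic_redN k : {morph @padic_red p k : a / - a}.
Proof.
move=> a; apply/eqP; rewrite -subr_eq0 opprK; apply/eqP.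
by rewrite -padic_redD addNr padic_red0.
Qed.

Definition padic_zero := @PadicInt p (fun=> 0) (fun k => esym (padic_red0 k)).
Definition padic_one := @PadicInt p (fun=> 1) (fun k => esym (padic_red1 k)).

Definition padic_opp (x : padic_int p) : padic_int p.
Proof.
exists (fun k => - x k) => k.
by rewrite padic_redN -padic_coordP.
Defined.

Definition padic_add (x y : padic_int p) : padic_int p.
Proof.
exists (fun k => x k + y k) => k.
by rewrite padic_redD -!padic_coordP.
Defined.

Definition padic_mul (x y : padic_int p) : padic_int p.
Proof.
exists (fun k => x k * y k) => k.
by rewrite padic_redM -!padic_coordP.
Defined.

HB.instance Definition _ := gen_eqMixin (padic_int p).
HB.instance Definition _ := gen_choiceMixin (padic_int p).

Fact padic_addA : associative padic_add.
Proof. by move=> x y z; apply: padic_intP => k /=; rewrite addrA. Qed.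
Fact padic_addC : commutative padic_add.
Proof. by move=> x y; apply: padic_intP => k /=; rewrite addrC. Qed.
Fact padic_add0 : left_id padic_zero padic_add.
Proof. by move=> x; apply: padic_intP => k /=; rewrite add0r. Qed.
Fact padic_addN : left_inverse padic_zero padic_opp padic_add.
Proof. by move=> x; apply: padic_intP => k /=; rewrite addNr. Qed.
Fact padic_mulA : associative padic_mul.
Proof. by move=> x y z; apply: padic_intP => k /=; rewrite mulrA. Qed.
Fact padic_mulC : commutative padic_mul.
Proof. by move=> x y; apply: padic_intP => k /=; rewrite mulrC. Qed.
Fact padic_mul1 : left_id padic_one padic_mul.
Proof. by move=> x; apply: padic_intP => k /=; rewrite mul1r. Qed.
Fact padic_mulD : left_distributive padic_mul padic_add.
Proof. by move=> x y z; apply: padic_intP => k /=; rewrite mulrDl. Qed.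
Fact padic_one_neq0 : padic_one != padic_zero.
Proof.
apply/eqP => /(congr1 (fun x : padic_int p => x 0%N)) /eqP.
by rewrite (negbTE (oner_neq0 _)).
Qed.

HB.instance Definition _ := GRing.isZmodule.Build (padic_int p)
  padic_addA padic_addC padic_add0 padic_addN.
HB.instance Definition _ := GRing.Zmodule_isComNzRing.Build (padic_int p)
  padic_mulA padic_mulC padic_mul1 padic_mulD padic_one_neq0.

Definition padic_unit : pred (padic_int p) :=
  fun x => `[< exists y, y * x = 1 >].
Definition padic_inv (x : padic_int p) : padic_int p :=
  xget x [set y | y * x = 1].

Fact padic_mulV : {in padic_unit, left_inverse 1 padic_inv *%R}.
Proof.
by move=> x /asboolP [y yx]; rewrite /padic_inv; case: xgetP => //= /(_ y) /(_ yx).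
Qed.
Fact padic_unitPl (x y : padic_int p) : y * x = 1 -> padic_unit x.
Proof. by move=> yx; apply/asboolP; exists y. Qed.
Fact padic_invr_out : {in [predC padic_unit], padic_inv =1 id}.
Proof.
move=> x /negP xNu; rewrite /padic_inv; case: xgetP => //= y _ yx.
by case: xNu; apply/asboolP; exists y.
Qed.

HB.instance Definition _ := GRing.ComNzRing_hasMulInverse.Build (padic_int p)
  padic_mulV padic_unitPl padic_invr_out.
HB.instance Definition _ := isPointed.Build (padic_int p) 0.

End PadicRing.

Section PadicTopology.
Variable p : nat.

(* The sets [[set y | y k = x k]] are the balls x + p^(k+1) Z_p. *)
Definition padic_open : set_system (padic_int p) :=
  [set U | forall x : padic_int p, U x ->
    exists k, [set y : padic_int p | y k = x k] `<=` U].

Lemma padic_coord_le (x y : padic_int p) k l :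
  (k <= l)%N -> x l = y l -> x k = y k.
Proof.
elim: l => [|l IHl]; first by rewrite leqn0 => /eqP ->.
rewrite leq_eqVlt => /predU1P [->//|kl] xy; apply: IHl => //.
by rewrite padic_coordP xy -padic_coordP.
Qed.

Fact padic_openT : padic_open setT.
Proof. by move=> x _; exists 0%N. Qed.
Fact padic_openI : setI_closed padic_open.
Proof.
move=> U V oU oV x [/oU [k kU] /oV [l lV]]; exists (maxn k l) => y /= yx.
by split; [apply: kU|apply: lV]; apply: padic_coord_le yx;
  rewrite ?leq_maxl ?leq_maxr.
Qed.
Fact padic_open_bigU (I : Type) (f : I -> set (padic_int p)) :
  (forall i, padic_open (f i)) -> padic_open (\bigcup_i f i).
Proof.
by move=> of_ x [i _ /of_ [k kf]]; exists k => y /kf fy; exists i.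
Qed.

HB.instance Definition _ := isOpenTopological.Build (padic_int p)
  padic_openT padic_openI padic_open_bigU.

End PadicTopology.

Section PadicBorel.
Variables p m n : nat.
Let M : Type := 'M[padic_int p]_(m, n).

HB.instance Definition _ := @isMeasurable.Build (sigma_display (@open M))
  'M[padic_int p]_(m, n) <<s @open M >>
  (@sigma_algebra0 _ setT _) (@sigma_algebraC M _)
  (@sigma_algebra_bigcup _ setT _).

End PadicBorel.

Section Orthogonal.
Variables p n : nat.

Definition orthogonal : set 'M[padic_int p]_n :=
  [set A | A \in unitmx /\ A^T *m A = 1%:M].
Definition special_orthogonal : set 'M[padic_int p]_n :=
  [set A | orthogonal A /\ \det A = 1].
Definition orthogonal_minus : set 'M[padic_int p]_n :=
  [set A | orthogonal A /\ \det A = -1].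

Variable R : realType.
Implicit Types mu nu : probability 'M[padic_int p]_n R.

(* The left-invariant probability measure of a closed subgroup G of GL_n(Z_p),
   seen as a Borel measure on M_n(Z_p) that is carried by G. *)
Definition is_haar (G : set 'M[padic_int p]_n) mu : Prop :=
  mu G = 1%E /\
  forall g B, G g -> measurable B -> mu (mulmx g @^-1` B) = mu B.

Variant ensemble := OrthogonalGroup | SpecialOrthogonal | OrthogonalMinus.

Definition is_haar_law (e : ensemble) mu : Prop :=
  match e with
  | OrthogonalGroup => is_haar orthogonal mu
  | SpecialOrthogonal => is_haar special_orthogonal mu
  | OrthogonalMinus => exists2 nu, is_haar orthogonal nu &
      forall B, measurable B ->
        mu B = (nu (B `&` orthogonal_minus) / nu orthogonal_minus)%E
  end.

Definition haar_random (e : ensemble) d (T : measurableType d)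
    (P : probability T R) (A : {RV P >-> 'M[padic_int p]_n}) : Prop :=
  is_haar_law e (distribution P A).

End Orthogonal.

Definition subgroup (V : zmodType) (S : pred V) (S_closed : zmod_closed S) :
    zmodClosed V :=
  HB.pack S (GRing.isZmodClosed.Build V S S_closed).

Definition zquot (V : zmodType) (S : pred V) (S_closed : zmod_closed S) :=
  {ideal_quot (subgroup S_closed)}.
HB.instance Definition _ (V : zmodType) (S : pred V) (cS : zmod_closed S) :=
  GRing.Zmodule.on (zquot cS).

Definition zproj (V : zmodType) (S : pred V) (cS : zmod_closed S) (v : V) :
    zquot cS :=
  \pi_{ideal_quot (subgroup cS)}%qT v.

Section QuotientTheory.
Variables (V : zmodType) (S : pred V) (cS : zmod_closed S).

Lemma zprojB : zmod_morphism (zproj cS).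
Proof. by move=> u v; rewrite /zproj; exact: pi_is_zmod_morphism. Qed.
HB.instance Definition _ :=
  GRing.isZmodMorphism.Build V (zquot cS) (zproj cS) zprojB.

Lemma zproj_surj (c : zquot cS) : exists v, c = zproj cS v.
Proof. by exists (repr c); rewrite /zproj reprK. Qed.

Lemma zproj_eq0 v : (zproj cS v == 0) = S v.
Proof.
rewrite -(raddf0 (zproj cS)) /zproj.
by rewrite -(Quotient.idealrBE (subgroup cS)) subr0.
Qed.

End QuotientTheory.

Section Generated.
Variables (V : zmodType) (E : set V).

Definition generated : pred V :=
  fun v => `[< forall S : pred V, zmod_closed S -> E `<=` [set` S] -> S v >].

Fact generated_closed : zmod_closed generated.
Proof.
split=> [|u v /asboolP uE /asboolP vE]; apply/asboolP => S cS ES.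
  by case: cS.
by case: (cS) => _; apply; [exact: uE|exact: vE].
Qed.

End Generated.

Section Cokernel.
Variables (p n : nat) (B : 'M[padic_int p]_n).

Definition im_mulmx : pred 'cV[padic_int p]_n :=
  fun v => `[< exists u, v = B *m u >].

Fact im_mulmx_closed : zmod_closed im_mulmx.
Proof.
split=> [|_ _ /asboolP [u ->] /asboolP [v ->]]; apply/asboolP.
  by exists 0; rewrite mulmx0.
by exists (u - v); rewrite mulmxBr.
Qed.

Definition cok := zquot im_mulmx_closed.
HB.instance Definition _ := GRing.Zmodule.on cok.

End Cokernel.

Definition Sur (X Y : zmodType) : set (X -> Y) :=
  [set f | zmod_morphism f /\ set_surj [set: X] [set: Y] f].
Arguments Sur : clear implicits.

Section Rank.
Variables (p : nat) (V : zmodType).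

(* The dimension of V as a vector space over F_p, for V killed by a prime p and
   finite; group isomorphisms between such V are F_p-linear. *)
Definition Fp_dim : nat :=
  xget 0%N [set d | exists2 f : 'rV['F_p]_d -> V, zmod_morphism f & bijective f].

Lemma Fp_dimE d (f : 'rV['F_p]_d -> V) :
  zmod_morphism f -> bijective f -> Fp_dim = d.
Proof.
move=> fB bij_f; rewrite /Fp_dim; case: xgetP => [e _ [g _ bij_g]|/(_ d)]; last first.
  by case; exists f.
have [f' fK f'K] := bij_f; have [g' gK g'K] := bij_g.
have /bij_eq_card : bijective (f' \o g).
  by exists (g' \o f) => x /=; rewrite ?f'K ?gK ?g'K ?fK.
rewrite !card_mx !mul1n => /eqP.
by rewrite eqn_exp2l ?card_ord // => /eqP.
Qed.

Definition multiple (m : nat) : pred V := fun v => `[< exists u, v = u *+ m >].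

Fact multiple_closed m : zmod_closed (multiple m).
Proof.
split=> [|_ _ /asboolP [u ->] /asboolP [v ->]]; apply/asboolP.
  by exists 0; rewrite mul0rn.
by exists (u - v); rewrite mulrnBl.
Qed.

Definition torsion (m : nat) : pred V := fun v => v *+ m == 0.

Fact torsion_closed m : zmod_closed (torsion m).
Proof.
split=> [|u v]; rewrite /torsion /in_mem /= ?mul0rn //.
by rewrite mulrnBl => /eqP -> /eqP ->; rewrite subr0.
Qed.

End Rank.

Definition rank_d (p : nat) (H : zmodType) : nat :=
  Fp_dim p (zquot (@multiple_closed H p)).

Section TwoRank.
Variable H : zmodType.

HB.instance Definition _ :=
  GRing.isZmodClosed.Build H (torsion 2) (@torsion_closed H 2).

Definition two_torsion : Type := {h : H | torsion 2 h}.
HB.instance Definition _ := SubChoice.on two_torsion.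
HB.instance Definition _ := [SubChoice_isSubZmodule of two_torsion by <:].

Fact two_torsion_multiple_closed :
  zmod_closed (fun h : two_torsion => multiple 2 (val h)).
Proof.
have [m0 mB] := @multiple_closed H 2.
by split=> [|u v uM vM]; rewrite /in_mem /= ?raddf0 ?raddfB; [|apply: mB].
Qed.

Definition rank_t : nat := Fp_dim 2 (zquot two_torsion_multiple_closed).

End TwoRank.

(* The free abelian group on a finite type X is [{ffun X -> int}]. *)
Section Presentation.
Variables (X : finType) (E : set {ffun X -> int}).

Definition free_gen (x : X) : {ffun X -> int} := [ffun y => (y == x)%:R].

Definition presented := zquot (generated_closed E).
HB.instance Definition _ := GRing.Zmodule.on presented.

Definition pres_gen (x : X) : presented :=
  zproj (generated_closed E) (free_gen x).

Definition free_lift (A : zmodType) (q : X -> A) (u : {ffun X -> int}) : A :=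
  \sum_x q x *~ u x.

End Presentation.

Section PresentationTheory.
Variable X : finType.

Lemma free_liftB (A : zmodType) (q : X -> A) : zmod_morphism (free_lift q).
Proof.
move=> u v; rewrite /free_lift -sumrB; apply: eq_bigr => x _.
by rewrite !ffunE mulrzBr.
Qed.
HB.instance Definition _ (A : zmodType) (q : X -> A) :=
  GRing.isZmodMorphism.Build _ _ (free_lift q) (free_liftB q).

Lemma free_lift_gen (A : zmodType) (q : X -> A) x :
  free_lift q (free_gen x) = q x.
Proof.
rewrite /free_lift (bigD1 x) //= big1 => [|y /negPf yx]; rewrite ffunE.
  by rewrite eqxx addr0.
by rewrite yx.
Qed.

Let coord (x : X) (u : {ffun X -> int}) : int := u x.
Let coordB x : zmod_morphism (coord x).
Proof. by move=> u v; rewrite /coord !ffunE. Qed.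
HB.instance Definition _ x := GRing.isZmodMorphism.Build _ _ (coord x) (coordB x).

Lemma free_sum (u : {ffun X -> int}) : u = \sum_x free_gen x *~ u x.
Proof.
apply/ffunP => y; rewrite -[RHS]/(coord y _) raddf_sum (bigD1 y) //=.
rewrite big1 => [|x /negPf xy]; rewrite raddfMz /= /coord /free_gen ffunE.
  by rewrite eqxx addr0 intz.
by rewrite eq_sym xy mul0rz.
Qed.

Lemma presented_universal (E : set {ffun X -> int}) (A : zmodType) (q : X -> A) :
  (forall r, E r -> free_lift q r = 0) ->
  exists! g : presented E -> A,
    zmod_morphism g /\ forall x, g (pres_gen E x) = q x.
Proof.
move=> Eq; pose S : pred _ := fun u => free_lift q u == 0.
have S_closed : zmod_closed S.
  split=> [|u v]; rewrite /S /in_mem /= ?raddf0 // free_liftB.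
  by move=> /eqP -> /eqP ->; rewrite subr0.
have lift0 u : generated E u -> free_lift q u = 0.
  by move=> /asboolP /(_ S S_closed) h; apply/eqP/h => r /Eq /eqP.
pose P := zproj (generated_closed E).
pose g (c : presented E) := free_lift q (repr c).
have gP u : g (P u) = free_lift q u.
  apply/eqP; rewrite -subr_eq0 -raddfB; apply/eqP/lift0.
  rewrite -(zproj_eq0 (generated_closed E)) raddfB subr_eq0.
  by apply/eqP; exact: (@reprK _ {ideal_quot (subgroup (generated_closed E))}).
exists g; split.
  split=> [a b|x]; last by rewrite gP free_lift_gen.
  have [u ->] := zproj_surj a; have [v ->] := zproj_surj b.
  by rewrite -raddfB !gP raddfB.
move=> h [hB hq]; apply/funext => c; have [u ->] := zproj_surj c; rewrite gP.
pose hA : {additive presented E -> A} :=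
  HB.pack h (GRing.isZmodMorphism.Build _ _ h hB).
rewrite /free_lift {2}(free_sum u) -[h _]/(hA (zproj _ _)) !raddf_sum.
by apply: eq_bigr => x _; rewrite !raddfMz -hq.
Qed.

End PresentationTheory.

Section SymmetricSquare.
Variable H : finZmodType.
Implicit Types x y z : H.

Local Notation e x y := (free_gen (x, y)).

Definition tensor_rel : set {ffun H * H -> int} :=
  [set r | (exists x y z, r = e (x + y) z - e x z - e y z) \/
           (exists x y z, r = e x (y + z) - e x y - e x z)].

Definition tensor_square := presented tensor_rel.
HB.instance Definition _ := GRing.Zmodule.on tensor_square.
Definition tens x y : tensor_square := pres_gen tensor_rel (x, y).

Definition sym_rel : set tensor_square :=
  [set r | exists x y, r = tens x y - tens y x].

Definition Sym2 := zquot (generated_closed sym_rel).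
HB.instance Definition _ := GRing.Zmodule.on Sym2.

End SymmetricSquare.

Definition biadditive (H A : zmodType) (b : H -> H -> A) : Prop :=
  (forall x y z, b (x + y) z = b x z + b y z) /\
  (forall x y z, b x (y + z) = b x y + b x z).

Lemma tensor_square_universal (H : finZmodType) (A : zmodType) (b : H -> H -> A) :
  biadditive b ->
  exists! g : tensor_square H -> A,
    zmod_morphism g /\ forall x y, g (tens x y) = b x y.
Proof.
move=> [bDl bDr].
have rel0 r : tensor_rel r -> free_lift (fun u : H * H => b u.1 u.2) r = 0.
  case=> -[x [y [z ->]]]; rewrite !free_liftB !free_lift_gen /=.
    by rewrite bDl [_ + b y z]addrC addrK subrr.
  by rewrite bDr [_ + b x z]addrC addrK subrr.
have [g [[gB gb] gU]] := presented_universal rel0.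
exists g; split; first by split=> // x y; rewrite gb.
by move=> h [hB hb]; apply: gU; split=> // -[x y]; rewrite -hb.
Qed.

Definition polar (H A : zmodType) (q : H -> A) (x y : H) : A :=
  q (x + y) - q x - q y.

Definition homogeneous_quadratic (H A : zmodType) (q : H -> A) : Prop :=
  biadditive (polar q) /\ forall (k : int) x, q (x *~ k) = q x *~ (k ^+ 2).

Section Whitehead.
Variable H : finZmodType.
Implicit Types x y z : H.

Local Notation e := (@free_gen H).

Definition Gamma_rel : set {ffun H -> int} :=
  [set r | [\/ exists x y z, r = polar e (x + y) z - polar e x z - polar e y z,
               exists x y z, r = polar e x (y + z) - polar e x y - polar e x z
             | exists (k : int) x, r = e (x *~ k) - e x *~ (k ^+ 2)]].

Definition Gamma := presented Gamma_rel.
HB.instance Definition _ := GRing.Zmodule.on Gamma.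
Definition gamma x : Gamma := pres_gen Gamma_rel x.

Lemma gamma_quadratic : homogeneous_quadratic gamma.
Proof.
have rel0 r : Gamma_rel r -> zproj (generated_closed Gamma_rel) r = 0.
  by move=> Er; apply/eqP; rewrite zproj_eq0; apply/asboolP => S _; apply.
have polarE x y : polar gamma x y =
    zproj (generated_closed Gamma_rel) (polar e x y).
  by rewrite /polar !raddfB.
split; first split.
- move=> x y z; apply/eqP; rewrite -subr_eq0 opprD addrA !polarE -!raddfB.
  by apply/eqP/rel0; constructor 1; exists x, y, z.
- move=> x y z; apply/eqP; rewrite -subr_eq0 opprD addrA !polarE -!raddfB.
  by apply/eqP/rel0; constructor 2; exists x, y, z.
move=> k x; apply/eqP; rewrite -subr_eq0 /gamma /pres_gen -raddfMz -raddfB.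
by apply/eqP/rel0; constructor 3; exists k, x.
Qed.

Lemma Gamma_universal (A : zmodType) (q : H -> A) :
  homogeneous_quadratic q ->
  exists! g : Gamma -> A, zmod_morphism g /\ forall x, q x = g (gamma x).
Proof.
move=> [[qDl qDr] qZ].
have liftP x y : free_lift q (polar e x y) = polar q x y.
  by rewrite /polar !free_liftB !free_lift_gen.
have rel0 r : Gamma_rel r -> free_lift q r = 0.
  case=> [[x [y [z ->]]]|[x [y [z ->]]]|[k [x ->]]].
  - by rewrite (free_liftB _ (_ - _)) (free_liftB _ (polar _ _ _)) !liftP
      qDl [_ + polar q y z]addrC addrK subrr.
  - by rewrite (free_liftB _ (_ - _)) (free_liftB _ (polar _ _ _)) !liftP
      qDr [_ + polar q x z]addrC addrK subrr.
  - by rewrite free_liftB free_lift_gen raddfMz /= free_lift_gen qZ subrr.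
have [g [[gB gq] gU]] := presented_universal rel0.
exists g; split; first by split=> // x; rewrite gq.
by move=> h [hB hq]; apply: gU; split=> // x; rewrite hq.
Qed.

End Whitehead.

(* Main.v *)
(** A surjection [cok (A - 1) -> H] is a tuple [F] of [n] generators of [H] with
    [FA = F].  By left invariance, the probability that [FA = F] is the inverse
    of the size of the orbit of [F], so that the expectation is the number of
    orbits of generating [n]-tuples under [O_n(Z_p)]; once [n > |H|], a
    transposition of two equal entries shows that [SO_n(Z_p)] has the same orbits.

    The orbit of [F = (h_1, ..., h_n)] determines the element
    [gamma h_1 + ... + gamma h_n] of [Gamma H] and the subgroup [D] spanned by
    all the [h_i + h_j] and [h_i - h_j].  For large [n] it is determined by
    them: let [e] kill [H], and let [I] be a set of indices other than [i], [j],
    of size divisible by [2e] and with zero sum of entries; the reflection in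
    [e_i + e_j + 1_I] allows one to translate all entries in [I] by [h_i + h_j],
    hence eventually by any element of [D].  Modulo such moves, the class of a
    single entry [h] is a quadratic function of [h] on its coset of [D], and
    therefore factors through [Gamma H].

    [D] is [H] or a subgroup of index two.  In the first case every element of
    [Gamma H] occurs; in the second, [|Gamma H| / (4 |D[2]|)] elements do, and
    the sum over [D] follows by counting the subgroups of index two according
    to whether they contain [H[2]]. *)
From HB Require Import structures.
Require Import Defs.
From mathcomp Require Import all_boot all_order all_algebra.
From mathcomp Require Import perm finmap.
From mathcomp Require Import all_classical all_reals all_analysis.
From mathcomp Require Import measurable_realfun.
From mathcomp Require Import zify ring.

Set Implicit Arguments.
Unset Strict Implicit.
Unset Printing Implicit Defensive.

Import Order.TTheory GRing.Theory Num.Theory.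
Local Open Scope classical_set_scope.
Local Open Scope ring_scope.

(** * Identities in abelian groups *)

(** For p = 2 the obstacle is that 2 is not a unit: a vector w gives an integral reflection if
    (w.w)/2 is a unit. A 0-1 vector with 2 + 2ke ones has half norm 1 + ke, a unit that acts as 1 on
    H; this is where the size 2e of the blocks comes from. The set O_n^- is no group, so the orbit
    count uses only that a law is carried by O_n and left invariant under SO_n; hence the need for
    SO_n to have the same orbits. The quadratic function on h_0 + D takes values in a quotient about
    which nothing is known, and is not extended to H within it. The target is enlarged, and the
    point is that the enlargement loses nothing. The same construction, applied to the zero
    function, gives the index 4 |D[2]|. The constant: there are 2^d subgroups of index at most two,
    H included, and 2^(d-t) of them contain H[2], which has order 2^d; for the others |D[2]| =
    2^(d-1). Summing 1/(4 |D[2]|) over the proper ones gives (2 * 2^d - 2^(d-t) - 1) / (4 * 2^d),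
    that is 1/2 - 2^(-t-2) - 2^(-d-2), and D = H adds 1. For odd p only D = H exists, and [Gamma H]
    is in bijection with [Sym2 H] because 2 is invertible. *)

(* The tactic [zmod] below decides identities in a [zmodType] by comparing
   integer coefficients of the atoms. *)
Inductive zexp :=
  ZVar of nat | ZZero | ZAdd of zexp & zexp | ZOpp of zexp | ZMuln of zexp & nat.

Fixpoint zcoef (t : zexp) (i : nat) : int :=
  match t with
  | ZVar j => (i == j)%:Z
  | ZZero => 0
  | ZAdd t u => zcoef t i + zcoef u i
  | ZOpp t => - zcoef t i
  | ZMuln t n => zcoef t i * n%:Z
  end.

Fixpoint zeval (V : zmodType) (s : seq V) (t : zexp) : V :=
  match t with
  | ZVar j => s`_j
  | ZZero => 0
  | ZAdd t u => zeval s t + zeval s u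
  | ZOpp t => - zeval s t
  | ZMuln t n => zeval s t *+ n
  end.

Lemma zevalE (V : zmodType) (s : seq V) t :
  zeval s t = \sum_(i < size s) s`_i *~ zcoef t i.
Proof.
elim: t => [j||t IHt u IHu|t IHt|t IHt n] /=.
- have [js|sj] := ltnP j (size s); last first.
    rewrite nth_default // big1 // => i _; rewrite (_ : (val i == j) = false) ?mulr0z //.
    by apply/eqP => ij; move: (ltn_ord i); rewrite ij ltnNge sj.
  rewrite (bigD1 (Ordinal js)) //= eqxx big1 ?addr0 // => i.
  by rewrite -val_eqE /= => /negPf ->; rewrite mulr0z.
- by rewrite big1.
- by rewrite IHt IHu -big_split; apply: eq_bigr => i _; rewrite mulrzDr.
- by rewrite IHt -sumrN; apply: eq_bigr => i _; rewrite mulrNz.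
- by rewrite IHt -sumrMnl; apply: eq_bigr => i _; rewrite mulrzA -pmulrn.
Qed.

Lemma zeval_eq (V : zmodType) (s : seq V) t u :
  all (fun i => zcoef t i == zcoef u i) (iota 0 (size s)) ->
  zeval s t = zeval s u.
Proof.
move=> /allP tu; rewrite !zevalE; apply: eq_bigr => i _; congr (_ *~ _).
by apply/eqP/tu; rewrite mem_iota add0n /=.
Qed.

Ltac zmem x s :=
  match s with
  | nil => false
  | ?y :: _ => let _ := match goal with _ => unify x y end in true
  | _ :: ?s' => zmem x s'
  end.
Ltac zindex x s :=
  match s with
  | ?y :: _ => let _ := match goal with _ => unify x y end in O
  | _ :: ?s' => let n := zindex x s' in constr:(S n)
  end.
Ltac zclosed n :=
  lazymatch n with O => true | S ?m => zclosed m | _ => false end.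
Ltac zatom t s :=
  let b := zmem t s in
  lazymatch b with true => s | false => constr:(t :: s) end.
Ltac zatoms t s :=
  lazymatch t with
  | GRing.zero => s
  | ?a + ?b => let s1 := zatoms a s in zatoms b s1
  | - ?a => zatoms a s
  | ?a *+ ?n =>
      let b := zclosed n in
      lazymatch b with true => zatoms a s | false => zatom t s end
  | _ => zatom t s
  end.
Ltac zvar t s := let n := zindex t s in constr:(ZVar n).
Ltac zreify t s :=
  lazymatch t with
  | GRing.zero => constr:(ZZero)
  | ?a + ?b => let x := zreify a s in let y := zreify b s in constr:(ZAdd x y)
  | - ?a => let x := zreify a s in constr:(ZOpp x)
  | ?a *+ ?n =>
      let b := zclosed n in
      lazymatch b with
      | true => let x := zreify a s in constr:(ZMuln x n)
      | false => zvar t s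
      end
  | _ => zvar t s
  end.
Ltac zmod :=
  lazymatch goal with
  | |- ?l = ?r :> ?T =>
    let s0 := constr:(@nil T) in
    let s1 := zatoms l s0 in
    let s := zatoms r s1 in
    let t := zreify l s in
    let u := zreify r s in
    refine (@zeval_eq _ s t u _); vm_compute; reflexivity
  end.

Lemma generated_sub (V : zmodType) (E : set V) (S : pred V) :
  zmod_closed S -> E `<=` [set` S] -> forall v, generated E v -> S v.
Proof. by move=> cS ES v /asboolP; apply. Qed.

Lemma generated_mem (V : zmodType) (E : set V) v : E v -> generated E v.
Proof. by move=> Ev; apply/asboolP => S _; apply. Qed.

Definition sums_diffs (V : zmodType) (s : seq V) : set V :=
  [set x | exists a b, [/\ a \in s, b \in s & x = a + b \/ x = a - b]].

(** * Orbits under abstract moves *)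

Section Moves.
Variables (H : finZmodType) (e : nat).
Hypothesis e_gt0 : (0 < e)%N.
Hypothesis eH : forall h : H, h *+ e = 0.

(* The only features of "being in the same orbit of O_n(Z_p)" that the
   classification uses. *)
Record moves (eqv : seq H -> seq H -> Prop) : Prop := Moves {
  eqv_sym : forall s t, eqv s t -> eqv t s;
  eqv_trans : forall s t u, eqv s t -> eqv t u -> eqv s u;
  eqv_perm : forall s t, perm_eq s t -> eqv s t;
  eqv_opp : forall h s, eqv (h :: s) (- h :: s);
  eqv_shiftD : forall a b I r, (e.*2 %| size I)%N -> \sum_(x <- I) x = 0 ->
    eqv (a :: b :: I ++ r) (a :: b :: [seq x + (a + b) | x <- I] ++ r);
  eqv_shiftB : forall a b I r, (e.*2 %| size I)%N -> \sum_(x <- I) x = 0 ->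
    eqv (a :: b :: I ++ r) (a :: b :: [seq x + (a - b) | x <- I] ++ r) }.

Variable eqv : seq H -> seq H -> Prop.
Hypothesis eqvM : moves eqv.

Let sym := eqv_sym eqvM.
Let trans := eqv_trans eqvM.
Let permE := eqv_perm eqvM.

Lemma eqv_congr s t s' t' :
  perm_eq s s' -> perm_eq t t' -> eqv s t -> eqv s' t'.
Proof.
move=> ss' tt' st; apply: trans (permE tt'); apply: trans st.
by apply: permE; rewrite perm_sym.
Qed.

Lemma sum_map_addr (I : seq H) h :
  \sum_(x <- [seq y + h | y <- I]) x = \sum_(x <- I) x + h *+ size I.
Proof.
rewrite big_map big_split /=; congr (_ + _).
by rewrite big_const_seq count_predT iter_addr_0.
Qed.

Lemma mulrn_dvd (h : H) m : (e %| m)%N -> h *+ m = 0.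
Proof. by move=> /dvdnP [k ->]; rewrite mulnC mulrnA eH mul0rn. Qed.

Definition shifts (J : seq H) : pred H := fun h => `[< forall I r,
  (e.*2 %| size I)%N -> \sum_(x <- I) x = 0 ->
  eqv (J ++ I ++ r) (J ++ [seq x + h | x <- I] ++ r) >].

Lemma dvd_e2 m : (e.*2 %| m)%N -> (e %| m)%N.
Proof. by apply: dvdn_trans; rewrite -muln2 dvdn_mulr. Qed.

(** A shifted block still has zero sum, because [e] kills [H] and divides the size. Shifts therefore
    compose: a shift by [h - k] followed by one by [k] is a shift by [h]. *)
Lemma shifts_closed J : zmod_closed (shifts J).
Proof.
split=> [|h k /asboolP hJ /asboolP kJ]; apply/asboolP => I r eI I0.
  by apply: permE; under eq_map do rewrite addr0; rewrite map_id.
apply: trans (hJ I r eI I0) _; apply: sym.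
have := kJ [seq x + (h - k) | x <- I] r; rewrite size_map sum_map_addr.
rewrite (mulrn_dvd _ (dvd_e2 eI)) addr0 => /(_ eI I0).
rewrite -map_comp (_ : map (_ \o _) I = [seq x + h | x <- I]) //.
by apply: eq_map => x /=; rewrite -addrA subrK.
Qed.

Lemma shifts_pair J a b J' : perm_eq J (a :: b :: J') ->
  shifts J (a + b) /\ shifts J (a - b).
Proof.
move=> pJ; split; apply/asboolP => I r eI I0;
  [have := eqv_shiftD eqvM a b (J' ++ r) eI I0|
   have := eqv_shiftB eqvM a b (J' ++ r) eI I0];
  apply: eqv_congr; apply/seq.permP => P; move/seq.permP: pJ => /(_ P);
  rewrite /= !count_cat /= => ->; ring.
Qed.

(** The moves need two positions, whereas [sums_diffs] also contains [a + a] for an entry that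
    occurs once. That case is (a + b) + (a - b) for any other entry [b], which is why two entries
    are required. *)
Lemma shifts_sums_diffs J : (1 < size J)%N ->
  sums_diffs J `<=` [set` shifts J].
Proof.
have [cJ0 cJB] := shifts_closed J.
have cJD x y : shifts J x -> shifts J y -> shifts J (x + y).
  move=> xJ yJ; have := cJB x (0 - y) xJ (cJB 0 y cJ0 yJ).
  by rewrite sub0r opprK.
move=> sJ x [a [b [aJ bJ xE]]] /=.
have pa := perm_to_rem aJ.
have [ab|ab] := eqVneq a b; last first.
  have bJ' : b \in rem a J.
    by move: bJ; rewrite (perm_mem pa) inE eq_sym (negPf ab).
  have pb : perm_eq J (a :: b :: rem b (rem a J)).
    by apply: perm_trans pa _; rewrite perm_cons perm_to_rem.
  by have [? ?] := shifts_pair pb; case: xE => ->.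
subst b; case: xE => ->; last by rewrite subrr.
case: (rem a J) pa => [|b J'] pa.
  by move/perm_size: pa sJ => ->.
have [D B] := shifts_pair pa.
by have := cJD _ _ D B; rewrite addrACA subrr addr0.
Qed.

Variables (D : pred H) (h0 : H).
Hypothesis cD : zmod_closed D.
Hypothesis D2 : D (h0 + h0).

(** A good list acts as a catalyst: it stays unchanged and allows other blocks to be shifted by any
    element of [D]. *)
Definition good (J : seq H) := [/\ (1 < size J)%N,
  {in J, forall h, D (h - h0)} & forall x, D x -> generated (sums_diffs J) x].

Lemma shift_good J h I r : good J -> D h -> (e.*2 %| size I)%N ->
  \sum_(x <- I) x = 0 -> eqv (J ++ I ++ r) (J ++ [seq x + h | x <- I] ++ r).
Proof.
move=> [sJ _ JD] /JD hJ eI I0.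
have /asboolP : shifts J h; last exact.
exact: generated_sub (shifts_closed J) (shifts_sums_diffs sJ) _ hJ.
Qed.

Lemma good_sub J J' : (1 < size J')%N -> {subset J <= J'} ->
  {in J', forall h, D (h - h0)} -> good J -> good J'.
Proof.
move=> sJ' JJ' J'D [_ _ JD]; split=> // x /JD.
apply: generated_sub; first exact: generated_closed.
move=> y [a [b [aJ bJ yE]]]; apply: generated_mem.
by exists a, b; split=> //; exact: JJ'.
Qed.

(** A block of 2e equal entries has zero sum, so it may be shifted by [h0 - k]. *)
Lemma eqv_nseq J k r : good J -> D (k - h0) ->
  eqv (J ++ nseq e.*2 k ++ r) (J ++ nseq e.*2 h0 ++ r).
Proof.
move=> gJ kD; have kD' : D (h0 - k).
  by have [c0 cB] := cD; rewrite -opprB -sub0r; apply: cB.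
have := @shift_good J (h0 - k) (nseq e.*2 k) r gJ kD'.
rewrite size_nseq dvdnn map_nseq addrC subrK; apply=> //.
by rewrite big_nseq iter_addr_0 mulrn_dvd ?dvd_e2.
Qed.

Lemma eqv_nseq_mul J k r m : good J -> D (k - h0) ->
  eqv (J ++ nseq (m * e.*2) k ++ r) (J ++ nseq (m * e.*2) h0 ++ r).
Proof.
move=> gJ kD; elim: m r => [|m IHm] r; first exact: permE.
rewrite mulSn addnC !nseqD -!catA.
apply: trans (IHm _) _.
apply: eqv_congr (eqv_nseq (nseq (m * e.*2) h0 ++ r) gJ kD).
  by rewrite perm_cat2l perm_catCA.
by rewrite perm_cat2l perm_catCA.
Qed.

Lemma perm_count (s : seq H) :
  perm_eq s (flatten [seq nseq (count_mem h s) h | h <- index_enum H]).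
Proof.
apply/allP => x _ /=; rewrite count_flatten sumnE !big_map.
rewrite (bigD1 x) //= count_nseq /= eqxx mul1n big1 ?addn0 // => y yx.
by rewrite count_nseq /= (negPf yx).
Qed.

Lemma size_count (s : seq H) : size s = (\sum_h count_mem h s)%N.
Proof.
rewrite {1}(perm_size (perm_count s)) size_flatten sumnE !big_map.
by apply: eq_bigr => h _; rewrite size_nseq.
Qed.

Definition reduced (s : seq H) : seq H :=
  flatten [seq nseq (count_mem h s %% e.*2) h | h <- index_enum H] ++
  nseq (\sum_h count_mem h s %/ e.*2 * e.*2)%N h0.

Lemma eqv_reduced J s r : good J -> {in s, forall h, D (h - h0)} ->
  eqv (J ++ s ++ r) (J ++ reduced s ++ r).
Proof.
move=> gJ sD.
suff step (L : seq H) r' :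
    eqv (J ++ flatten [seq nseq (count_mem h s) h | h <- L] ++ r')
      (J ++ flatten [seq nseq (count_mem h s %% e.*2) h | h <- L] ++
       nseq (\sum_(h <- L) count_mem h s %/ e.*2 * e.*2)%N h0 ++ r').
  rewrite /reduced -!catA; apply: trans (step (index_enum H) r).
  by apply: permE; rewrite perm_cat2l perm_cat2r perm_count.
elim: L r' => [|h L IHL] r'; first by rewrite big_nil; exact: permE.
rewrite /= [X in nseq X h ++ _](divn_eq (count_mem h s) e.*2) nseqD big_cons.
set q := (_ %/ _)%N; set t := (_ %% _)%N.
have hq r'' : eqv (J ++ nseq (q * e.*2) h ++ r'') (J ++ nseq (q * e.*2) h0 ++ r'').
  case: (posnP (count_mem h s)) => [q0|].
    by rewrite /q q0 div0n mul0n; exact: permE.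
  by rewrite -has_count has_pred1 => /sD; exact: eqv_nseq_mul.
rewrite -!catA; apply: trans (hq _) _.
apply: eqv_congr (IHL (nseq (q * e.*2) h0 ++ nseq t h ++ r')).
  by apply/seq.permP => P; rewrite !count_cat; ring.
by apply/seq.permP => P; rewrite nseqD !count_cat; ring.
Qed.

(** Both lists have the same [reduced] form. Nothing is asked at [h0], since its multiplicity modulo
    2e follows from the size and the other multiplicities. *)
Lemma eqv_congruent J s t r : good J -> size s = size t ->
  {in s, forall h, D (h - h0)} -> {in t, forall h, D (h - h0)} ->
  (forall h, h != h0 -> (count_mem h s = count_mem h t %[mod e.*2])%N) ->
  eqv (J ++ s ++ r) (J ++ t ++ r).
Proof.
move=> gJ st sD tD cst.
suff Est : reduced s = reduced t.
  by apply: trans (eqv_reduced r gJ sD) _; rewrite Est; exact/sym/eqv_reduced.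
have c0 : (count_mem h0 s = count_mem h0 t %[mod e.*2])%N.
  have sumE : (\sum_(h | h != h0) count_mem h s =
               \sum_(h | h != h0) count_mem h t %[mod e.*2])%N.
    apply: (big_ind2 (fun x y => x = y %[mod e.*2])%N) => // x1 x2 y1 y2 Ex Ey.
    by rewrite -modnDm Ex Ey modnDm.
  move: st; rewrite !size_count (bigD1 h0) //= [in RHS](bigD1 h0) //= => st.
  apply/eqP; rewrite -(eqn_modDr (\sum_(h | h != h0) count_mem h t)%N).
  by rewrite -modnDmr -sumE modnDmr st.
have {c0}cst h : (count_mem h s %% e.*2 = count_mem h t %% e.*2)%N.
  by have [->|] := eqVneq h h0; [exact: c0|exact: cst].
rewrite /reduced; congr (_ ++ nseq _ _).
  by congr flatten; apply: eq_map => h; rewrite cst.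
have sumD (u : seq H) : (\sum_h count_mem h u %/ e.*2 * e.*2 =
    size u - \sum_h count_mem h u %% e.*2)%N.
  rewrite size_count; under [X in (X - _)%N]eq_bigr do rewrite (divn_eq (count_mem _ _) e.*2).
  by rewrite big_split addnK.
by rewrite !sumD st; congr (_ - _)%N; apply: eq_bigr => h _; rewrite cst.
Qed.

(* [c] is trivial when a block of entries with multiplicities [c] modulo [2e],
   up to copies of [h0], may be exchanged for copies of [h0].  The quadratic map
   to which the universality of [Gamma] will be applied is
   [h |-> free_gen h] modulo [triv]. *)
Definition triv_witness (c : {ffun H -> int}) (a : seq H) : Prop :=
  [/\ {in a, forall h, D (h - h0)},
      forall h, h != h0 -> (e.*2 %| c h - (count_mem h a)%:Z)%Z
    & forall J r, good J -> eqv (J ++ a ++ r) (J ++ nseq (size a) h0 ++ r)].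

Definition triv : pred {ffun H -> int} :=
  fun c => `[< exists a, triv_witness c a >].

Let D0 : D (h0 - h0).
Proof. by rewrite subrr; case: cD. Qed.

Lemma count_flatten_nseq (s : seq H) m h :
  count_mem h (flatten (nseq m s)) = (m * count_mem h s)%N.
Proof. by elim: m => // m IHm; rewrite /= count_cat IHm mulSn. Qed.

Lemma eqv_flatten_nseq J a m r : good J ->
  (forall J r, good J -> eqv (J ++ a ++ r) (J ++ nseq (size a) h0 ++ r)) ->
  eqv (J ++ flatten (nseq m a) ++ r) (J ++ nseq (m * size a) h0 ++ r).
Proof.
move=> gJ ea; elim: m r => [|m IHm] r; first exact: permE.
rewrite /= mulSn nseqD -!catA; apply: trans (ea _ _ gJ) _.
apply: eqv_congr (IHm (nseq (size a) h0 ++ r)).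
  by rewrite perm_cat2l perm_catCA.
by rewrite perm_cat2l perm_catCA.
Qed.

Lemma triv_closed : zmod_closed triv.
Proof.
split=> [|c c' /asboolP [a [aD ca ea]] /asboolP [a' [aD' ca' ea']]].
  apply/asboolP; exists [::]; split=> // [h _|J r _].
    by rewrite ffunE subrr dvdz0.
  exact: permE.
(* Multiplicities only matter modulo 2e, so 2e - 1 copies of [a'] stand for minus [a']. *)
apply/asboolP; exists (a ++ flatten (nseq (e.*2).-1 a')); split=> [h|h hh0|J r gJ].
- rewrite mem_cat => /orP [/aD //|/flattenP [s]].
  by rewrite mem_nseq => /andP [_ /eqP ->] /aD'.
- rewrite count_cat count_flatten_nseq !ffunE.
  have := ca _ hh0; have := ca' _ hh0.
  set x := count_mem h a; set x' := count_mem h a'.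
  move=> /dvdzP [k' k'E] /dvdzP [k kE]; apply/dvdzP; exists (k - k' - x'%:Z).
  have -> : c h = k * (e.*2)%:Z + x%:Z by rewrite -kE subrK.
  have -> : c' h = k' * (e.*2)%:Z + x'%:Z by rewrite -k'E subrK.
  have : (0 < e.*2)%N by rewrite double_gt0.
  case: (e.*2) => // N _ /=; rewrite PoszD PoszM -addn1 PoszD; ring.
- rewrite -!catA; apply: trans (ea _ _ gJ) _.
  rewrite size_cat (_ : size (flatten _) = (e.*2).-1 * size a')%N; last first.
    by elim: (_.-1) => //= m IHm; rewrite size_cat IHm mulSn.
  have := @eqv_flatten_nseq J a' (e.*2).-1 (nseq (size a) h0 ++ r) gJ ea'.
  by apply: eqv_congr; rewrite ?nseqD -?catA perm_cat2l perm_catCA.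
Qed.

Lemma pigeonhole (s : seq H) m : (#|H| * m < size s)%N ->
  exists k, (m < count_mem k s)%N.
Proof.
move=> ms; apply: contrapT => km; move: ms; rewrite size_count ltnNge => /negP; apply.
rewrite -sum_nat_const; apply: leq_sum => k _; rewrite leqNgt; apply/negP => ?.
by apply: km; exists k.
Qed.

(** Some [k] occurs more than m + 1 times. At least two copies of it stay in [J], which therefore
    has two entries and the same elements as [F], and remains good. *)
Lemma good_extract F m : good F -> (#|H| * m.+1 < size F)%N ->
  exists J k, [/\ perm_eq F (J ++ nseq m k), good J & D (k - h0)].
Proof.
move=> gF /pigeonhole [k km].
have kF : k \in F by rewrite -has_pred1 has_count; apply: leq_ltn_trans km.
pose J := nseq (count_mem k F - m) k ++ [seq x <- F | x != k].
have pF : perm_eq F (J ++ nseq m k).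
  apply/allP => x _ /=; rewrite !count_cat !count_nseq count_filter /=.
  have [->|xk] := eqVneq x k; last first.
    rewrite !mul0n add0n addn0; apply/eqP/eq_count => y /=.
    by have [->|//] := eqVneq y x; rewrite (negPf xk).
  rewrite !mul1n (_ : count (predI _ _) F = 0)%N.
    by rewrite addn0 subnK // ltnW // ltnW.
  by rewrite (eq_count (a2 := pred0)) ?count_pred0 // => y /=; rewrite andbN.
have FJ : {subset F <= J}.
  move=> x xF; rewrite mem_cat mem_filter xF andbT mem_nseq.
  by case: eqVneq => [_|//]; rewrite subn_gt0 (ltnW km).
have JF : {subset J <= F}.
  move=> x; rewrite mem_cat mem_filter mem_nseq.
  by case/orP => [/andP [_ /eqP ->]|/andP []].
have [_ FD _] := gF.
exists J, k; split=> //; last exact: FD.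
apply: good_sub FJ _ gF => [|x /JF /FD //].
by rewrite size_cat size_nseq; apply: leq_trans (leq_addr _ _); rewrite ltn_subRL addn1.
Qed.

Definition diff_count (s t : seq H) : {ffun H -> int} :=
  [ffun h => (count_mem h s)%:Z - (count_mem h t)%:Z].

(** Being in [triv] depends only on [c] modulo 2e, which leaves finitely many classes. A uniform
    bound is needed because the threshold in [eqv_triv] is chosen before the lists. *)
Lemma triv_bound : exists M, forall c, triv c ->
  exists2 a, triv_witness c a & (size a <= M)%N.
Proof.
have e2_gt0 : (0 < e.*2)%N by rewrite double_gt0.
pose lift (c : {ffun H -> 'I_e.*2}) : {ffun H -> int} := [ffun h => (c h : nat)%:Z].
have [f fP] : {f : {ffun H -> 'I_e.*2} -> seq H &
    forall c, triv (lift c) -> triv_witness (lift c) (f c)}.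
  apply: (@choice _ _ (fun c a => triv (lift c) -> triv_witness (lift c) a)) => c.
  by case: (boolP (triv (lift c))) => [/asboolP [a ac]|_]; [exists a|exists [::]].
exists (\max_c size (f c))%N => c tc.
have cP h : (`|(c h %% e.*2)%Z| < e.*2)%N.
  rewrite -ltz_nat gez0_abs ?modz_ge0 ?ltz_pmod //; lia.
pose c' : {ffun H -> 'I_e.*2} := [ffun h => Ordinal (cP h)].
have cc' h : (e.*2 %| c h - lift c' h)%Z.
  rewrite !ffunE /= gez0_abs ?modz_ge0 //; last by lia.
  by rewrite {1}(divz_eq (c h) e.*2) addrK dvdz_mull.
have wit (c1 c2 : {ffun H -> int}) a : (forall h, (e.*2 %| c1 h - c2 h)%Z) ->
    triv_witness c2 a -> triv_witness c1 a.
  move=> c12 [aD c2a ea]; split=> // h /c2a c2h.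
  by rewrite -(subrK (c2 h) (c1 h)) -addrA rpredD.
have /fP w : triv (lift c').
  case/asboolP: tc => a aw; apply/asboolP; exists a; apply: wit aw => h.
  by rewrite -opprB rpredN; exact: cc'.
by exists (f c'); [exact: wit w|exact: leq_bigmax].
Qed.

Lemma eqv_triv : exists n0, forall F F',
  size F = size F' -> (n0 <= size F)%N -> good F -> good F' ->
  triv (diff_count F F') -> eqv F F'.
Proof.
have e2_gt0 : (0 < e.*2)%N by rewrite double_gt0.
have [M MP] := triv_bound.
(* The whole coset, listed twice so that there are two entries even if [D] is trivial. It contains
   every entry of [F], hence is good. *)
pose R0 := [seq h <- index_enum H | D (h - h0)]; pose R := R0 ++ R0.
have RP h : (h \in R) = D (h - h0).
  by rewrite mem_cat orbb mem_filter mem_index_enum andbT.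
have gR F : good F -> good R.
  move=> gF; have [sF FD _] := gF; apply: good_sub gF; first 2 last.
  - by move=> h; rewrite RP.
  - rewrite size_cat; suff : (0 < size R0)%N by case: (size R0) => // m; lia.
    by rewrite lt0n size_eq0; apply/eqP => R00; move: (RP h0); rewrite /R R00 D0.
  - by move=> h /FD; rewrite RP.
(* A multiple of 2e, so that [m] equal entries can be turned into [h0], and large enough to turn
   these into 2e copies of [R] with [size a] copies of [h0] to spare. *)
pose m := ((e.*2) * (size R + M))%N.
exists (#|H| * m.+1).+1 => F F' FF' nF gF gF' tF.
have [J [k [pF gJ kD]]] := good_extract gF nF.
have [J' [k' [pF' gJ' kD']]] : exists J k,
  [/\ perm_eq F' (J ++ nseq m k), good J & D (k - h0)].
  by apply: good_extract; rewrite -?FF'.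
have extract G K x : perm_eq G (K ++ nseq m x) -> good K -> D (x - h0) ->
    eqv G (K ++ nseq m h0).
  move=> pG gK xD; apply: trans (permE pG) _.
  have := eqv_nseq_mul [::] (size R + M) gK xD.
  by rewrite !cats0 mulnC.
apply: trans (extract _ _ _ pF gJ kD) _.
apply: trans (sym (extract _ _ _ pF' gJ' kD')).
have JJ' : size J = size J'.
  apply/eqP; rewrite -(eqn_add2r m).
  move/perm_size: pF; move/perm_size: pF'.
  by rewrite !size_cat !size_nseq -FF' => -> ->.
have [a [aD ca ea] aM] := MP _ tF.
have {}gR : good R by apply: gR gF.
have [J_D J'_D R_D] : [/\ {in J, forall h, D (h - h0)},
    {in J', forall h, D (h - h0)} & {in R, forall h, D (h - h0)}].
  by case: gJ; case: gJ'; case: gR.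
pose RN i := flatten (nseq i R).
have size_RN i : size (RN i) = (i * size R)%N.
  by rewrite /RN; elim: i => //= i IHi; rewrite size_cat IHi mulSn.
have RN_D i : {in RN i, forall h, D (h - h0)}.
  by move=> h /flattenP [s]; rewrite mem_nseq => /andP [_ /eqP ->]; exact: R_D.
have D0s i : {in nseq i h0, forall h, D (h - h0)}.
  by move=> h; rewrite mem_nseq => /andP [_ /eqP ->]; exact: D0.
have catD s t : {in s, forall h, D (h - h0)} -> {in t, forall h, D (h - h0)} ->
    {in s ++ t, forall h, D (h - h0)}.
  by move=> sD tD h; rewrite mem_cat => /orP [/sD|/tD].
have [z zE] : exists z, m = (e.*2 * size R + size a + z)%N.
  exists (m - (e.*2 * size R + size a))%N; rewrite subnKC // /m mulnDr leq_add2l.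
  by apply: leq_trans aM _; rewrite leq_pmull.
have blocks K : good K -> {in K, forall h, D (h - h0)} ->
    eqv (K ++ nseq m h0) (R ++ (K ++ RN e.*2.-1 ++ nseq (size a) h0) ++ nseq z h0).
  move=> gK KD; rewrite zE !nseqD; apply: trans (_ : eqv _
    (K ++ RN e.*2 ++ (nseq (size a) h0 ++ nseq z h0))) _.
    rewrite -catA; apply: eqv_congruent => //.
      by rewrite size_nseq size_RN.
    move=> h hh0; rewrite count_nseq /= eq_sym (negPf hh0) mul0n.
    by rewrite count_flatten_nseq mulnC modnMl mod0n.
  rewrite -{1}(prednK e2_gt0) {1}/RN /= -/(RN _).
  by apply: permE; apply/seq.permP => P; rewrite !count_cat; ring.
apply: trans (blocks J gJ J_D) _; apply: trans (sym (blocks J' gJ' J'_D)).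
(* One copy of [R] serves as catalyst. Since [a] represents the difference of the multiplicities of
   [F] and [F'] modulo 2e, the lists [J] with copies of [h0] and [J'] with [a] are congruent away
   from [h0]; the witness property of [a] then turns [a] into copies of [h0]. *)
apply: trans (_ : eqv _ (R ++ (J' ++ RN e.*2.-1 ++ a) ++ nseq z h0)) _.
  apply: eqv_congruent => //.
  - by rewrite !size_cat JJ' size_nseq.
  - by apply: (catD) => //; apply: (catD); [exact: RN_D|exact: D0s].
  - by apply: (catD) => //; apply: (catD); [exact: RN_D|exact: aD].
  move=> h hh0; rewrite !count_cat count_nseq /= eq_sym (negPf hh0) mul0n addn0.
  rewrite addnC [in RHS]addnCA; apply/eqP; rewrite eqn_modDl.
  have := ca _ hh0; rewrite ffunE.
  move/seq.permP: pF => /(_ (pred1 h)); move/seq.permP: pF' => /(_ (pred1 h)).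
  rewrite !count_cat !count_nseq => -> -> /=.
  set x := count_mem h J; set y := count_mem h J'; set w := count_mem h a.
  move=> dvd_w; suff : (e.*2 %| x%:Z - (y + w)%:Z)%Z.
    by rewrite -eqz_mod_dvd !modz_nat.
  set u := nat_of_bool _ in dvd_w; set v := nat_of_bool _ in dvd_w.
  have dvd_m : (e.*2 %| m%:Z)%Z by rewrite /m PoszM dvdz_mulr.
  have := rpredD dvd_w (dvdz_mull (v%:Z - u%:Z) dvd_m).
  by congr (_ %| _)%Z; rewrite !PoszD !PoszM; ring.
apply: eqv_congr (ea (R ++ J') (RN e.*2.-1 ++ nseq z h0) _).
- by apply/seq.permP => P; rewrite !count_cat; ring.
- by apply/seq.permP => P; rewrite !count_cat; ring.
apply: good_sub (gR); first by rewrite size_cat ltn_addr //; case: gR.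
  by move=> h hR; rewrite mem_cat hR.
exact: catD.
Qed.

Lemma triv_h0 : triv (free_gen h0).
Proof.
apply/asboolP; exists [::]; split=> // [h /negPf hh0|J r _]; last exact: permE.
by rewrite ffunE hh0 subr0 dvdz0.
Qed.

Let DN h : D h -> D (- h).
Proof. by case: (cD) => c0 cB Dh; rewrite -sub0r; apply: cB. Qed.

Let DD h k : D h -> D k -> D (h + k).
Proof. by case: (cD) => c0 cB Dh Dk; rewrite -[k]opprK; apply: cB => //; apply: DN. Qed.

Lemma eqv_opp_mid J r h : eqv (J ++ h :: r) (J ++ - h :: r).
Proof.
apply: eqv_congr (eqv_opp eqvM h (J ++ r)).
  by apply/seq.permP => P; rewrite /= !count_cat /=; ring.
by apply/seq.permP => P; rewrite /= !count_cat /=; ring.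
Qed.

Let e2_gt0 : (0 < e.*2)%N. Proof. by rewrite double_gt0. Qed.

Let pred_e2 : (e.*2).-1%:Z = (e.*2)%:Z - 1.
Proof. by rewrite -{2}(prednK e2_gt0) -addn1 PoszD addrK. Qed.

(** The witness is [h] with 2e - 1 copies of [- h]: negating the single [h] leaves 2e equal entries,
    which turn into [h0]. *)
Lemma triv_opp h : D (h - h0) -> triv (free_gen h - free_gen (- h)).
Proof.
move=> hD; have hD' : D (- h - h0).
  rewrite (_ : - h - h0 = - ((h - h0) + (h0 + h0))); first by apply/DN/DD.
  by rewrite addrA subrK opprD.
apply/asboolP; exists (h :: nseq (e.*2).-1 (- h)); split.
- move=> x; rewrite inE => /orP [/eqP -> //|].
  by rewrite mem_nseq => /andP [_ /eqP ->].
- move=> x _; rewrite !ffunE /= count_nseq /= [h == x]eq_sym [- h == x]eq_sym.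
  rewrite !natz PoszD PoszM pred_e2.
  by apply/dvdzP; exists (- (x == - h)%:Z); ring.
- move=> J r gJ; rewrite /= size_nseq.
  apply: trans (eqv_opp_mid J _ h) _.
  have := eqv_nseq r gJ hD'.
  by rewrite -(prednK e2_gt0).
Qed.

(** This is the vanishing of third differences on the coset. The eighth vertex [h0] is omitted
    because [free_gen h0] is already trivial; vertices with a minus sign get multiplicity 2e - 1. *)
Lemma triv_parallelepiped x y z : D x -> D y -> D z ->
  triv (free_gen (h0 + (x + y + z)) + free_gen (h0 + x) + free_gen (h0 + y)
    + free_gen (h0 + z) - free_gen (h0 + (x + y)) - free_gen (h0 + (y + z))
    - free_gen (h0 + (x + z))).
Proof.
move=> Dx Dy Dz; pose N1 := (e.*2).-1.
have hN1 (h : H) : h *+ N1 = - h.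
  apply/eqP; rewrite -addr_eq0 -{2}[h]mulr1n -mulrnDr addn1 prednK //.
  by rewrite mulrn_dvd // -muln2 dvdn_mulr.
apply/asboolP; exists ([:: h0 + (x + y + z); h0 + x; h0 + y; h0 + z] ++
  nseq N1 (h0 + (x + y)) ++ nseq N1 (h0 + (y + z)) ++ nseq N1 (h0 + (x + z))).
have hD h : D h -> D (h0 + h - h0) by rewrite addrAC subrr add0r.
split.
- apply/(@allP _ (fun h => D (h - h0))); rewrite !all_cat /= !all_nseq.
  by rewrite !hD ?orbT //; do ?apply: DD.
- move=> h _; rewrite !count_cat !count_nseq /= !ffunE !(eq_sym h).
  set b1 := _ == h; set b2 := _ == h; set b3 := _ == h; set b4 := _ == h.
  set b5 := _ == h; set b6 := _ == h; set b7 := _ == h.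
  rewrite !natz !PoszD !PoszM pred_e2.
  apply/dvdzP; exists (- b5%:Z - b6%:Z - b7%:Z).
  ring.
- move=> J r gJ; apply: sym.
  have step u (I s t : seq H) r' : D u -> size I = (2 * e.*2)%N ->
      \sum_(v <- I) v = 0 -> perm_eq s (I ++ r') ->
      perm_eq t ([seq v + u | v <- I] ++ r') -> eqv (J ++ s) (J ++ t).
    move=> Du sI I0 ps pt; apply: eqv_congr (shift_good r' gJ Du _ I0).
    - by rewrite perm_cat2l perm_sym.
    - by rewrite perm_cat2l perm_sym.
    - by rewrite sI dvdn_mull.
  pose n1 (h : H) := nseq N1 h.
  have sum_n1 h s : \sum_(v <- n1 h ++ s) v = - h + \sum_(v <- s) v.
    by rewrite big_cat big_nseq iter_addr_0 hN1.
  have size_n1 (a b : H) : size ([:: a; b] ++ n1 a ++ n1 b) = (2 * e.*2)%N.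
    by rewrite !size_cat !size_nseq /= /N1; lia.
  (* Starting from copies of [h0] only, shift by [x], then [y], then [z], each
     time a block of [4e] entries with zero sum. *)
  apply: trans (step x (nseq (2 * e.*2) h0) _ ([:: h0 + x; h0 + x; h0; h0] ++
    n1 (h0 + x) ++ n1 h0 ++ n1 (h0 + x) ++ r) ([:: h0; h0] ++ n1 h0 ++ r) Dx _ _ _ _) _.
  + by rewrite size_nseq.
  + by rewrite big_nseq iter_addr_0 mulrn_dvd ?dvdn_mull ?dvd_e2.
  + apply/seq.permP => P; rewrite !size_cat !size_nseq !count_cat !count_nseq /= /N1.
    case: (e.*2) e2_gt0 => // N _; rewrite /=; ring.
  + apply/seq.permP => P; rewrite map_nseq !count_cat !count_nseq /= /N1.
    case: (e.*2) e2_gt0 => // N _; rewrite /=; ring.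
  apply: trans (step y ([:: h0 + x; h0] ++ n1 (h0 + x) ++ n1 h0) _
    ([:: h0 + x + y; h0 + x; h0 + y; h0] ++
    n1 (h0 + x + y) ++ n1 (h0 + y) ++ n1 (h0 + x) ++ r)
    ([:: h0 + x; h0] ++ n1 (h0 + x) ++ r) Dy (size_n1 _ _) _ _ _) _.
  + rewrite !big_cons sum_n1 -[n1 h0]cats0 sum_n1 big_nil.
    zmod.
  + by apply/seq.permP => P; rewrite !count_cat !count_nseq /=; ring.
  + by apply/seq.permP => P; rewrite !map_cat !map_nseq !count_cat !count_nseq /=; ring.
  apply: (step z ([:: h0 + x + y; h0] ++ n1 (h0 + y) ++ n1 (h0 + x)) _ _
    ([:: h0 + x; h0 + y] ++ n1 (h0 + x + y) ++ r) Dz).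
  + by rewrite !size_cat !size_nseq /= /N1; lia.
  + rewrite !big_cons sum_n1 -[n1 (h0 + x)]cats0 sum_n1 big_nil.
    zmod.
  + by apply/seq.permP => P; rewrite !count_cat !count_nseq /=; ring.
  + apply/seq.permP => P; rewrite !map_cat !map_nseq !count_cat !count_nseq /=.
    by rewrite !addrA [h0 + y + z]addrAC; ring.
Qed.

Definition trivQ := zquot triv_closed.
HB.instance Definition _ := GRing.Zmodule.on trivQ.
Definition triv_cl (h : H) : trivQ := zproj triv_closed (free_gen h).

End Moves.

(** Evenness gives [polar q x (- x)] the value -2 q(x), and additivity turns this into [polar q x x]
    = 2 q(x); the rule q(nx) = n^2 q(x) follows by induction on n. *)
Lemma quadratic_of_even (V W : zmodType) (q : V -> W) :
  biadditive (polar q) -> (forall x, q (- x) = q x) -> homogeneous_quadratic q.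
Proof.
move=> bq qN; split=> //; have [Dl Dr] := bq.
have q0 : q 0 = 0.
  have := Dl 0 0 0; rewrite /polar !addr0 => /eqP.
  by rewrite -subr_eq0 => /eqP E; rewrite -[RHS]E; zmod.
have Pxx x : polar q x x = q x *+ 2.
  have := Dr x x (- x); rewrite subrr.
  have -> : polar q x 0 = 0 by rewrite /polar addr0 q0; zmod.
  have -> : polar q x (- x) = - (q x *+ 2) by rewrite /polar subrr q0 qN; zmod.
  by move=> /esym/eqP; rewrite subr_eq0 => /eqP.
have Pn n x : polar q (x *+ n) x = q x *+ 2 *+ n.
  elim: n => [|n IHn]; last by rewrite [x *+ _]mulrSr Dl IHn Pxx -mulrSr.
  by rewrite !mulr0n /polar add0r q0; zmod.
have qn n x : q (x *+ n) = q x *+ (n ^ 2).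
  elim: n => [|n IHn]; first by rewrite !mulr0n q0.
  have := Pn n x; rewrite /polar -mulrSr IHn => /eqP.
  rewrite subr_eq => /eqP E.
  rewrite -[LHS](subrK (q x *+ (n ^ 2)%N)) E -mulrnA -mulrSr -mulrnDr.
  by congr (_ *+ _); rewrite -addn1; ring.
have qz n x : q (x *~ n%:Z) = q x *~ (n%:Z ^+ 2).
  by rewrite -pmulrn qn pmulrn expnS expn1 PoszM.
by case=> n x; rewrite ?NegzE ?mulrNz ?qN ?sqrrN qz.
Qed.

(** * Quadratic maps on a coset *)

Section CosetQuadratic.
Variables (H Q : zmodType) (D : pred H) (h0 : H) (q : H -> Q).

Definition coset_quadratic : Prop :=
  [/\ q h0 = 0,
      forall h, D (h - h0) -> q (- h) = q h
    & forall x y z, D x -> D y -> D z ->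
        q (h0 + (x + y + z)) + q (h0 + x) + q (h0 + y) + q (h0 + z)
        - q (h0 + (x + y)) - q (h0 + (y + z)) - q (h0 + (x + z)) = 0].

End CosetQuadratic.

Lemma coset_quadratic_full (H Q : zmodType) (q : H -> Q) :
  coset_quadratic predT 0 q -> homogeneous_quadratic q.
Proof.
move=> [q0 qN q3]; apply: quadratic_of_even; last by move=> x; apply: qN.
have P3 x y z : polar q (x + y) z = polar q x z + polar q y z.
  have := q3 x y z isT isT isT; rewrite !add0r => E.
  by rewrite -[RHS]addr0 -E /polar; zmod.
have PC x y : polar q x y = polar q y x by rewrite /polar [x + y]addrC; zmod.
by split=> // x y z; rewrite PC P3 !(PC _ x).
Qed.

(* A quadratic function [q] on the coset [h0 + D] of a subgroup of index two
   extends to a quadratic map on [H] after an injective enlargement of its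
   target: [(a, x, m)] stands for [a], plus the value at [x] of a linear form
   adjoined freely, plus [m] times a new constant.  The extension sends
   [h0 *~ m + x] to [Q2 m x]; the relations [ext_rel] are what makes this
   independent of the choice of [m] and [x]. *)
Section Extension.
Variables (H Q : zmodType) (D : pred H) (h0 : H) (q : H -> Q).
Hypothesis cD : zmod_closed D.
Hypothesis D2 : D (h0 + h0).
Hypothesis Dh0 : ~~ D h0.
Hypothesis Dcover : forall h, D h \/ D (h - h0).
Hypothesis qq : coset_quadratic D h0 q.

Let t := h0 + h0.
Let q1 x := q (h0 + x).
Let B x y := q1 (x + y) - q1 x - q1 y.

Let sD : zmodClosed H := subgroup cD.
Let DD x y : D x -> D y -> D (x + y). Proof. by move=> *; apply: (@rpredD _ sD). Qed.
Let DN x : D x -> D (- x). Proof. by move=> Dx; rewrite -[D _]/(- x \in sD) rpredN. Qed.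
Let DM x n : D x -> D (x *~ n).
Proof. by move=> Dx; apply: (@rpredMz _ sD). Qed.
Let D0 : D 0. Proof. exact: (@rpred0 _ sD). Qed.

Let q1_0 : q1 0 = 0. Proof. by rewrite /q1 addr0; case: qq. Qed.

Let q1_opp x : D x -> q1 (- x - t) = q1 x.
Proof.
move=> Dx; have [_ qN _] := qq; rewrite /q1 -(qN (h0 + x)); last by rewrite addrAC subrr add0r.
by congr q; rewrite /t; zmod.
Qed.

Let BDl x y z : D x -> D y -> D z -> B (x + y) z = B x z + B y z.
Proof.
move=> Dx Dy Dz; have [_ _ /(_ x y z Dx Dy Dz) E] := qq.
by rewrite -[RHS]addr0 -E /B /q1; zmod.
Qed.

Let BC x y : B x y = B y x. Proof. by rewrite /B [x + y]addrC; zmod. Qed.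

Let B0l x : B 0 x = 0. Proof. by rewrite /B add0r q1_0; zmod. Qed.

Let BNl x y : D x -> D y -> B (- x) y = - B x y.
Proof.
move=> Dx Dy; apply/eqP; rewrite -addr_eq0 -BDl ?DN //.
by rewrite addNr B0l.
Qed.

Let Bopp x : D x -> B x t = q1 x - q1 (- x).
Proof.
move=> Dx; have := q1_opp D0; rewrite oppr0 add0r q1_0 => qt.
have := BNl D2 Dx; rewrite BC [B t x]BC.
have -> : B x (- t) = q1 (x - t) - q1 x by rewrite /B qt; zmod.
rewrite -[x in q1 (x - t)]opprK q1_opp ?DN // => E.
by rewrite -[LHS]opprK -E; zmod.
Qed.

Let Bself x : D x -> q1 (- x) - q1 x = - B x t.
Proof. by move=> Dx; rewrite Bopp //; zmod. Qed.

Definition ext_rel : pred (Q * H * int) := fun u =>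
  `[< exists k j, D k /\ u = (- B k t, k *+ 2 + t *~ j, j *- 4) >].

Lemma ext_rel_closed : zmod_closed ext_rel.
Proof.
split=> [|_ _ /asboolP [k [j [Dk ->]]] /asboolP [k' [j' [Dk' ->]]]]; apply/asboolP.
  exists 0, 0; split=> //; rewrite B0l mulr0z; congr (_, _, _).
  - by rewrite oppr0.
  - by zmod.
exists (k - k'), (j - j'); split; first by apply: DD => //; apply: DN.
congr (_, _, _); rewrite ?mulrzBr.
- by rewrite BDl ?BNl ?DN //=; zmod.
- by rewrite /=; zmod.
- by rewrite /=; ring.
Qed.

Definition ext := zquot ext_rel_closed.
HB.instance Definition _ := GRing.Zmodule.on ext.

Definition ext_cl (a : Q) (x : H) (m : int) : ext := zproj ext_rel_closed (a, x, m).

Lemma ext_clD a x m a' x' m' :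
  ext_cl (a + a') (x + x') (m + m') = ext_cl a x m + ext_cl a' x' m'.
Proof. by rewrite /ext_cl -raddfD. Qed.

Lemma ext_cl_eq a x m a' x' m' : ext_cl a x m = ext_cl a' x' m' <->
  exists k j, D k /\ (a - a', x - x', m - m') = (- B k t, k *+ 2 + t *~ j, j *- 4).
Proof.
have E : ext_cl a x m - ext_cl a' x' m' =
    zproj ext_rel_closed (a - a', x - x', m - m').
  by rewrite /ext_cl -raddfB.
split=> [/eqP|kj]; first by rewrite -subr_eq0 E zproj_eq0 => /asboolP.
by apply/eqP; rewrite -subr_eq0 E zproj_eq0; apply/asboolP.
Qed.

(** The last coordinate forces j = 0 and the middle one then gives 2k = 0. Hence k = -k, and
    evenness of [q] on the coset, in the form [Bopp], makes [B k t] vanish. *)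
Lemma ext_cl_inj a a' m : ext_cl a 0 m = ext_cl a' 0 m -> a = a'.
Proof.
case/ext_cl_eq => k [j [Dk [Ea Ex Ej]]].
have j0 : j = 0 by move: Ej; rewrite subrr; lia.
move: Ex; rewrite j0 mulr0z subrr addr0 => /esym k2.
apply/eqP; rewrite -subr_eq0 Ea Bopp // (_ : - k = k) ?subrr ?oppr0 //.
by rewrite -[RHS]subr0 -k2; zmod.
Qed.

(** A quadratic map takes at [h0 *~ m + x] the value m^2 c + m L(x) + Q(x), with c its value at [h0]
    and L its polar form against [h0]. Prescribing [q1 x] + c at m = 1 forces Q(x) = [q1 x] - L(x).
    Here L(x) and c are the free generators in the second and third coordinates. *)
Let Q2 (m : int) (x : H) : ext := ext_cl (q1 x) (x *~ (m - 1)) (m ^+ 2).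

(** The difference of the two triples is the element of [ext_rel] with k = x and j = -(m + 1), so
    [ext_rel] consists of exactly the relations that this identity demands. *)
Let Q2_shift m x : D x -> Q2 (m + 2) (x - t) = Q2 m x.
Proof.
move=> Dx; apply/ext_cl_eq; exists x, (- (m + 1)); split=> //.
congr (_, _, _).
- rewrite -[x in q1 (x - t)]opprK q1_opp ?DN // Bself //.
- rewrite -[m - 1](addrK 2) (_ : m - 1 + 2 = m + 1); last by ring.
  rewrite (_ : m + 2 - 1 = m + 1); last by ring.
  rewrite mulrzBl mulrNz mulrzBr (_ : x *~ 2 = x *+ 2) //.
  by zmod.
- by rewrite -mulNrn -mulr_natr; ring.
Qed.

Let Q2_rep m m' x x' : D x -> D x' -> h0 *~ m + x = h0 *~ m' + x' -> Q2 m x = Q2 m' x'.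
Proof.
have shift i n y : D y -> Q2 (n + (i.*2)%:Z) (y - t *~ i%:Z) = Q2 n y.
  elim: i n y => [|i IHi] n y Dy.
    by rewrite double0 -[0%:Z]/(0 : int) mulr0z addr0 subr0.
  rewrite -addn1 doubleD PoszD addrA PoszD mulrzDr mulr1z opprD addrA.
  by rewrite Q2_shift ?IHi //; apply: DD => //; apply/DN/DM.
wlog mm' : m m' x x' / m' <= m => [wlg Dx Dx' E|Dx Dx' E].
  by have [/wlg|/ltW/wlg] := lerP m' m; [exact|move=> w; apply/esym/w].
have mE : h0 *~ (m - m') = x' - x.
  by rewrite mulrzBr -[h0 *~ m](addrK x) E; zmod.
have [i iE] : exists i : nat, m - m' = i%:Z.
  by exists `|m - m'|%N; rewrite gez0_abs // subr_ge0.
(* The difference of the two values of [m] is even, since [h0] is not in [D]; repeated use of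
   [Q2_shift] then suffices. *)
move: mE; rewrite iE -(odd_double_half i) PoszD mulrzDr.
have tE j : h0 *~ (j.*2)%:Z = t *~ j%:Z.
  by rewrite -muln2 mulnC PoszM mulrzA; congr (_ *~ _); rewrite /t -pmulrn mulr2n.
rewrite tE; case: (odd i) (iE) (odd_double_half i) => /= iE' iE2 mE.
  case/negP: Dh0; rewrite (_ : h0 = x' - x - t *~ i./2%:Z).
    by apply: DD; [apply: DD => //; apply: DN|apply/DN/DM].
  by rewrite -mE mulr1z addrK.
move: mE; rewrite mulr0z add0r => mE.
have -> : m = m' + (i./2.*2)%:Z.
  rewrite -[m in LHS](subrK m') iE' addrC; congr (_ + Posz _).
  by rewrite -[LHS]iE2 add0n.
rewrite -(@shift i./2 m' x') //; congr (Q2 _ _); rewrite mE.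
by zmod.
Qed.

Definition ext_quad (h : H) : ext := if D h then Q2 0 h else Q2 1 (h - h0).

Let ext_quadE m x : D x -> ext_quad (h0 *~ m + x) = Q2 m x.
Proof.
move=> Dx; rewrite /ext_quad; case: ifP => Dm.
  by apply: Q2_rep => //; rewrite mulr0z add0r.
apply: Q2_rep => //; last by rewrite mulr1z addrC subrK.
by case: (Dcover (h0 *~ m + x)) => //; rewrite Dm.
Qed.

Let rep h : exists m x, D x /\ h = h0 *~ m + x.
Proof.
case: (Dcover h) => Dh; first by exists 0, h; rewrite mulr0z add0r.
by exists 1, (h - h0); split=> //; rewrite mulr1z; zmod.
Qed.

Lemma ext_quad_coset x : D x -> ext_quad (h0 + x) = ext_cl (q (h0 + x)) 0 1.
Proof.
move=> Dx; have := @ext_quadE 1 x Dx; rewrite mulr1z => ->.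
by rewrite /Q2 subrr mulr0z expr1n.
Qed.

Lemma ext_quad_sub x : D x -> ext_quad x = ext_cl (q (h0 + x)) (- x) 0.
Proof.
move=> Dx; have := @ext_quadE 0 x Dx; rewrite mulr0z add0r => ->.
by rewrite /Q2 sub0r mulrNz mulr1z expr0n.
Qed.

Lemma ext_quad_quadratic : homogeneous_quadratic ext_quad.
Proof.
have polarE m x m' x' : D x -> D x' ->
    polar ext_quad (h0 *~ m + x) (h0 *~ m' + x') =
    ext_cl (B x x') (x *~ m' + x' *~ m) (m * m' *+ 2).
  move=> Dx Dx'; rewrite /polar addrACA -mulrzDr !ext_quadE ?DD //.
  rewrite /Q2 /ext_cl -!raddfB; congr (zproj _ (_, _, _)).
    rewrite /= !mulrzBr !mulrzDr !mulrzDl !mulr1z; zmod.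
  by rewrite /=; ring.
have PD x y z : polar ext_quad (x + y) z = polar ext_quad x z + polar ext_quad y z.
  have [m [x' [Dx ->]]] := rep x; have [n [y' [Dy ->]]] := rep y.
  have [l [z' [Dz ->]]] := rep z; rewrite addrACA -mulrzDr.
  rewrite !polarE ?DD // -ext_clD BDl //; congr ext_cl; last by ring.
  by rewrite mulrzDl mulrzDr; zmod.
have PC x y : polar ext_quad x y = polar ext_quad y x.
  by rewrite /polar [x + y]addrC; zmod.
apply: quadratic_of_even; first by split=> // x y z; rewrite PC PD !(PC _ x).
move=> h; have [m [x [Dx ->]]] := rep h.
rewrite opprD -mulrNz !ext_quadE ?DN //; apply/ext_cl_eq.
exists x, 0; split=> //; congr (_, _, _); first exact: Bself.
  by rewrite mulNrz !mulrzBr !mulrNz mulr0z mulr1z; zmod.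
by rewrite sqrrN subrr.
Qed.

End Extension.

Definition coset_type (H : zmodType) (D : pred H) (h0 : H) : Prop :=
  (forall h, D h) /\ h0 = 0 \/
  [/\ ~~ D h0, D (h0 + h0) & forall h, D h \/ D (h - h0)].

Lemma coset_type_double (H : zmodType) (D : pred H) (h0 : H) :
  coset_type D h0 -> D (h0 + h0).
Proof. by case=> [[]|[]]. Qed.

Lemma gamma_lift (H : finZmodType) (A : zmodType) (q : H -> A) (s t : seq H) :
  homogeneous_quadratic q ->
  \sum_(x <- s) gamma x = \sum_(x <- t) gamma x ->
  \sum_(x <- s) q x = \sum_(x <- t) q x.
Proof.
move=> /Gamma_universal [g [[gB gq] _]] st.
pose gA : {additive Gamma H -> A} :=
  HB.pack g (GRing.isZmodMorphism.Build _ _ g gB).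
have gE u : \sum_(x <- u) q x = gA (\sum_(x <- u) gamma x).
  by rewrite raddf_sum; apply: eq_bigr => x _; rewrite gq.
by rewrite !gE st.
Qed.

(** In the index-two case each entry contributes 1 to the third coordinate of [ext], so equal sizes
    put both sums in the same fibre, where [ext_cl_inj] applies. *)
Lemma coset_gamma_eq (H : finZmodType) (Q : zmodType) (D : pred H) (h0 : H)
    (q : H -> Q) (s t : seq H) :
  zmod_closed D -> coset_type D h0 -> coset_quadratic D h0 q ->
  {in s, forall h, D (h - h0)} -> {in t, forall h, D (h - h0)} ->
  size s = size t -> \sum_(x <- s) gamma x = \sum_(x <- t) gamma x ->
  \sum_(x <- s) q x = \sum_(x <- t) q x.
Proof.
move=> cD [[DT h00]|[Dh0 D2 Dc]] qq sD tD sz st.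
  move: qq; rewrite h00 => -[q0 qN q3].
  by apply: gamma_lift st; apply: coset_quadratic_full; split=> // *;
    [apply: qN|apply: q3].
have [QE QD] := (ext_quad_coset cD D2 Dh0 Dc qq, ext_quad_quadratic cD D2 Dh0 Dc qq).
have sumE u : {in u, forall h, D (h - h0)} ->
    \sum_(x <- u) ext_quad cD D2 qq x = ext_cl cD D2 qq (\sum_(x <- u) q x) 0 (size u)%:Z.
  elim: u => [_|x u IHu uD]; first by rewrite !big_nil /ext_cl raddf0.
  rewrite !big_cons IHu; last by move=> h hu; apply: uD; rewrite inE hu orbT.
  have QEx : ext_quad cD D2 qq x = ext_cl cD D2 qq (q x) 0 1.
    rewrite (_ : x = h0 + (x - h0)); last by zmod.
    by rewrite QE //; apply: uD; rewrite inE eqxx.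
  by rewrite QEx -ext_clD addr0 -PoszD.
have := gamma_lift QD st; rewrite !sumE // sz.
exact: ext_cl_inj.
Qed.

Lemma zproj_diff_count (H : finZmodType) (S : pred {ffun H -> int})
    (cS : zmod_closed S) (s t : seq H) :
  zproj cS (diff_count s t) =
  \sum_(x <- s) zproj cS (free_gen x) - \sum_(x <- t) zproj cS (free_gen x).
Proof.
rewrite -!raddf_sum -raddfB; congr (zproj cS _); apply/ffunP => h.
have E (u : seq H) : (\sum_(x <- u) free_gen x) h = (count_mem h u)%:Z.
  elim: u => [|x u IHu]; first by rewrite big_nil ffunE.
  by rewrite big_cons !ffunE IHu /= natz PoszD eq_sym.
by rewrite !ffunE !E.
Qed.

Lemma eqv_gamma (H : finZmodType) (e : nat) (eqv : seq H -> seq H -> Prop)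
    (D : pred H) (h0 : H) :
  (0 < e)%N -> (forall h : H, h *+ e = 0) -> moves e eqv ->
  zmod_closed D -> coset_type D h0 ->
  exists n0, forall s t, size s = size t -> (n0 <= size s)%N ->
    good D h0 s -> good D h0 t ->
    \sum_(x <- s) gamma x = \sum_(x <- t) gamma x -> eqv s t.
Proof.
move=> e_gt0 eH eqvM cD tD; have D2 := coset_type_double tD.
have [n0 n0P] := eqv_triv e_gt0 eH eqvM cD D2.
exists n0 => s t st ns gs gt gamma_st; apply: n0P => //.
have cl_q : coset_quadratic D h0 (triv_cl e_gt0 eqvM D h0).
  split=> [|h Dh|x y z Dx Dy Dz].
  - by apply/eqP; rewrite zproj_eq0; apply: triv_h0.
  - apply/eqP; rewrite eq_sym -subr_eq0 -raddfB zproj_eq0.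
    exact: triv_opp.
  - rewrite -!(raddfD, raddfB); apply/eqP; rewrite zproj_eq0.
    exact: triv_parallelepiped.
have [_ sD _] := gs; have [_ tD' _] := gt.
have := coset_gamma_eq cD tD cl_q sD tD' st gamma_st.
move=> E; rewrite -(zproj_eq0 (triv_closed e_gt0 eqvM D h0)) zproj_diff_count.
by rewrite subr_eq0; apply/eqP.
Qed.

(** * Reflections over the p-adic integers *)

Section PadicAction.
Variables (p : nat) (H : zmodType) (K : nat).
Hypothesis p_prime : prime p.
Hypothesis pH : forall h : H, h *+ (p ^ K.+1) = 0.

Let e := (p ^ K.+1)%N.

Lemma expp_gt1 k : (1 < p ^ k.+1)%N.
Proof. by rewrite -(exp1n k.+1) ltn_exp2r // prime_gt1. Qed.

(** Scalar multiplication by Z_p: coordinate [K] is the residue modulo p^(K+1), which is all that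
    matters on a group killed by that power. *)
Definition act (a : padic_int p) (h : H) : H := h *+ (a K : nat).

Lemma mulrn_mod (h : H) m : h *+ (m %% (Zp_trunc e).+2) = h *+ m.
Proof.
rewrite Zp_cast ?expp_gt1 // [in RHS](divn_eq m e) mulrnDr mulnC mulrnA pH.
by rewrite mul0rn add0r.
Qed.

Lemma actDl a b h : act (a + b) h = act a h + act b h.
Proof. by rewrite /act -mulrnDr -[RHS]mulrn_mod. Qed.

Lemma actDr a h k : act a (h + k) = act a h + act a k.
Proof. exact: mulrnDl. Qed.

Lemma actM a b h : act (a * b) h = act a (act b h).
Proof. by rewrite /act -mulrnA mulnC -[RHS]mulrn_mod. Qed.

Lemma act0l h : act 0 h = 0. Proof. exact: mulr0n. Qed.
Lemma act0r a : act a 0 = 0. Proof. exact: mul0rn. Qed.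
Lemma act1 h : act 1 h = h. Proof. by rewrite /act /= modn_small. Qed.

Lemma actNl a h : act (- a) h = - act a h.
Proof. by apply/eqP; rewrite -addr_eq0 -actDl addNr act0l. Qed.

Lemma act_nat n h : act n%:R h = h *+ n.
Proof.
elim: n => [|n IHn]; first by rewrite act0l mulr0n.
by rewrite !mulrSr actDl IHn act1.
Qed.

Lemma act_suml (I : Type) (r : seq I) (P : pred I) (F : I -> padic_int p) h :
  act (\sum_(i <- r | P i) F i) h = \sum_(i <- r | P i) act (F i) h.
Proof. by elim/big_rec2: _ => [|i x y _ <-]; rewrite ?act0l ?actDl. Qed.

Lemma act_sumr (I : Type) (r : seq I) (P : pred I) (F : I -> H) a :
  act a (\sum_(i <- r | P i) F i) = \sum_(i <- r | P i) act a (F i).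
Proof. by elim/big_rec2: _ => [|i x y _ <-]; rewrite ?act0r ?actDr. Qed.

Lemma padic_nat_coord n k : (n%:R : padic_int p) k = n%:R.
Proof. by elim: n => // n IHn; rewrite !mulrSr /= IHn. Qed.

Lemma padic_nat_inv m : coprime p m -> exists c : padic_int p, c * m%:R = 1.
Proof.
move=> pm; have mU k : (m%:R : 'Z_(p ^ k.+1)) \is a GRing.unit.
  by rewrite unitZpE ?expp_gt1 // coprimeXl.
have red_m k : padic_red (m%:R : 'Z_(p ^ k.+2)) = m%:R.
  by rewrite -!padic_nat_coord -padic_coordP.
have redV k : (m%:R^-1 : 'Z_(p ^ k.+1)) = padic_red (m%:R^-1 : 'Z_(p ^ k.+2)).
  apply: (mulIr (mU k)); rewrite (mulVr (mU k)).
  by rewrite -[X in _ * X]red_m -padic_redM (mulVr (mU _)) padic_red1.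
exists (PadicInt redV); apply: padic_intP => k /=.
by rewrite padic_nat_coord (mulVr (mU k)).
Qed.

Definition mact n (F : 'I_n -> H) (A : 'M[padic_int p]_n) (j : 'I_n) : H :=
  \sum_i act (A i j) (F i).

Lemma eq_mact n (F G : 'I_n -> H) A : F =1 G -> mact F A =1 mact G A.
Proof. by move=> FG j; apply: eq_bigr => i _; rewrite FG. Qed.

Lemma mact_mul n (F : 'I_n -> H) A B : mact F (A *m B) =1 mact (mact F A) B.
Proof.
move=> j; rewrite /mact; under [RHS]eq_bigr do rewrite act_sumr.
rewrite exchange_big; apply: eq_bigr => i _.
rewrite mxE act_suml; apply: eq_bigr => k _.
by rewrite mulrC actM.
Qed.

Lemma mact1 n (F : 'I_n -> H) : mact F 1%:M =1 F.
Proof.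
move=> j; rewrite /mact (bigD1 j) //= mxE eqxx act1 big1 ?addr0 // => i ij.
by rewrite mxE (negPf ij) act0l.
Qed.

Lemma orthogonalP n (A : 'M[padic_int p]_n) :
  Defs.orthogonal A <-> A^T *m A = 1%:M.
Proof.
by split=> [[]|AA] //; split=> //; have [] := mulmx1_unit AA.
Qed.

Lemma orthogonal_mul n (A B : 'M[padic_int p]_n) :
  Defs.orthogonal A -> Defs.orthogonal B -> Defs.orthogonal (A *m B).
Proof.
move=> /orthogonalP AA /orthogonalP BB; apply/orthogonalP.
by rewrite trmx_mul mulmxA -(mulmxA B^T) AA mulmx1.
Qed.

Lemma orthogonal_tr n (A : 'M[padic_int p]_n) :
  Defs.orthogonal A -> A *m A^T = 1%:M /\ Defs.orthogonal A^T.
Proof.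
move=> /orthogonalP AA; have AA' := mulmx1C AA; split=> //.
by apply/orthogonalP; rewrite trmxK.
Qed.

Section Reflection.
Variables (n : nat) (c : padic_int p) (w : 'I_n -> padic_int p).
Hypothesis cw : c * \sum_i w i * w i = 2%:R.

(** The reflection in [w], with the equation [cw] in place of a division by the square norm. *)
Definition reflection : 'M[padic_int p]_n :=
  \matrix_(i, j) ((i == j)%:R - c * w i * w j).

Lemma reflection_orthogonal : Defs.orthogonal reflection.
Proof.
apply/orthogonalP/matrixP => i j; rewrite !mxE.
transitivity (\sum_k ((k == i)%:R * (k == j)%:R - (k == i)%:R * (c * w k * w j)
   - (k == j)%:R * (c * w k * w i) + c * c * w i * w j * (w k * w k))).
  by apply: eq_bigr => k _; rewrite !mxE; ring.
have delta i' (F : 'I_n -> padic_int p) : \sum_k (k == i')%:R * F k = F i'.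
  rewrite (bigD1 i') //= eqxx mul1r big1 ?addr0 // => k ki.
  by rewrite (negPf ki) mul0r.
rewrite big_split !sumrB !delta -mulr_sumr /=.
rewrite (_ : c * c * w i * w j * _ = c * w i * w j * (c * \sum_k w k * w k)); last by ring.
by rewrite cw; ring.
Qed.

Lemma mact_reflection (F : 'I_n -> H) j :
  mact F reflection j = F j - act (c * w j) (\sum_i act (w i) (F i)).
Proof.
rewrite /mact act_sumr; under eq_bigr do rewrite mxE actDl actNl.
rewrite sumrB; congr (_ - _).
  rewrite (bigD1 j) //= eqxx act1 big1 ?addr0 // => i ij.
  by rewrite (negPf ij) act0l.
by apply: eq_bigr => i _; rewrite -actM; congr act; ring.
Qed.

End Reflection.

Definition orth_eqv n (F G : 'I_n -> H) : Prop :=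
  exists2 A : 'M[padic_int p]_n, Defs.orthogonal A & G =1 mact F A.

Lemma orth_eqv_sym n (F G : 'I_n -> H) : orth_eqv F G -> orth_eqv G F.
Proof.
case=> A oA GE; have [AA oA'] := orthogonal_tr oA; exists A^T => // j.
by rewrite (eq_mact _ GE) -mact_mul AA mact1.
Qed.

Lemma orth_eqv_trans n (F G E : 'I_n -> H) :
  orth_eqv F G -> orth_eqv G E -> orth_eqv F E.
Proof.
case=> A oA GE [B oB EE]; exists (A *m B); first exact: orthogonal_mul.
by move=> j; rewrite EE (eq_mact _ GE) mact_mul.
Qed.

Definition seq_fun n (s : seq H) : 'I_n -> H := fun i => s`_i.

(** Quantifying over [n] with an equation lets both lists be read as functions on one ordinal type,
    without casts. *)
Definition seq_eqv (s t : seq H) : Prop :=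
  size s = size t /\ forall n, size s = n -> orth_eqv (@seq_fun n s) (@seq_fun n t).

Lemma seq_eqv_trans s t u : seq_eqv s t -> seq_eqv t u -> seq_eqv s u.
Proof.
move=> [st eqst] [tu eqtu]; split=> [|n sn]; first by rewrite st.
by apply: orth_eqv_trans (eqst n sn) (eqtu n _); rewrite -st.
Qed.

Lemma seq_eqv_perm s t : perm_eq s t -> seq_eqv s t.
Proof.
move=> pst; split=> [|n sn]; first exact: perm_size.
have /tuple_permP [f fE] : perm_eq t (Tuple (introT eqP sn)) by rewrite perm_sym.
exists (perm_mx f)^T.
  apply/orthogonalP; rewrite trmxK.
  by rewrite tr_perm_mx -perm_mxM mulgV perm_mx1.
move=> j; rewrite /mact (bigD1 (f j)) //= !mxE eqxx act1 big1 => [|i ij].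
  rewrite addr0 /seq_fun fE /= (nth_map j) ?size_enum_ord // (tnth_nth 0) /=.
  by rewrite nth_ord_enum.
by rewrite !mxE eq_sym (negPf ij) act0l.
Qed.

Lemma seq_sum (w : seq (padic_int p)) (s : seq H) n : size w = n -> size s = n ->
  \sum_(i < n) act w`_i s`_i = \sum_(u <- zip w s) act u.1 u.2.
Proof.
move=> wn sn; rewrite (big_nth (0, 0)) size_zip wn sn minnn big_mkord.
by apply: eq_bigr => i _; rewrite nth_zip ?wn.
Qed.

Lemma seq_eqv_reflection (c : padic_int p) (w : seq (padic_int p)) (s : seq H) :
  size w = size s -> c * \sum_(x <- w) x * x = 2%:R ->
  seq_eqv s [seq u.2 - act (c * u.1) (\sum_(v <- zip w s) act v.1 v.2) | u <- zip w s].
Proof.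
move=> ws cw; have sz : size (zip w s) = size s by rewrite size_zip ws minnn.
split=> [|n sn]; first by rewrite size_map sz.
have cw' : c * \sum_(i < n) w`_i * w`_i = 2%:R.
  by rewrite -cw (big_nth 0) ws sn big_mkord.
exists (reflection c (fun i : 'I_n => w`_i)); first exact: reflection_orthogonal.
move=> j; rewrite mact_reflection /seq_fun (nth_map (0, 0)) ?sz ?sn //.
by rewrite nth_zip //= seq_sum ?ws.
Qed.

Lemma seq_eqv_sym s t : seq_eqv s t -> seq_eqv t s.
Proof.
move=> [st eqst]; split=> // n tn; apply/orth_eqv_sym/eqst.
by rewrite st.
Qed.

Lemma zip_nseq (T U : Type) (a : T) (s : seq U) :
  zip (nseq (size s) a) s = [seq (a, x) | x <- s].
Proof. by elim: s => //= x s ->. Qed.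

Lemma seq_eqv_opp h s : seq_eqv (h :: s) (- h :: s).
Proof.
pose w : seq (padic_int p) := 1 :: nseq (size s) 0.
have ww : 2%:R * \sum_(x <- w) x * x = 2%:R.
  by rewrite big_cons big_nseq iter_addr_0 mulr1 mul0r mul0rn addr0 mulr1.
have wF : \sum_(v <- zip w (h :: s)) act v.1 v.2 = h.
  by rewrite /= zip_nseq big_cons big_map big1 => [|x _]; rewrite ?act0l // addr0 act1.
have := @seq_eqv_reflection 2%:R w (h :: s); rewrite wF => /(_ _ ww).
rewrite /= size_nseq zip_nseq => /(_ erefl).
rewrite mulr1 act_nat -map_comp (_ : h - h *+ 2 = - h); last by zmod.
rewrite (_ : map _ s = s) // -[RHS]map_id; apply: eq_map => x /=.
by rewrite mulr0 act0l subr0.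
Qed.

Lemma seq_eqv_opp2 a b s : seq_eqv (a :: b :: s) (- b :: - a :: s).
Proof.
have perm12 (x y : H) : seq_eqv (x :: y :: s) (y :: x :: s).
  by apply: seq_eqv_perm; exact/permPl/(perm_catCA [:: x] [:: y]).
apply: seq_eqv_trans (seq_eqv_opp _ _) _; apply: seq_eqv_trans (perm12 _ _) _.
exact: seq_eqv_opp.
Qed.

(* Reflection in the vector equal to 1 at [a], [b] and on [I]: since [2e]
   divides [size I], half its square norm acts as 1 on [H]. *)
Lemma seq_eqv_shift a b I r : (e.*2 %| size I)%N -> \sum_(x <- I) x = 0 ->
  seq_eqv (a :: b :: I ++ r) (a :: b :: [seq x - (a + b) | x <- I] ++ r).
Proof.
move=> /dvdnP [k sI] I0.
have [c cE] : exists c : padic_int p, c * (1 + k * e)%:R = 1.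
  apply: padic_nat_inv; rewrite prime_coprime // /e expnS mulnCA.
  by rewrite dvdn_addl ?dvdn_mulr // dvdn1; apply: contraTneq p_prime => ->.
have cact h : act c h = h.
  rewrite -[RHS]act1 -cE actM act_nat mulrnDr mulr1n mulnC mulrnA pH.
  by rewrite mul0rn addr0.
apply: seq_eqv_trans (_ : seq_eqv _ (- b :: - a ::
  [seq x - (a + b) | x <- I] ++ r)) (seq_eqv_sym (seq_eqv_opp2 _ _ _)).
pose w : seq (padic_int p) := 1 :: 1 :: nseq (size I) 1 ++ nseq (size r) 0.
have zipE : zip w (a :: b :: I ++ r) =
    (1, a) :: (1, b) :: [seq (1, x) | x <- I] ++ [seq (0, x) | x <- r].
  by rewrite /= zip_cat ?size_nseq // !zip_nseq.
have ww : c * \sum_(x <- w) x * x = 2%:R.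
  rewrite !big_cons big_cat /= !big_nseq !iter_addr_0 !mulr1 mul0r mul0rn addr0 sI.
  rewrite (_ : 1 + _ = (1 + k * e)%:R * 2%:R); first by rewrite mulrA cE mul1r.
  rewrite -natrM (_ : ((1 + k * e) * 2 = 1 + (1 + k * e.*2))%N) ?natrD //.
  by rewrite -muln2; ring.
have wF : \sum_(v <- zip w (a :: b :: I ++ r)) act v.1 v.2 = a + b.
  rewrite zipE !big_cons big_cat !big_map /= !act1.
  under eq_bigr do rewrite act1.
  rewrite I0 big1 => [|x _]; last exact: act0l.
  by rewrite !addr0.
have := @seq_eqv_reflection c w (a :: b :: I ++ r); rewrite wF => /(_ _ ww).
rewrite zipE /= !size_cat !size_nseq map_cat -!map_comp => /(_ erefl).
have E1 : a - (a + b) = - b by zmod.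
have E2 : b - (a + b) = - a by zmod.
rewrite mulr1 cact E1 E2.
rewrite (@eq_map _ _ _ (fun x => x - (a + b))) => [|x /=]; last by rewrite mulr1 cact.
rewrite (_ : map (_ \o _) r = r) // -[RHS]map_id; apply: eq_map => x /=.
by rewrite mulr0 act0l subr0.
Qed.

End PadicAction.

Section SeqMoves.
Variables (p : nat) (H : finZmodType) (K : nat).
Hypothesis p_prime : prime p.
Let e := (p ^ K.+1)%N.
Hypothesis pH : forall h : H, h *+ e = 0.

Let E := @seq_eqv p H K.
Let E_sym s t : E s t -> E t s. Proof. exact: seq_eqv_sym. Qed.
Let E_trans s t u : E s t -> E t u -> E s u. Proof. exact: seq_eqv_trans. Qed.
Let E_opp h s : E (h :: s) (- h :: s). Proof. exact: seq_eqv_opp. Qed.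

Let E_shiftD a b I r : (e.*2 %| size I)%N -> \sum_(x <- I) x = 0 ->
  E (a :: b :: I ++ r) (a :: b :: [seq x + (a + b) | x <- I] ++ r).
Proof.
move=> eI I0; have eI' : (e %| size I)%N by apply: dvd_e2 eI.
have := @seq_eqv_shift p H K p_prime pH a b [seq x + (a + b) | x <- I] r.
rewrite size_map sum_map_addr I0 add0r (mulrn_dvd pH) // => /(_ eI erefl).
rewrite -map_comp (_ : map (_ \o _) I = I); first exact: E_sym.
by rewrite -[RHS]map_id; apply: eq_map => x /=; rewrite addrK.
Qed.

Lemma seq_moves : moves e E.
Proof.
have perm12 a b s : E (a :: b :: s) (b :: a :: s).
  by apply: seq_eqv_perm; exact/permPl/(perm_catCA [:: a] [:: b]).
have opp_snd a b s : E (a :: b :: s) (a :: - b :: s).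
  by apply: E_trans (perm12 _ _ _) _; apply: E_trans (perm12 _ _ _); exact: E_opp.
split=> // [s t|a b I r eI I0]; first exact: seq_eqv_perm.
apply: E_trans (opp_snd _ _ _) _.
apply: E_trans (E_shiftD a (- b) r eI I0) _.
exact/E_sym/opp_snd.
Qed.

End SeqMoves.

Lemma gamma_gen (H : finZmodType) (g : Gamma H) :
  exists u : {ffun H -> int}, g = \sum_x gamma x *~ u x.
Proof.
have [u ->] := zproj_surj g; exists u.
by rewrite {1}(free_sum u) raddf_sum; apply: eq_bigr => x _; rewrite raddfMz.
Qed.

Lemma gamma_ind (H : finZmodType) (P : pred (Gamma H)) :
  zmod_closed P -> (forall x, P (gamma x)) -> forall g, P g.
Proof.
move=> cP Pg g; have [u ->] := gamma_gen g.
pose sP : zmodClosed _ := subgroup cP.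
by apply: (@rpred_sum _ sP) => x _; apply: (@rpredMz _ sP); exact: Pg.
Qed.

(** On generators, e^2 gamma(x) = gamma(ex) = 0. The square cannot be dropped in general: for H =
    Z/2 the group Gamma is Z/4. *)
Lemma gamma_exponent (H : finZmodType) (e : nat) :
  (forall h : H, h *+ e = 0) -> forall g : Gamma H, g *+ (e * e) = 0.
Proof.
move=> eH g; have [[gDl _] gZ] := gamma_quadratic H.
apply/eqP; apply: (@gamma_ind H (@torsion (Gamma H) (e * e))) => [|x].
  exact: torsion_closed.
have g0 : gamma (0 : H) = 0 by have := gZ 0 0; rewrite !mulr0z.
by have := gZ e x; rewrite -pmulrn eH g0 /torsion pmulrn PoszM => <-.
Qed.

(** * Invariants of an orbit *)

Section Span.
Variable H : finZmodType.
Implicit Types (s t : seq H) (D : {ffun H -> bool}).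

(** A finite function rather than a predicate, so that the possible values form a finite type, over
    which one can maximise thresholds and sum. *)
Definition span s : {ffun H -> bool} := [ffun x => generated (sums_diffs s) x].

Definition base D : H := if [pick h | ~~ D h] is Some h then h else 0.

Definition full s : Prop := forall x, generated [set` s] x.

Lemma spanE s : (span s : pred H) = generated (sums_diffs s).
Proof. by apply/funext => x; rewrite ffunE. Qed.

Lemma span_closed s : zmod_closed (span s : pred H).
Proof. by rewrite spanE; exact: generated_closed. Qed.

(** Since 2a and all b - a with b in [s] lie in the span, the union of the span and its translate by
    [a] is a subgroup containing [s]. *)
Lemma span_cover s a : full s -> a \in s -> forall h, span s h \/ span s (h - a).
Proof.
move=> fs sa h; pose S : pred H := fun h => span s h || span s (h - a).
have [S0 SB] := span_closed s; pose sS := subgroup (span_closed s).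
have aa b : b \in s -> span s (b - a) /\ span s (b + a).
  by move=> bs; rewrite spanE; split; apply: generated_mem; exists b, a; split; auto.
have S_closed : zmod_closed S.
  split=> [|x y]; first by apply/orP; left; exact: S0.
  have a2 : a + a \in sS by exact: (aa a sa).2.
  rewrite /S /in_mem /= => /orP [] xS /orP [] yS; apply/orP.
  - by left; apply: (SB).
  - right; rewrite (_ : x - y - a = x - (y - a) - (a + a)); last by zmod.
    by apply: (SB) => //; apply: (SB).
  - by right; rewrite (_ : x - y - a = x - a - y); [apply: (SB)|zmod].
  - by left; rewrite (_ : x - y = x - a - (y - a)); [apply: (SB)|zmod].
have : S h.
  apply: generated_sub S_closed _ _ (fs h) => x /= xs.
  by apply/orP; right; exact: (aa x xs).1.
by case/orP; [left|right].
Qed.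

Lemma span_coset s : full s -> (1 < size s)%N ->
  coset_type (span s) (base (span s)) /\ good (span s) (base (span s)) s.
Proof.
move=> fs s1; case: s fs s1 => // a s0; set s := a :: s0 => fs s1.
have as_ : a \in s by rewrite inE eqxx.
pose sS := subgroup (span_closed s).
have cover := span_cover fs.
have sd b c : b \in s -> c \in s -> span s (b - c) /\ span s (b + c).
  by move=> bs cs; rewrite spanE; split; apply: generated_mem; exists b, c; split; auto.
rewrite /base; case: pickP => [h0 nh0|allD].
  have hb b : b \in s -> span s (h0 - b).
    by move=> bs; case: (cover b bs h0) => // ; rewrite (negPf nh0).
  have h02 : span s (h0 + h0).
    rewrite (_ : h0 + h0 = (h0 - a) + (h0 - a) + (a + a)); last by zmod.
    apply: (@rpredD _ sS); last exact: (sd a a as_ as_).2.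
    by apply: (@rpredD _ sS); apply: hb.
  split; [right|]; split=> //.
  - move=> h; case: (cover a as_ h) => [|Dh]; [by left|right].
    rewrite (_ : h - h0 = (h - a) - (h0 - a)); last by zmod.
    by apply: (@rpredB _ sS) => //; apply: hb.
  - by move=> b bs; rewrite -opprB; apply: (@rpredNr _ sS); apply: hb.
  - by move=> x; rewrite spanE.
have {}allD x : span s x by move/negbFE: (allD x).
by split; [left|split=> // x; rewrite spanE].
Qed.

Lemma uniform_threshold (P : (H -> bool) -> nat -> Prop) :
  (forall D n m, (n <= m)%N -> P D n -> P D m) ->
  (forall D : {ffun H -> bool}, exists n, P D n) ->
  exists n, forall D : {ffun H -> bool}, P D n.
Proof.
move=> Pmono Pex; have [f fP] := choice Pex.
exists (\max_D f D)%N => D; apply: Pmono (fP D).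
exact: leq_bigmax.
Qed.

End Span.

Section Classification.
Variables (p : nat) (H : finZmodType) (K : nat).
Hypothesis p_prime : prime p.
Let e := (p ^ K.+1)%N.
Hypothesis pH : forall h : H, h *+ e = 0.

Definition tseq n (F : 'I_n -> H) : seq H := [seq F i | i <- enum 'I_n].

Lemma size_tseq n (F : 'I_n -> H) : size (tseq F) = n.
Proof. by rewrite size_map size_enum_ord. Qed.

Lemma nth_tseq n (F : 'I_n -> H) (i : 'I_n) : (tseq F)`_i = F i.
Proof. by rewrite (nth_map i) ?size_enum_ord // nth_ord_enum. Qed.

Lemma sum_tseq (V : zmodType) (q : H -> V) n (F : 'I_n -> H) :
  \sum_(x <- tseq F) q x = \sum_i q (F i).
Proof. by rewrite big_map big_enum. Qed.

Lemma orth_classification : exists n0, forall n (F G : 'I_n -> H), (n0 <= n)%N ->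
  full (tseq F) -> full (tseq G) -> span (tseq F) = span (tseq G) ->
  \sum_i gamma (F i) = \sum_i gamma (G i) -> orth_eqv p K F G.
Proof.
have e_gt0 : (0 < e)%N by rewrite expn_gt0 prime_gt0.
have [] := @uniform_threshold H (fun D n0 => zmod_closed D -> coset_type D (base [ffun x => D x]) ->
  forall s t : seq H, size s = size t -> (n0 <= size s)%N ->
    good D (base [ffun x => D x]) s -> good D (base [ffun x => D x]) t ->
    \sum_(x <- s) gamma x = \sum_(x <- t) gamma x -> seq_eqv p K s t).
- move=> D n m nm IH cD tD s t st ms; apply: IH => //; exact: leq_trans ms.
- move=> D; have [cD|ncD] := pselect (zmod_closed D); last by exists 0%N.
  have [tD|ntD] := pselect (coset_type D (base [ffun x => D x])); last by exists 0%N.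
  have [n0 n0P] := eqv_gamma e_gt0 pH (seq_moves p_prime pH) cD tD.
  by exists n0 => _ _; exact: n0P.
move=> n0 n0P; exists n0.+2 => n F G nn fF fG FG gFG.
have sz (E : 'I_n -> H) : (1 < size (tseq E))%N by rewrite size_tseq; apply: leq_trans nn.
have [tF gF] := span_coset fF (sz F); have [_ gG] := span_coset fG (sz G).
have ffE (D : {ffun H -> bool}) : [ffun x => D x] = D :> {ffun H -> bool} by apply/ffunP => x; rewrite ffunE.
have := n0P (span (tseq F)) (span_closed _); rewrite ffE => /(_ tF (tseq F) (tseq G)).
rewrite !size_tseq !sum_tseq => /(_ erefl); case=> //.
- by apply: leq_trans nn; rewrite ltnW.
- by rewrite FG.
move=> _ /(_ n (size_tseq F)) [A oA GE]; exists A => // j.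
by rewrite -nth_tseq -/(seq_fun _ _) GE; apply: eq_mact => i; rewrite -[RHS]nth_tseq.
Qed.

Lemma mem_tseq n (F : 'I_n -> H) i : F i \in tseq F.
Proof. by apply: map_f; rewrite mem_enum. Qed.

Lemma tseqP n (F : 'I_n -> H) x : reflect (exists i, x = F i) (x \in tseq F).
Proof.
by apply: (iffP mapP) => [[i _ ->]|[i ->]]; exists i => //; rewrite mem_enum.
Qed.

Lemma orth_eqv_full n (F G : 'I_n -> H) :
  orth_eqv p K F G -> full (tseq F) -> full (tseq G).
Proof.
move=> /(orth_eqv_sym p_prime pH) [A _ FE] fF x.
apply: generated_sub (generated_closed _) _ _ (fF x) => _ /tseqP [i ->] /=.
rewrite FE; pose sG := subgroup (generated_closed [set` tseq G]).
apply: (@rpred_sum _ sG) => j _; apply: (@rpredMn _ sG).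
by apply: generated_mem; exact: mem_tseq.
Qed.

(** The integer x^2 - x is even. *)
Lemma act_sq_mod2 (S : zmodClosed H) h (a : padic_int p) : h + h \in S ->
  act K (a * a) h - act K a h \in S.
Proof.
move=> h2; rewrite (actM p_prime pH) /act -mulrnA; set x := nat_of_ord _.
case: x => [|x]; first by rewrite !mulr0n subr0 rpred0.
rewrite mulnS mulrnDr addrAC subrr add0r.
have : (2 %| x.+1 * x)%N by rewrite dvdn2 oddM /= andNb.
by case/dvdnP => y ->; rewrite mulnC mulrnA mulr2n rpredMn.
Qed.

(** Each column of A has square norm 1, and squares agree with their roots modulo 2, so up to
    multiples of 2 E_i the entry E'_k minus E_i is the sum over l of A_lk (E_l - E_i). Hence every
    new entry lies in the old coset of the span; the converse inclusion uses the inverse matrix. *)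
Lemma orth_eqv_span n (F G : 'I_n -> H) : full (tseq F) ->
  orth_eqv p K F G -> span (tseq F) = span (tseq G).
Proof.
move=> fF FG.
suff sub (E E' : 'I_n -> H) : full (tseq E) -> orth_eqv p K E E' ->
    forall x, span (tseq E') x -> span (tseq E) x.
  have GF := orth_eqv_sym p_prime pH FG; have fG := orth_eqv_full FG fF.
  by apply/ffunP => x; apply/idP/idP; [exact: sub GF x|exact: sub FG x].
move=> {fF FG F G} fE [A oA E'E] x; rewrite {1}spanE.
pose S := subgroup (span_closed (tseq E)).
have memS y : span (tseq E) y = (y \in S) by [].
apply: (generated_sub (span_closed (tseq E))) => y [u [v [/tseqP [i ->] /tseqP [j ->] yE]]].
have DE k l : (E k - E l \in S) /\ (E k + E l \in S).
  by rewrite -!memS spanE; split; apply: generated_mem; exists (E k), (E l);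
    split; auto; exact: mem_tseq.
have modE k : E' k - E i \in S.
  have [AA _] := orthogonal_tr oA; have [_ AtA] := oA.
  have actE : act K (\sum_l A l k * A l k) (E i) = E i.
    rewrite (_ : \sum_l _ = 1) ?act1 //.
    transitivity ((1%:M : 'M[padic_int p]_n) k k); last by rewrite mxE eqxx.
    by rewrite -AtA mxE; apply: eq_bigr => l _; rewrite mxE.
  rewrite E'E -[E i]actE (act_suml p_prime pH) -sumrB; apply: rpred_sum => l _.
  rewrite (_ : act K (A l k) (E l) - _ = act K (A l k) (E l - E i)
    - (act K (A l k * A l k) (E i) - act K (A l k) (E i))).
    by apply: rpredB; [apply: rpredMn; case: (DE l i)|apply: act_sq_mod2; case: (DE i i)].
  by rewrite /act mulrnBl; zmod.
have i2 : E i + E i \in S by case: (DE i i).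
suff : y \in S by []; case: yE => ->.
  rewrite (_ : _ + _ = (E' i - E i) + (E' j - E i) + (E i + E i)); last by zmod.
  by apply: rpredD => //; apply: rpredD.
rewrite (_ : _ - _ = (E' i - E i) - (E' j - E i)); last by zmod.
exact: rpredB.
Qed.

Fixpoint pairs (T : Type) (r : seq T) : seq (T * T) :=
  if r is x :: r' then [seq (x, y) | y <- r'] ++ pairs r' else [::].

Lemma pairs_neq (T : eqType) (r : seq T) : uniq r ->
  {in pairs r, forall u, u.1 != u.2}.
Proof.
elim: r => //= x r IHr /andP [xr /IHr ur] u; rewrite mem_cat => /orP [|/ur //].
by case/mapP => y yr -> /=; apply: contraNneq xr => ->.
Qed.

Lemma quadratic_sum (V W : zmodType) (q : V -> W) (T : Type) (r : seq T) (x : T -> V) :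
  homogeneous_quadratic q ->
  q (\sum_(i <- r) x i) =
  \sum_(i <- r) q (x i) + \sum_(u <- pairs r) polar q (x u.1) (x u.2).
Proof.
move=> [[qDl qDr] qZ].
have q0 : q 0 = 0 by have := qZ 0 0; rewrite !mulr0z.
have pol0 y : polar q y 0 = 0 by rewrite /polar addr0 q0; zmod.
elim: r => [|i r IHr]; first by rewrite !big_nil q0; zmod.
rewrite !big_cons /= big_cat big_map /=.
have polS y (s : seq T) : polar q y (\sum_(j <- s) x j) = \sum_(j <- s) polar q y (x j).
  by elim: s => [|j s IHs]; rewrite ?big_nil ?pol0 // !big_cons qDr IHs.
rewrite -polS [polar q _ _]/polar IHr; zmod.
Qed.

Hypothesis pG : forall g : Gamma H, g *+ e = 0.

Lemma gamma_act (a : padic_int p) (h : H) : gamma (act K a h) = act K (a * a) (gamma h).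
Proof.
have [_ qZ] := gamma_quadratic H; rewrite (actM p_prime pG) /act -mulrnA.
apply: etrans (qZ (a K : nat)%:Z h) _.
by rewrite expr2 -PoszM -pmulrn.
Qed.

Lemma polar_act (a b : padic_int p) (h k : H) :
  polar (@gamma H) (act K a h) (act K b k) = act K (a * b) (polar (@gamma H) h k).
Proof.
have [[Dl Dr] _] := gamma_quadratic H.
have g0 : gamma (0 : H) = 0.
  by have [_ qZ] := gamma_quadratic H; have := qZ 0 0; rewrite !mulr0z.
have Ml m x y : polar (@gamma H) (x *+ m) y = polar (@gamma H) x y *+ m.
  elim: m => [|m IHm]; last by rewrite !mulrSr Dl IHm.
  by rewrite !mulr0n /polar add0r g0; zmod.
have C x y : polar (@gamma H) x y = polar (@gamma H) y x.
  by rewrite /polar [x + y]addrC; zmod.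
by rewrite (actM p_prime pG) /act Ml C Ml C -!mulrnA mulnC.
Qed.

(** Expanding gamma of each column sum, the coefficient of gamma(F_i) is the square norm of row i of
    A, and that of the polar term of F_i and F_k is the product of rows i and k. The rows are
    orthonormal. *)
Lemma orth_eqv_gamma n (F G : 'I_n -> H) : orth_eqv p K F G ->
  \sum_i gamma (F i) = \sum_i gamma (G i).
Proof.
case=> A oA GE; have [/matrixP AA _] := orthogonal_tr oA.
have AAE i k : \sum_j A i j * A k j = (i == k)%:R.
  by have := AA i k; rewrite !mxE => <-; apply: eq_bigr => j _; rewrite mxE.
apply/esym; under eq_bigr => j _.
  rewrite GE /mact quadratic_sum; last exact: gamma_quadratic.
  under eq_bigr do rewrite gamma_act.
  under [X in _ + X]eq_bigr do rewrite polar_act.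
  over.
rewrite big_split /= exchange_big [X in _ + X]exchange_big /=.
rewrite [X in _ + X]big_seq [X in _ + X]big1 => [|u up]; last first.
  rewrite -(act_suml p_prime pG) AAE (negPf (pairs_neq _ up)) ?act0l //.
  exact: index_enum_uniq.
rewrite addr0; apply: eq_bigr => i _.
by rewrite -(act_suml p_prime pG) AAE eqxx act1.
Qed.

End Classification.

(** * Surjections from the cokernel and orbit counting *)

Section PadicDomain.
Variable p : nat.
Hypothesis p_prime : prime p.

Lemma padic_coord_mod (x : padic_int p) k l : (k <= l)%N ->
  (x k = x l %% p ^ k.+1 :> nat)%N.
Proof.
move=> kl; have -> : (x k : nat) = (x k %% p ^ k.+1)%N.
  by rewrite modn_small // -[X in (_ < X)%N](Zp_cast (expp_gt1 p_prime k)) ltn_ord.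
elim: l kl => [|l IHl]; first by rewrite leqn0 => /eqP ->.
rewrite leq_eqVlt => /predU1P [->//|kl]; rewrite IHl // [x l]padic_coordP /=.
by rewrite (Zp_cast (expp_gt1 p_prime l)) modn_dvdm // dvdn_exp2l.
Qed.

Lemma padic_coord0 (x : padic_int p) k l : (k <= l)%N ->
  (p ^ k.+1 %| x l)%N -> x k = 0.
Proof.
move=> kl xl; apply/val_inj; rewrite /= (padic_coord_mod _ kl).
by apply/eqP.
Qed.

Lemma padic_mul_eq0 (x y : padic_int p) : x * y = 0 -> x = 0 \/ y = 0.
Proof.
move=> xy; have [|/eqP x0] := eqVneq x 0; [by left|right].
apply: contrapT => y0.
have nz (z : padic_int p) : z <> 0 -> exists k, z k <> 0.
  move=> z0; apply: contrapT => zk; apply: z0; apply: padic_intP => k.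
  by apply: contrapT => zk0; apply: zk; exists k.
have [k xk] := nz _ x0; have [l yl] := nz _ y0.
(* At this precision the valuations of x and y are at most k and l, so their product is not 0 modulo
   p^(m+1). *)
pose m := (k + l).+1.
have xm : ~~ (p ^ k.+1 %| x m)%N.
  by apply/negP => /padic_coord0 xk0; apply/xk/xk0; rewrite /m; lia.
have ym : ~~ (p ^ l.+1 %| y m)%N.
  by apply/negP => /padic_coord0 yl0; apply/yl/yl0; rewrite /m; lia.
have xm0 : (0 < x m)%N by case: posnP xm => // ->; rewrite dvdn0.
have ym0 : (0 < y m)%N by case: posnP ym => // ->; rewrite dvdn0.
have : (p ^ m.+1 %| x m * y m)%N.
  have := congr1 (fun z : padic_int p => z m : nat) xy.
  rewrite /=; move: (nat_of_ord (x m)) (nat_of_ord (y m)) => a b.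
  by rewrite (Zp_cast (expp_gt1 p_prime m)) /dvdn => ->.
move: xm ym; rewrite !pfactor_dvdn ?muln_gt0 ?xm0 // lognM // /m -!ltnNge; lia.
Qed.

Lemma orthogonal_det n (A : 'M[padic_int p]_n) :
  Defs.orthogonal A -> \det A = 1 \/ \det A = -1.
Proof.
case=> _ /(congr1 determinant); rewrite det_mulmx det_tr det1 => dd.
have : (\det A - 1) * (\det A + 1) = 0.
  by rewrite -subr_sqr expr2 dd expr1n subrr.
case/padic_mul_eq0 => /eqP; first by rewrite subr_eq0 => /eqP; left.
by rewrite addr_eq0 => /eqP; right.
Qed.

Lemma padic_1_neq_N1 : (1 : padic_int p) <> -1.
Proof.
(* Coordinate 1 is taken modulo p^2, because 1 and -1 agree modulo p when p = 2. *)
move=> /(congr1 (fun x : padic_int p => (x 1%N : nat))) /=.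
rewrite !(Zp_cast (expp_gt1 p_prime 1)) (modn_small (expp_gt1 p_prime 1)).
have p2 := prime_gt1 p_prime; have p4 : (4 <= p ^ 2)%N by rewrite (leq_sqr 2).
by rewrite modn_small; lia.
Qed.

Definition swap_mx n (i j : 'I_n) : 'M[padic_int p]_n := perm_mx (tperm i j).

Lemma swap_mx_orthogonal n (i j : 'I_n) : Defs.orthogonal (swap_mx i j).
Proof.
by apply/orthogonalP; rewrite /swap_mx tr_perm_mx tpermV -perm_mxM tperm2 perm_mx1.
Qed.

Lemma det_swap_mx n (i j : 'I_n) : i != j -> \det (swap_mx i j) = -1.
Proof. by move=> ij; rewrite det_perm odd_tperm ij expr1. Qed.

Lemma mact_swap_mx (H : zmodType) K n (F : 'I_n -> H) i j :
  F i = F j -> mact K F (swap_mx i j) =1 F.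
Proof.
move=> Fij k; rewrite /mact (bigD1 (tperm i j k)) //= !mxE tpermK eqxx act1.
rewrite big1 => [|l lk]; last first.
  by rewrite !mxE -(inj_eq (@perm_inj _ (tperm i j))) tpermK (negPf lk) act0l.
by rewrite addr0; case: tpermP => // ->.
Qed.

Lemma orth_eqv_special (H : finZmodType) K n (F G : 'I_n -> H) :
  (forall h : H, h *+ (p ^ K.+1) = 0) -> (#|H| < n)%N -> orth_eqv p K F G ->
  exists2 A : 'M[padic_int p]_n, special_orthogonal A & G =1 mact K F A.
Proof.
move=> pH Hn [A oA GE]; have [detA|detA] := orthogonal_det oA; first by exists A.
have [i [j [ij Fij]]] : exists i j, i != j /\ F i = F j.
  have /injectivePn [i [j ij Fij]] : ~~ injectiveb F.
    apply/negP => /injectiveP /leq_card; rewrite card_ord => nH.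
    by move: Hn; rewrite ltnNge nH.
  by exists i, j.
exists (swap_mx i j *m A).
  split; first by apply: orthogonal_mul => //; apply: swap_mx_orthogonal.
  by rewrite det_mulmx det_swap_mx // detA mulrNN mulr1.
move=> k; rewrite (mact_mul p_prime pH) GE.
by apply: eq_mact => l; rewrite mact_swap_mx.
Qed.

End PadicDomain.

Lemma counting_seq (R : realType) (T : choiceType) (s : seq T) (A : set T) :
  uniq s -> (forall x, A x <-> x \in s) -> counting A = (size s)%:R%:E :> \bar R.
Proof.
move=> us As; pose X := finmap.seq_fset tt s.
have AX : A = [set` X].
  by apply/seteqP; split=> x /=; rewrite finmap.seq_fsetE => /As.
have fA : finite_set A by rewrite AX; exact: finite_fset.
rewrite /counting asboolT // AX set_fsetK.
by rewrite finmap.size_seq_fset undup_id.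
Qed.

Section PadicDivision.
Variable p : nat.
Hypothesis p_prime : prime p.

Lemma padic_div (a : padic_int p) K :
  exists b : padic_int p, a = (a K : nat)%:R + b *+ (p ^ K.+1).
Proof.
pose q := (p ^ K.+1)%N.
have [c cE] : exists c : padic_int p, c = a - (a K : nat)%:R by eexists.
have q_gt0 : (0 < q)%N by rewrite expn_gt0 prime_gt0.
have cK : c K = 0 by rewrite cE /= padic_nat_coord natr_Zp subrr.
have qc l : (K <= l)%N -> (q %| c l)%N.
  by move=> Kl; have := padic_coord_mod p_prime c Kl; rewrite cK => /esym/eqP.
pose b k : 'Z_(p ^ k.+1) := inZp (c (k + K.+1)%N %/ q).
have bP k : b k = padic_red (b k.+1).
  apply/val_inj; rewrite /= (Zp_cast (expp_gt1 p_prime k)) (Zp_cast (expp_gt1 p_prime k.+1)).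
  rewrite modn_dvdm; last first.
    by rewrite dvdn_exp2l.
  rewrite !modn_divl /q -!expnD addSn; congr (_ %/ _)%N.
  rewrite (padic_coord_mod p_prime c (leqnSn (k + K.+1))).
  by rewrite modn_mod.
exists (PadicInt bP); apply/eqP; rewrite addrC -subr_eq -cE eq_sym; apply/eqP.
have pow_coord (x : padic_int p) m k : (x *+ m) k = x k *+ m.
  by elim: m => [|m IHm]; rewrite ?mulr0n // !mulrSr /= IHm.
apply: padic_intP => k; rewrite pow_coord /=; apply/val_inj.
rewrite Zp_mulrn /= [RHS](padic_coord_mod p_prime c (leq_addr K.+1 k)).
rewrite (Zp_cast (expp_gt1 p_prime k)) modnMml divnK //.
by apply: qc; lia.
Qed.

End PadicDivision.

Section Surjections.
Variables (p : nat) (H : finZmodType) (K : nat).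
Hypothesis p_prime : prime p.
Hypothesis pH : forall h : H, h *+ (p ^ K.+1) = 0.
Variables (n : nat) (A : 'M[padic_int p]_n).

Definition fixed_full (F : {ffun 'I_n -> H}) : bool :=
  `[< full (tseq F) /\ mact K F A =1 F >].

Let B := A - 1%:M.

Definition eval_vec (F : 'I_n -> H) (v : 'cV[padic_int p]_n) : H :=
  \sum_i act K (v i 0) (F i).

Lemma eval_vecB F : zmod_morphism (eval_vec F).
Proof.
move=> u v; rewrite /eval_vec -sumrB; apply: eq_bigr => i _.
by rewrite !mxE (actDl p_prime pH) (actNl p_prime pH).
Qed.

Lemma eval_vec_mul F (C : 'M[padic_int p]_n) v :
  eval_vec F (C *m v) = eval_vec (mact K F C) v.
Proof.
rewrite /eval_vec; under eq_bigr do rewrite mxE (act_suml p_prime pH).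
rewrite exchange_big; apply: eq_bigr => i _; rewrite /mact act_sumr.
by apply: eq_bigr => k _; rewrite mulrC (actM p_prime pH).
Qed.

Lemma eval_delta F i : eval_vec F (delta_mx i 0) = F i.
Proof.
rewrite /eval_vec (bigD1 i) //= mxE !eqxx act1 big1 ?addr0 // => j ij.
by rewrite mxE (negPf ij) act0l.
Qed.

Definition cok_hom (F : {ffun 'I_n -> H}) (c : cok B) : H := eval_vec F (repr c).

Lemma cok_homE F v : fixed_full F ->
  cok_hom F (zproj (im_mulmx_closed B) v) = eval_vec F v.
Proof.
case/asboolP => _ FA; apply/eqP; rewrite -subr_eq0 -eval_vecB.
have : zproj (im_mulmx_closed B) (repr (zproj (im_mulmx_closed B) v) - v) == 0.
  rewrite raddfB subr_eq0; apply/eqP.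
  exact: (@reprK _ {ideal_quot (subgroup (im_mulmx_closed B))}).
rewrite zproj_eq0 => /asboolP [u ->].
rewrite /B mulmxBl mul1mx eval_vecB eval_vec_mul subr_eq0; apply/eqP.
by apply: eq_bigr => i _; rewrite FA.
Qed.

Definition cok_vals (f : cok B -> H) : {ffun 'I_n -> H} :=
  [ffun i => f (zproj (im_mulmx_closed B) (delta_mx i 0))].

Lemma cok_homK F : fixed_full F -> cok_vals (cok_hom F) = F.
Proof.
by move=> fF; apply/ffunP => i; rewrite ffunE cok_homE // eval_delta.
Qed.

Lemma cok_hom_Sur F : fixed_full F -> Sur (cok B) H (cok_hom F).
Proof.
move=> fF; have fB : zmod_morphism (cok_hom F).
  move=> x y; have [u ->] := zproj_surj x; have [v ->] := zproj_surj y.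
  by rewrite -raddfB !cok_homE // eval_vecB.
split=> // h _; case/asboolP: (fF) => /(_ h) + _.
pose S : pred H := fun h => `[< exists c, cok_hom F c = h >].
have cS : zmod_closed S.
  split=> [|_ _ /asboolP [c <-] /asboolP [d <-]]; apply/asboolP.
    by exists 0; rewrite -(subrr 0) fB subrr.
  by exists (c - d); rewrite fB.
move/(generated_sub cS) => FS; have /asboolP : S h.
  apply: FS => _ /tseqP [i ->]; apply/asboolP.
  by exists (zproj (im_mulmx_closed B) (delta_mx i 0)); rewrite cok_homE // eval_delta.
by case=> c cE; exists c.
Qed.

Lemma Sur_cok_vals f : Sur (cok B) H f ->
  fixed_full (cok_vals f) /\ cok_hom (cok_vals f) = f.
Proof.
move=> [fB f_surj]; pose pr := zproj (im_mulmx_closed B).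
pose g v := f (pr v).
have gB : zmod_morphism g by move=> u v; rewrite /g /pr raddfB fB.
pose gA : {additive 'cV[padic_int p]_n -> H} :=
  HB.pack g (GRing.isZmodMorphism.Build _ _ g gB).
(* [Sur] asks only for additivity. Linearity over Z_p is automatic: a p-adic integer is a natural
   number plus a multiple of p^(K+1), and that power kills [H]. *)
have gZ a v : g (a *: v) = act K a (g v).
  have [b {1}->] := padic_div p_prime a K.
  rewrite scalerDl scaler_nat -scalerMnl -[g _]/(gA _) raddfD !raddfMn /= pH addr0.
  by [].
have gE v : g v = eval_vec (cok_vals f) v.
  rewrite {1}(_ : v = \sum_i v i 0 *: delta_mx i 0); last first.
    rewrite {1}[v]matrix_sum_delta; apply: eq_bigr => i _.
    by rewrite big_ord1.
  rewrite -[g _]/(gA _) raddf_sum; apply: eq_bigr => i _.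
  by rewrite [LHS]gZ ffunE.
have fF : fixed_full (cok_vals f).
  apply/asboolP; split=> [h|j].
    have [c _ <-] := f_surj h I; have [v ->] := zproj_surj c.
    rewrite -[f _]/(g v) gE.
    pose sG := subgroup (generated_closed [set` tseq (cok_vals f)]).
    apply: (@rpred_sum _ sG) => i _; apply: (@rpredMn _ sG).
    by apply: generated_mem; exact: mem_tseq.
  transitivity (g (A *m delta_mx j 0)).
    by rewrite gE eval_vec_mul eval_delta.
  apply/eqP; rewrite ffunE -[f _]/(g _) -subr_eq0 -gB.
  rewrite (_ : A *m _ - _ = B *m delta_mx j 0); last by rewrite mulmxBl mul1mx.
  rewrite /g (_ : pr _ = 0); last first.
    by apply/eqP; rewrite zproj_eq0; apply/asboolP; exists (delta_mx j 0).
  by have := fB 0 0; rewrite subr0 subrr => ->.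
split=> //; apply/funext => c; have [v ->] := zproj_surj c.
by rewrite cok_homE // -gE.
Qed.

Lemma counting_Sur_cok (R : realType) :
  counting (Sur (cok B) H) = (\sum_F (fixed_full F)%:R)%:E :> \bar R.
Proof.
rewrite (@counting_seq _ _ [seq cok_hom F | F <- enum fixed_full]).
- rewrite size_map -cardE -sum1_card natr_sum big_mkcond; congr (_%:E).
  by apply: eq_bigr => F _; rewrite -[F \in _]/(fixed_full F); case: fixed_full.
- rewrite map_inj_in_uniq ?enum_uniq // => F G.
  rewrite !mem_enum => fF fG FG.
  by rewrite -[F]cok_homK // FG cok_homK.
move=> f; split=> [/Sur_cok_vals [fF <-]|/mapP [F]].
  by apply: map_f; rewrite mem_enum.
by rewrite mem_enum => fF ->; exact: cok_hom_Sur.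
Qed.

End Surjections.

(** * Borel sets of p-adic matrices *)

Section PadicMeasurability.
Variables (p n : nat).
Local Notation M := 'M[padic_int p]_n.

Lemma open_of_coord k (S : set M) :
  (forall A A' : M, (forall i j, A i j k = A' i j k) -> S A -> S A') -> open S.
Proof.
move=> Sk; rewrite openE => A SA; pose P i j := [set y : padic_int p | y k = A i j k].
exists P => [i j|A' PA']; last by apply: Sk SA => i j; rewrite PA'.
apply: open_nbhs_nbhs; split; last by [].
suff : padic_open (P i j) by [].
by move=> x xP; exists k => y /= yx; rewrite /P /= yx.
Qed.

Lemma measurable_of_coord k (S : set M) :
  (forall A A' : M, (forall i j, A i j k = A' i j k) -> S A -> S A') -> measurable S.
Proof. by move=> /open_of_coord oS; exact: sub_sigma_algebra. Qed.

Definition coordk k (x : padic_int p) : 'Z_(p ^ k.+1) := x k.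
Fact coordkB k : zmod_morphism (coordk k). Proof. by []. Qed.
Fact coordkM k : monoid_morphism (coordk k). Proof. by []. Qed.
HB.instance Definition _ k := GRing.isZmodMorphism.Build _ _ (coordk k) (coordkB k).
HB.instance Definition _ k := GRing.isMonoidMorphism.Build _ _ (coordk k) (coordkM k).

Lemma eq_map_coord k (A A' : M) :
  (forall i j, A i j k = A' i j k) -> map_mx (coordk k) A = map_mx (coordk k) A'.
Proof. by move=> AA'; apply/matrixP => i j; rewrite !mxE; exact: AA'. Qed.

(** The equation holds when it holds modulo every p^(k+1), so the set is a countable intersection of
    open sets. *)
Lemma measurable_orthogonal : measurable (@Defs.orthogonal p n).
Proof.
rewrite (_ : @Defs.orthogonal p n = \bigcap_k
    [set A | map_mx (coordk k) A^T *m map_mx (coordk k) A = 1%:M]).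
  apply: bigcapT_measurable => k; apply: (@measurable_of_coord k) => A A' AA' /=.
  by rewrite -!map_trmx (eq_map_coord AA').
apply/seteqP; split=> A.
  by move=> /orthogonalP AA k _ /=; rewrite -map_mxM AA map_mx1.
move=> Ak; apply/orthogonalP/matrixP => i j; apply: padic_intP => k.
have := Ak k I; rewrite /= -map_mxM -(map_mx1 (coordk k)) => /matrixP /(_ i j).
by rewrite !mxE.
Qed.

Lemma measurable_det (c : padic_int p) : measurable [set A : M | \det A = c].
Proof.
rewrite (_ : [set A | _] = \bigcap_k [set A : M | \det (map_mx (coordk k) A) = c k]).
  apply: bigcapT_measurable => k; apply: (@measurable_of_coord k) => A A' AA' /=.
  by rewrite (eq_map_coord AA').
apply/seteqP; split=> A.
  by move=> /= <- k _ /=; rewrite det_map_mx.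
by move=> Ak; apply: padic_intP => k; have := Ak k I; rewrite /= det_map_mx.
Qed.

Lemma measurable_orthogonal_minus : measurable (@orthogonal_minus p n).
Proof. by apply: measurableI; [exact: measurable_orthogonal|exact: measurable_det]. Qed.

Lemma measurable_special_orthogonal : measurable (@special_orthogonal p n).
Proof. by apply: measurableI; [exact: measurable_orthogonal|exact: measurable_det]. Qed.

Lemma measurable_mact (H : zmodType) K (F G : 'I_n -> H) :
  measurable [set A : M | mact K F A =1 G].
Proof.
apply: (@measurable_of_coord K) => A A' AA' AG j; rewrite -AG.
by apply: eq_bigr => i _; rewrite /act AA'.
Qed.

End PadicMeasurability.

Lemma measure_disjoint_seq d (T : measurableType d) (R : realType)
    (mu : {measure set T -> \bar R}) (I : eqType) (s : seq I) (B : I -> set T) :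
  uniq s -> (forall i, measurable (B i)) ->
  (forall i j t, B i t -> B j t -> i = j) ->
  mu (\bigcup_(i in [set` s]) B i) = (\sum_(i <- s) mu (B i))%E.
Proof.
move=> + mB dB; have mU (r : seq I) : measurable (\bigcup_(i in [set` r]) B i).
  elim: r => [|i r IHr].
    by rewrite (_ : \bigcup_(i in _) _ = set0) // -subset0 => t [].
  rewrite (_ : \bigcup_(i in _) _ = B i `|` \bigcup_(i in [set` r]) B i).
    exact: measurableU.
  apply/seteqP; split=> t; first by
    move=> [j /=]; rewrite inE => /orP [/eqP -> ?|jr ?]; [left|right; exists j].
  by move=> [Bt|[j /= jr Bt]]; [exists i|exists j] => //=; rewrite inE ?eqxx ?jr ?orbT.
elim: s => [_|i r IHr /= /andP [ir ur]].
  by rewrite big_nil (_ : \bigcup_(i in _) _ = set0) ?measure0 // -subset0 => t [].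
rewrite big_cons -IHr // -measureU //.
  congr (mu _); apply/seteqP; split=> t.
    by move=> [j /=]; rewrite inE => /orP [/eqP -> ?|jr ?]; [left|right; exists j].
  by move=> [Bt|[j /= jr Bt]]; [exists i|exists j] => //=; rewrite inE ?eqxx ?jr ?orbT.
rewrite -subset0 => t [Bi [j /= jr Bj]].
by move: ir; rewrite (dB _ _ _ Bi Bj) jr.
Qed.

(** * The expectation as a number of orbits *)

Section Burnside.
Variables (R : realType) (p : nat) (H : finZmodType) (K n : nat).
Hypothesis p_prime : prime p.
Hypothesis pH : forall h : H, h *+ (p ^ K.+1) = 0.
Local Notation M := 'M[padic_int p]_n.

Variables (X : pred {ffun 'I_n -> H}) (T : finType) (iota : {ffun 'I_n -> H} -> T).
Hypothesis iota_inj : forall F G, X F -> X G -> iota F = iota G ->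
  exists2 A : M, special_orthogonal A & G =1 mact K F A.
Hypothesis iota_inv : forall F (A : M), X F -> Defs.orthogonal A ->
  X [ffun i => mact K F A i] /\ iota [ffun i => mact K F A i] = iota F.

(** Within one class all fixing sets have the mass of a transporter set: if F = F_0 g, then FA = F
    if and only if F_0 (gA) = F. The sets of A with F_0 A = F, for F in the class, are disjoint and
    cover O_n, so each class contributes 1. *)
Lemma burnside (mu : probability M R) :
  mu (@Defs.orthogonal p n) = 1%E ->
  (forall (g : M) B, special_orthogonal g -> measurable B ->
     measurable (mulmx g @^-1` B) -> mu (mulmx g @^-1` B) = mu B) ->
  (\sum_(F | X F) mu [set A : M | mact K F A =1 F] =
   (#|[set iota F | F in X]%SET|%:R)%:E)%E.
Proof.
move=> mu1 mu_inv.
rewrite (partition_big_imset iota) /=.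
rewrite -sum1_card natr_sum -sumEFin; apply: eq_bigr => y /imsetP [F0 XF0 ->].
transitivity (\sum_(F | X F && (iota F == iota F0))
    mu [set A : M | mact K F0 A =1 F])%E.
  apply: eq_bigr => F /andP [XF /eqP FF0].
  have [g gSO FE] := iota_inj XF0 XF (esym FF0).
  have pre : mulmx g @^-1` [set A | mact K F0 A =1 F] = [set A | mact K F A =1 F].
    apply/seteqP; split=> A /= AF i.
      by rewrite -AF (mact_mul p_prime pH); apply: eq_mact => j; rewrite FE.
    by rewrite (mact_mul p_prime pH) -AF; apply: eq_mact => j; rewrite FE.
  rewrite -pre; apply: mu_inv => //; first exact: measurable_mact.
  by rewrite pre; exact: measurable_mact.
rewrite -big_filter -measure_disjoint_seq.
- apply/eqP; rewrite eq_le probability_le1 /=; last first.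
    apply: fin_bigcup_measurable => [|F _]; last exact: measurable_mact.
    exact: finite_seq.
  rewrite -mu1 le_measure ?inE //; first exact: measurable_orthogonal.
    apply: fin_bigcup_measurable => [|F _]; last exact: measurable_mact.
    exact: finite_seq.
  move=> A oA; have [XF FF0] := iota_inv XF0 oA.
  exists [ffun i => mact K F0 A i] => /=.
    by rewrite mem_filter mem_index_enum XF FF0 eqxx.
  by move=> i; rewrite ffunE.
- exact/filter_uniq/index_enum_uniq.
- by move=> F; exact: measurable_mact.
- by move=> F G A /= AF AG; apply/ffunP => i; rewrite -AF -AG.
Qed.

End Burnside.

Section HaarLaw.
Variables (R : realType) (p n : nat).
Hypothesis p_prime : prime p.
Hypothesis n_gt1 : (1 < n)%N.
Local Notation M := 'M[padic_int p]_n.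

Lemma orthogonal_mulKl (g A : M) : Defs.orthogonal g ->
  Defs.orthogonal (g *m A) -> Defs.orthogonal A.
Proof.
move=> og ogA; have [_ ogT] := orthogonal_tr og; have [_ gg] := og.
by rewrite -(mul1mx A) -gg -mulmxA; exact: orthogonal_mul.
Qed.

(** Left translation by a transposition matrix shows that O_n^- and SO_n have the same mass, and
    together they make up O_n. *)
Lemma haar_orthogonal_minus_neq0 (nu : probability M R) :
  is_haar (@Defs.orthogonal p n) nu -> nu (@orthogonal_minus p n) != 0%E.
Proof.
move=> [nu1 nu_inv]; pose s := swap_mx p (Ordinal (ltnW n_gt1)) (Ordinal n_gt1).
have os : Defs.orthogonal s by exact: swap_mx_orthogonal.
have ds : \det s = -1 by rewrite det_swap_mx.
have SOE : mulmx s @^-1` @orthogonal_minus p n = @special_orthogonal p n.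
  apply/seteqP; split=> A; rewrite /special_orthogonal /orthogonal_minus /=.
    move=> [osA]; rewrite det_mulmx ds mulN1r => /oppr_inj dA.
    by split=> //; exact: orthogonal_mulKl osA.
  by move=> [oA dA]; rewrite det_mulmx ds dA mulN1r; split=> //; exact: orthogonal_mul.
have := nu_inv s _ os (@measurable_orthogonal_minus p n); rewrite SOE => SOm.
apply/eqP => m0; move: nu1; rewrite (_ : @Defs.orthogonal p n =
    @special_orthogonal p n `|` @orthogonal_minus p n).
  rewrite measureU.
  - move=> E; suff : (0 + 0)%E = 1%E :> \bar R by rewrite adde0 => /esym/eqP; rewrite onee_eq0.
    by rewrite -E; congr (_ + _)%E; rewrite -[LHS]m0 // -SOm.
  - exact: measurable_special_orthogonal.
  - exact: measurable_orthogonal_minus.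
  rewrite -subset0 => A [[_ dA] [_]]; rewrite dA.
  exact: padic_1_neq_N1.
apply/seteqP; split=> A; last by case=> -[].
by move=> oA; case: (orthogonal_det p_prime oA) => dA; [left|right].
Qed.

(** For the third ensemble, left multiplication by SO_n preserves O_n^-, so the normalised
    restriction inherits the invariance. *)
Lemma haar_law_burnside (e : ensemble) (mu : probability M R) : is_haar_law e mu ->
  mu (@Defs.orthogonal p n) = 1%E /\
  forall (g : M) B, special_orthogonal g -> measurable B ->
     measurable (mulmx g @^-1` B) -> mu (mulmx g @^-1` B) = mu B.
Proof.
case: e => [[mu1 mu_inv]|[mu1 mu_inv]|[nu hnu muE]].
- by split=> // g B [og _] mB _; exact: mu_inv.
- split=> [|g B sg mB _]; last exact: mu_inv.
  apply/eqP; rewrite eq_le probability_le1 /=; last first.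
    exact: measurable_orthogonal.
  rewrite -mu1 le_measure ?inE //; last by move=> A [].
    exact: measurable_special_orthogonal.
  exact: measurable_orthogonal.
have nz := haar_orthogonal_minus_neq0 hnu; have [nu1 nu_inv] := hnu.
split=> [|g B [og dg] mB mgB'].
  rewrite muE; last exact: measurable_orthogonal.
  rewrite setIidr; last by move=> A [].
  rewrite divee // fin_num_measure //; exact: measurable_orthogonal_minus.
have mB' : measurable (B `&` @orthogonal_minus p n).
  by apply: measurableI => //; exact: measurable_orthogonal_minus.
have mgB : mulmx g @^-1` B `&` @orthogonal_minus p n =
    mulmx g @^-1` (B `&` @orthogonal_minus p n).
  apply/seteqP; split=> A [BA [oA dA]]; split=> //; split.
  - exact: orthogonal_mul.
  - by rewrite det_mulmx dg dA mul1r.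
  - exact: orthogonal_mulKl oA.
  - by move: dA; rewrite det_mulmx dg mul1r.
by rewrite (muE B) // -(nu_inv g _ og mB') -mgB -muE.
Qed.

End HaarLaw.

Section Expectation.
Variables (R : realType) (p : nat) (H : finZmodType) (K n : nat).
Hypothesis p_prime : prime p.
Hypothesis pH : forall h : H, h *+ (p ^ K.+1) = 0.
Hypothesis n_gt1 : (1 < n)%N.
Local Notation M := 'M[padic_int p]_n.

Let X (F : {ffun 'I_n -> H}) : bool := `[< full (tseq F) >].

Lemma expectation_orbits (I : finType) (iota : {ffun 'I_n -> H} -> I)
    (e : ensemble) d (T : measurableType d) (P : probability T R)
    (A : {RV P >-> M}) :
  (forall F G, X F -> X G -> iota F = iota G ->
    exists2 A : M, special_orthogonal A & G =1 mact K F A) ->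
  (forall F (A : M), X F -> Defs.orthogonal A ->
    X [ffun i => mact K F A i] /\ iota [ffun i => mact K F A i] = iota F) ->
  haar_random e A ->
  (\int[P]_w counting (Sur (cok (A w - 1%:M)) H) =
   (#|[set iota F | F in X]%SET|%:R)%:E)%E.
Proof.
move=> iota_inj iota_inv /(haar_law_burnside p_prime n_gt1) [mu1 mu_inv].
rewrite -(burnside p_prime pH iota_inj iota_inv mu1 mu_inv).
have mA (F : {ffun 'I_n -> H}) : measurable (A @^-1` [set B | mact K F B =1 F]).
  rewrite -[X in measurable X]setTI; apply: measurable_funP => //.
  exact: measurable_mact.
transitivity (\int[P]_w \sum_(F <- [seq F <- index_enum {ffun 'I_n -> H} | X F])
    ((\1_(A @^-1` [set B | mact K F B =1 F]) w)%:E : \bar R))%E.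
  apply: eq_integral => w _; rewrite (counting_Sur_cok p_prime pH) sumEFin.
  congr (_%:E); rewrite big_filter [RHS]big_mkcond; apply: eq_bigr => F _.
  rewrite indicE /X /fixed_full; case: asboolP => [[fF FA]|nF].
    by rewrite asboolT // mem_set.
  case: asboolP => // fF; rewrite memNset // => FA; exact: nF.
rewrite ge0_integral_sum //; last first.
  by move=> F; apply/measurable_EFinP; apply: measurable_indic; exact: mA.
rewrite big_filter; apply: eq_bigr => F _.
by rewrite integral_indic // setIT.
Qed.

End Expectation.

Lemma card_finZmod_mulrn (V : finZmodType) (v : V) : v *+ #|V| = 0.
Proof.
have : \sum_(x : V) x = \sum_(x : V) (x + v).
  rewrite (reindex_inj (h := +%R^~ v)) //; exact: addIr.
rewrite big_split sumr_const /= => /eqP.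
by rewrite -subr_eq0 opprD addrA subrr sub0r oppr_eq0 => /eqP.
Qed.

(** * Counting the invariants *)

Section FiniteZmodule.
Variables (V : zmodType) (s : seq V).
Hypotheses (us : uniq s) (sV : forall v, v \in s).

Let V_pickleK : pcancel (index^~ s) (nth None (map some s)).
Proof. by move=> v; rewrite (nth_map v) ?index_mem // nth_index. Qed.

Let V_enumP : Finite.axiom s.
Proof. by move=> v; rewrite count_uniq_mem // sV. Qed.

(* The proofs are phantom arguments, so that the finType instance on the copy
   of [V] can be inferred. *)
Definition fin_zmod (_ : uniq s) (_ : forall v, v \in s) : Type := V.
Local Notation T := (fin_zmod us sV).
HB.instance Definition _ := GRing.Zmodule.on T.
HB.instance Definition _ := isCountable.Build T V_pickleK.
HB.instance Definition _ := fintype.isFinite.Build T V_enumP.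
End FiniteZmodule.

Lemma card_additive (V W : finZmodType) (S : zmodClosed V) (f : {additive V -> W}) :
  #|[set x in S]%SET| =
  (#|[set x in S | f x == 0%R]%SET| * #|[set f x | x in S]%SET|)%N.
Proof.
rewrite -sum1dep_card (partition_big_imset f) /= mulnC -sum_nat_const.
apply: eq_bigr => _ /imsetP [x0 Sx0 ->].
rewrite sum1dep_card -[RHS](card_imset _ (addrI x0)); apply: eq_card => x.
rewrite !inE; apply/andP/imsetP => [[Sx /eqP fx]|[y]].
  exists (x - x0); last by rewrite addrC subrK.
  by rewrite inE rpredB // raddfB fx subrr eqxx.
rewrite inE => /andP [Sy /eqP fy] ->.
by rewrite rpredD // raddfD fy addr0 eqxx.
Qed.

(** The properties of [Gamma] that the count uses, abstracted so that they can be transported to a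
    copy of [Gamma H] with a finite type structure. *)
Record universal_quadratic (H : zmodType) (G : zmodType) (gm : H -> G) : Prop := {
  uq_quadratic : homogeneous_quadratic gm;
  uq_ind : forall P : pred G, zmod_closed P -> (forall x, P (gm x)) -> forall g, P g;
  uq_lift : forall (A : zmodType) (q : H -> A), homogeneous_quadratic q ->
    exists f : {additive G -> A}, forall x, f (gm x) = q x }.

Section CosetCount.
Variables (H G : finZmodType) (gm : H -> G) (e : nat).
Hypothesis uq : universal_quadratic gm.
Hypothesis e_gt0 : (0 < e)%N.
Hypothesis eG : forall g : G, g *+ e = 0.
Variables (D : {ffun H -> bool}) (h0 : H).
Hypothesis cD : zmod_closed D.
Hypothesis tD : coset_type D h0.

Let sD : zmodClosed H := subgroup cD.
Let gDl x y z : polar gm (x + y) z = polar gm x z + polar gm y z.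
Proof. by have [[]] := uq_quadratic uq. Qed.
Let gDr x y z : polar gm x (y + z) = polar gm x y + polar gm x z.
Proof. by have [[]] := uq_quadratic uq. Qed.
Let gZ (n : nat) x : gm (x *+ n) = gm x *+ (n * n).
Proof.
have [_ qZ] := uq_quadratic uq; apply: etrans (qZ (Posz n) x) _.
by rewrite expr2 -PoszM.
Qed.
Let g0 : gm 0 = 0. Proof. by have := gZ 0 0; rewrite !mulr0n. Qed.
Let gD x y : gm (x + y) = gm x + gm y + polar gm x y.
Proof. by rewrite /polar; zmod. Qed.

Definition coset_step (k : H) : G := if D k then gm (h0 + k) - gm h0 else 0.

(** The subgroup generated by the differences gamma(h) - gamma(h_0) for h in h_0 + D. Coefficients
    below [e] suffice since [e] kills [G], and they make it a finite set. *)
Definition coset_steps : {set G} :=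
  [set \sum_k coset_step k *+ (c k : nat) | c : {ffun H -> 'I_e}]%SET.

Lemma coset_stepsP (c : H -> nat) : \sum_k coset_step k *+ c k \in coset_steps.
Proof.
apply/imsetP; exists [ffun k => Ordinal (ltn_pmod (c k) e_gt0)] => //.
apply: eq_bigr => k _; rewrite ffunE /= {1}(divn_eq (c k) e) mulrnDr mulnC mulrnA.
by rewrite eG mul0rn add0r.
Qed.

Lemma coset_steps_closed : zmod_closed (fun g => g \in coset_steps).
Proof.
split=> [|_ _ /imsetP [c _ ->] /imsetP [c' _ ->]]; rewrite /in_mem /=.
  have := coset_stepsP (fun=> 0%N).
  by rewrite big1 // => k _; rewrite mulr0n.
have := coset_stepsP (fun k => c k + (e - c' k))%N.
rewrite (_ : \sum_k _ = \sum_k coset_step k *+ c k - \sum_k coset_step k *+ c' k) //.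
rewrite -sumrB; apply: eq_bigr => k _.
by rewrite mulrnDr mulrnBr ?eG ?sub0r // ltnW.
Qed.

Let sS : zmodClosed G := subgroup coset_steps_closed.

Lemma coset_step_mem k : coset_step k \in sS.
Proof.
have := coset_stepsP (fun x => (x == k)%N); rewrite (bigD1 k) //= eqxx mulr1n.
by rewrite big1 ?addr0 // => x /negPf ->; rewrite mulr0n.
Qed.

Let stepE k : D k -> gm (h0 + k) - gm h0 \in sS.
Proof. by move=> Dk; have := coset_step_mem k; rewrite /coset_step Dk. Qed.

Let polar_mem k k' : D k -> D k' -> polar gm k k' \in sS.
Proof.
move=> Dk Dk'; have Dkk : D (k + k') by exact: (@rpredD _ sD).
rewrite (_ : polar gm k k' = (gm (h0 + (k + k')) - gm h0) - (gm (h0 + k) - gm h0)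
  - (gm (h0 + k') - gm h0)); first by apply: rpredB; [apply: rpredB|]; exact: stepE.
rewrite !gD !gDr; zmod.
Qed.

Let gm_double k : D k -> gm (k + k) \in sS.
Proof.
move=> Dk; rewrite (_ : gm (k + k) = polar gm k k *+ 2).
  by rewrite rpredMn ?polar_mem.
have := gZ 2 k; rewrite mulr2n -[(2 * 2)%N]/4%N => E; rewrite /polar E.
by zmod.
Qed.

Lemma card_coset_steps_full : (forall h, D h) -> #|coset_steps| = #|G|.
Proof.
move=> DT; rewrite -cardsT; congr #|pred_of_set _|; apply/setP => g; rewrite inE.
move: g; apply: (uq_ind uq coset_steps_closed) => x.
case: tD => [[_ h00]|[/negP]]; last by move/(_ (DT _)).
by have := stepE (DT x); rewrite h00 add0r g0 subr0.
Qed.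

Hypothesis Dh0 : ~~ D h0.

Let D2 : D (h0 + h0). Proof. exact: coset_type_double tD. Qed.
Let Dcover h : D h \/ D (h - h0).
Proof. by case: tD => [[DT]|[]//]; move: Dh0; rewrite DT. Qed.

Let decomp (m : nat) (k : H) : G := gm h0 *+ m + gm k.

(** Modulo [coset_steps], [gm] is constant on the coset and additive on [D]. As 4 gm(h_0) = gm(2
    h_0) with 2 h_0 in [D], the multiplicity of gm(h_0) can be brought below 4. *)
Let decomp_surj g : exists s m k, [/\ s \in sS, (m < 4)%N, D k & g = s + decomp m k].
Proof.
pose P : pred G := fun g => `[< exists s (m : nat) k, [/\ s \in sS, D k & g = s + decomp m k] >].
have Padd x y : P x -> P y -> P (x + y).
  move=> /asboolP [s [m [k [Ss Dk ->]]]] /asboolP [s' [m' [k' [Ss' Dk' ->]]]].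
  apply/asboolP; exists (s + s' - polar gm k k'), (m + m')%N, (k + k'); split.
  - by apply: rpredB; [exact: rpredD|exact: polar_mem].
  - exact: (@rpredD _ sD).
  - by rewrite /decomp gD mulrnDr; zmod.
have P0 : P 0.
  apply/asboolP; exists 0, 0%N, 0; split; [exact: rpred0|exact: (@rpred0 _ sD)|].
  by rewrite /decomp g0 mulr0n; zmod.
have Pn x n : P x -> P (x *+ n).
  by move=> Px; elim: n => [|n IHn]; rewrite ?mulr0n // mulrSr; exact: Padd.
have cP : zmod_closed P.
  split=> // x y Px Py; apply: Padd => //.
  rewrite (_ : - y = y *+ e.-1); first exact: Pn.
  by apply/eqP; rewrite eq_sym -subr_eq0 opprK -mulrSr prednK // eG.
have Pg x : P (gm x).
  case: (Dcover x) => Dx; apply/asboolP.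
    exists 0, 0%N, x; split; [exact: rpred0|by []|].
    by rewrite /decomp mulr0n; zmod.
  exists (gm (h0 + (x - h0)) - gm h0), 1%N, 0; split; [exact: stepE|exact: (@rpred0 _ sD)|].
  rewrite /decomp g0 (_ : h0 + (x - h0) = x); last by zmod.
  by zmod.
have /asboolP [s [m [k [Ss Dk ->]]]] := uq_ind uq cP Pg g.
elim/ltn_ind: m s k Ss Dk => m IHm s k Ss Dk.
have [m4|m4] := ltnP m 4; first by exists s, m, k.
have [|||s' [m' [k' [Ss' m'4 Dk' E]]]] :=
    IHm (m - 4)%N _ (s - polar gm (h0 + h0) k) (h0 + h0 + k).
- by lia.
- by apply: rpredB => //; exact: polar_mem.
- exact: (@rpredD _ sD).
exists s', m', k'; split=> //; rewrite -E /decomp gD.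
have := gZ 2 h0; rewrite mulr2n -[(2 * 2)%N]/4%N => ->.
rewrite -{1}(subnK m4) mulrnDr; zmod.
Qed.

(** Extending the zero function on the coset gives a homomorphism [f] on [G] that kills
    [coset_steps] and sends [decomp m k] to the class of (0, -k, m). For m and m' below 4, [ext_rel]
    only identifies elements of [D] that differ by an element of 2D. *)
Let decomp_inj m m' k k' : (m < 4)%N -> (m' < 4)%N -> D k -> D k' ->
  decomp m k - decomp m' k' \in sS -> m = m' /\ exists2 x, D x & k' - k = x + x.
Proof.
have q0 : coset_quadratic (fun x => D x) h0 (fun=> 0 : int).
  by split=> // x y z _ _ _; zmod.
have [f fE] := uq_lift uq (ext_quad_quadratic cD D2 Dh0 Dcover q0).
have f_coset x : D x -> f (gm (h0 + x)) = ext_cl cD D2 q0 0 0 1.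
  by move=> Dx; rewrite fE (ext_quad_coset cD D2 Dh0 Dcover q0).
have f_h0 : f (gm h0) = ext_cl cD D2 q0 0 0 1.
  by rewrite -(f_coset 0 (@rpred0 _ sD)) addr0.
have f_sub x : D x -> f (gm x) = ext_cl cD D2 q0 0 (- x) 0.
  by move=> Dx; rewrite fE (ext_quad_sub cD D2 Dh0 Dcover q0).
have f_S s : s \in sS -> f s = 0.
  move=> /imsetP [c _ ->]; rewrite raddf_sum big1 // => x _.
  rewrite raddfMn /coset_step; case: ifP => Dx; last by rewrite raddf0 mul0rn.
  by rewrite raddfB f_coset // f_h0 subrr mul0rn.
have f_decomp n x : D x -> f (decomp n x) = ext_cl cD D2 q0 0 (- x) n%:Z.
  move=> Dx; rewrite raddfD raddfMn f_sub // f_h0.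
  elim: n => [|n IHn]; first by rewrite mulr0n add0r.
  rewrite mulrSr addrAC IHn -ext_clD !addr0; congr ext_cl.
  by rewrite -addn1 PoszD.
move=> m4 m'4 Dk Dk' /f_S; rewrite raddfB !f_decomp // => /eqP.
rewrite subr_eq0 => /eqP/ext_cl_eq [x [j [Dx [kk' mm']]]].
have j0 : j = 0 by move: mm' m4 m'4; lia.
split; first by move: mm'; rewrite j0; lia.
exists x => //; move: kk'; rewrite j0 mulr0z addr0 mulr2n => <-.
by zmod.
Qed.

Let Dset : {set H} := [set x | D x]%SET.
Let double : H -> H := fun x => x + x.

(* Every fibre of [Psi : (s, m, k) |-> s + gm h0 *+ m + gm k] on
   [coset_steps * 'I_4 * D] is in bijection with [2D]. *)
Lemma card_coset_steps :
  (#|coset_steps| * 4 * #|[set x | D x & (x + x == 0)%R]%SET| = #|G|)%N.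
Proof.
have doubleB : zmod_morphism double by move=> x y; rewrite /double; zmod.
pose dA : {additive H -> H} := HB.pack double (GRing.isZmodMorphism.Build _ _ double doubleB).
have cardD : #|Dset| = (#|[set x | D x & (x + x == 0)%R]%SET| * #|[set double x | x in Dset]%SET|)%N.
  have := card_additive sD dA.
  have -> : [set x in sD]%SET = Dset by apply/setP => x; rewrite !inE.
  have -> : [set x in sD | dA x == 0%R]%SET = [set x | D x & (x + x == 0)%R]%SET.
    by apply/setP => x; rewrite !inE.
  move=> ->; congr (_ * _)%N; apply: eq_card => y.
  by apply/imsetP/imsetP => -[x xD ->]; exists x => //; move: xD; rewrite inE.
pose A := finset.setX coset_steps (finset.setX [set: 'I_4]%SET Dset).
pose Psi (u : G * ('I_4 * H)) : G := u.1 + decomp u.2.1 u.2.2.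
have cardA : #|A| = (#|G| * #|[set double x | x in Dset]%SET|)%N.
  rewrite -sum1_card (partition_big Psi predT) //= -sum_nat_const.
  apply: eq_bigr => g _; have [s0 [m0 [k0 [Ss0 m04 Dk0 gE]]]] := decomp_surj g.
  rewrite sum1dep_card.
  pose F (t : H) : G * ('I_4 * H) := (s0 + gm k0 - gm (k0 + t), (Ordinal m04, k0 + t)).
  have F_inj : injective F by move=> t t' [_ /addrI].
  rewrite -[RHS](card_imset _ F_inj); apply: eq_card => -[s [m k]].
  rewrite !inE /=; apply/andP/imsetP.
    move=> [/andP [Ss Dk] /eqP E].
    have [|m0E [x Dx kE]] := @decomp_inj m0 m k0 k m04 (ltn_ord m) Dk0 Dk.
      rewrite (_ : _ - _ = s - s0); first exact: rpredB.
      by move: E; rewrite gE /Psi /= => E; rewrite -[s](addrK (decomp m k)) E; zmod.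
    exists (x + x); first by apply/imsetP; exists x; rewrite ?inE.
    rewrite /F -kE (_ : k0 + (k - k0) = k); last by zmod.
    congr (_, (_, _)); last by apply/val_inj.
    move: E; rewrite gE /Psi /decomp m0E /= => E.
    rewrite -[s](addrK (gm h0 *+ m + gm k)) E; zmod.
  case=> t /imsetP [x]; rewrite inE => Dx -> [-> -> ->].
  have Dxx : D (double x) by exact: (@rpredD _ sD).
  have Dkx : D (k0 + double x) by exact: (@rpredD _ sD).
  split; last by rewrite /Psi /= gE /decomp; apply/eqP; zmod.
  rewrite Dkx andbT; suff : s0 + gm k0 - gm (k0 + double x) \in sS by [].
  rewrite gD (_ : _ - _ = s0 - gm (double x) - polar gm k0 (double x)); last by zmod.
  by apply: rpredB; [apply: rpredB => //; exact: gm_double|exact: polar_mem].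
(* The factor |2D| is cancelled against |D| = |D[2]| |2D|. *)
have d_gt0 : (0 < #|[set double x | x in Dset]%SET|)%N.
  apply/card_gt0P; exists 0; apply/imsetP; exists 0; rewrite /double ?addr0 // inE.
  exact: (@rpred0 _ sD).
apply/eqP; rewrite -(eqn_pmul2r d_gt0) -cardA -mulnA -cardD !cardsX cardsT card_ord.
by rewrite mulnA.
Qed.

End CosetCount.

Section AttainedSums.
Variables (H G : finZmodType) (gm : H -> G) (e : nat).
Hypothesis uq : universal_quadratic gm.
Hypothesis e_gt0 : (0 < e)%N.
Hypothesis eG : forall g : G, g *+ e = 0.
Variable D : {ffun H -> bool}.
Let h0 := base D.
Hypothesis cD : zmod_closed D.
Hypothesis tD : coset_type D h0.

Let sD : zmodClosed H := subgroup cD.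
Let sS : zmodClosed G := subgroup (coset_steps_closed gm e_gt0 eG D h0).

Let step_mem k : D k -> gm (h0 + k) - gm h0 \in sS.
Proof.
by move=> Dk; have := coset_step_mem gm e_gt0 eG D h0 k; rewrite /coset_step Dk.
Qed.

Lemma attained_sub n (F : 'I_n -> H) : (1 < n)%N -> full (tseq F) ->
  span (tseq F) = D -> \sum_i gm (F i) - gm h0 *+ n \in coset_steps gm e D h0.
Proof.
move=> n1 fF FD; have [|_] := span_coset fF; first by rewrite size_tseq.
rewrite FD -/h0 => -[_ Fh0 _]; rewrite -[n in _ *+ n]card_ord -sumr_const -sumrB.
apply: (@rpred_sum _ sS) => i _.
rewrite (_ : F i = h0 + (F i - h0)); last by zmod.
by apply: step_mem; apply: (Fh0 (F i)); exact: mem_tseq.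
Qed.

Let Dseq : seq H := [seq k <- index_enum H | D k].

Let size_Dseq : (size Dseq <= #|H|)%N.
Proof.
rewrite size_filter -sum1_count -sum1_card big_mkcond /=.
by apply: leq_sum => k _; case: ifP.
Qed.

(** The whole coset is listed once, as [s1], which makes the tuple generating with span [D]. Its
    contribution is subtracted first; the remainder is a sum of steps with coefficients below [e],
    realised by repetitions [s2], and copies of [h0] fill up the length. *)
Lemma attained_sup n g : (#|H| * e.+1 + 2 <= n)%N ->
  g - gm h0 *+ n \in coset_steps gm e D h0 ->
  exists F : {ffun 'I_n -> H},
    [/\ full (tseq F), span (tseq F) = D & \sum_i gm (F i) = g].
Proof.
move=> nn gS.
have stepsE (c : H -> nat) :
    \sum_k coset_step gm D h0 k *+ c k = \sum_(k <- Dseq) (gm (h0 + k) - gm h0) *+ c k.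
  rewrite big_filter [RHS]big_mkcond; apply: eq_bigr => k _; rewrite /coset_step.
  by case: ifP; rewrite ?mul0rn.
have : g - gm h0 *+ n - \sum_(k <- Dseq) (gm (h0 + k) - gm h0) \in sS.
  apply: (@rpredB _ sS) => //; rewrite big_seq; apply: (@rpred_sum _ sS) => k.
  by rewrite mem_filter => /andP [Dk _]; exact: step_mem.
case/imsetP => c _; rewrite stepsE => gE.
pose s1 := [seq h0 + k | k <- Dseq].
pose s2 := flatten [seq nseq (c k) (h0 + k) | k <- Dseq].
have sz1 : (size s1 <= #|H|)%N by rewrite size_map.
have sz2 : (size s2 <= #|H| * e)%N.
  rewrite size_flatten sumnE !big_map (leq_trans (n := (size Dseq * e)%N)) ?leq_mul2r ?size_Dseq ?orbT //.
  rewrite -sum1_size big_distrl /=; apply: leq_sum => k _.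
  by rewrite size_nseq mul1n ltnW.
pose s := s1 ++ s2 ++ nseq (n - size s1 - size s2) h0.
have size_s : size s = n.
  rewrite !size_cat size_nseq; move: nn; rewrite mulnS; lia.
have sum_s : \sum_(x <- s) gm x = g.
  rewrite !big_cat /= big_map big_nseq iter_addr_0.
  have -> : \sum_(x <- s2) gm x = \sum_(k <- Dseq) gm (h0 + k) *+ c k.
    rewrite big_flatten big_map; apply: eq_bigr => k _.
    by rewrite big_nseq iter_addr_0.
  have -> : g = gm h0 *+ n + \sum_(k <- Dseq) (gm (h0 + k) - gm h0) +
      \sum_(k <- Dseq) (gm (h0 + k) - gm h0) *+ c k.
    by rewrite -gE; zmod.
  rewrite sumrB big_const_seq count_predT iter_addr_0.
  under [X in _ = _ + X]eq_bigr do rewrite mulrnBl.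
  rewrite sumrB sumrMnr.
  have -> : (\sum_(k <- Dseq) c k = size s2)%N.
    by rewrite size_flatten sumnE !big_map; apply: eq_bigr => k _; rewrite size_nseq.
  rewrite [in RHS](_ : n = (n - size s1 - size s2) + size s1 + size s2)%N; last first.
    by move: size_s; rewrite !size_cat size_nseq; lia.
  rewrite !mulrnDr (_ : size s1 = size Dseq); last by rewrite size_map.
  by zmod.
have Ds x : x \in s -> D (x - h0).
  have D0 : D (h0 - h0) by rewrite subrr; exact: (@rpred0 _ sD).
  rewrite !mem_cat => /or3P [/mapP [k]|/flattenP [t /mapP [k]]|].
  - by rewrite mem_filter => /andP [Dk _] ->; rewrite addrAC subrr add0r.
  - rewrite mem_filter => /andP [Dk _] -> ; rewrite mem_nseq => /andP [_ /eqP ->].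
    by rewrite addrAC subrr add0r.
  - by rewrite mem_nseq => /andP [_ /eqP ->].
have sDk k : D k -> h0 + k \in s.
  by move=> Dk; rewrite mem_cat map_f // mem_filter Dk mem_index_enum.
have h0s : h0 \in s by rewrite -[h0]addr0; apply: sDk; exact: (@rpred0 _ sD).
have full_s : full s.
  move=> x; pose sG := subgroup (generated_closed [set` s]).
  have ss y : y \in s -> y \in sG by move=> ys; exact: generated_mem.
  suff : x \in sG by [].
  have [Dx|Dx] : D x \/ D (x - h0).
    by case: tD => [[DT _]|[_ _]]; [left; exact: DT|exact].
    rewrite (_ : x = h0 + x - h0); last by zmod.
    by apply: rpredB; apply: ss => //; exact: sDk.
  by rewrite (_ : x = h0 + (x - h0)); [apply: ss; exact: sDk|zmod].
have span_s : span s = D.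
  apply/ffunP => x; rewrite ffunE; apply/idP/idP => [|Dx].
    apply: generated_sub cD _ x => y [a [b [/Ds Da /Ds Db yE]]].
    suff : y \in sD by []; case: yE => ->.
      rewrite (_ : a + b = (a - h0) + (b - h0) + (h0 + h0)); last by zmod.
      apply: rpredD; last exact: coset_type_double tD.
      exact: (@rpredD _ sD).
    rewrite (_ : a - b = (a - h0) - (b - h0)); last by zmod.
    exact: (@rpredB _ sD).
  rewrite (_ : x = h0 + x - h0); last by zmod.
  by apply: generated_mem; exists (h0 + x), h0; split; auto.
exists [ffun i : 'I_n => s`_i].
have ts : tseq [ffun i : 'I_n => s`_i] = s.
  apply: (@eq_from_nth _ 0); rewrite size_tseq ?size_s // => i ni.
  by rewrite -[i]/(val (Ordinal ni)) nth_tseq ffunE.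
by rewrite ts; split=> //; rewrite -sum_s -[in RHS]ts sum_tseq.
Qed.

End AttainedSums.

(** * Elementary abelian 2-groups and subgroups of index two *)

Section F2Basis.
Variable V : zmodType.
Hypothesis V2 : forall v : V, v + v = 0.
Variable B : nat.
Hypothesis V_bound : forall r (f : 'rV['F_2]_r -> V), injective f -> (2 ^ r <= B)%N.

Lemma mulrn_F2D (v : V) (a b : 'F_2) :
  v *+ nat_of_ord (a + b) = v *+ nat_of_ord a + v *+ nat_of_ord b.
Proof.
have mod2 m : v *+ (m %% 2) = v *+ m.
  by rewrite [in RHS](divn_eq m 2) mulrnDr mulnC mulrnA mulr2n V2 mul0rn add0r.
by rewrite -mulrnDr -[RHS]mod2.
Qed.

Lemma additive_of_addr (W : zmodType) (f : W -> V) :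
  {morph f : x y / x + y} -> zmod_morphism f.
Proof.
move=> fD x y; apply: (addIr (f y)); rewrite -fD subrK.
by rewrite addrNK.
Qed.

(** An injective additive map from a row space of largest dimension is onto, since a vector outside
    its image would extend it. [V_bound] replaces finiteness of [V], which will be a quotient
    without a finite type structure. *)
Lemma F2_basis : exists r (f : 'rV['F_2]_r -> V), zmod_morphism f /\ bijective f.
Proof.
pose P r := exists2 f : 'rV['F_2]_r -> V, zmod_morphism f & injective f.
have P0 : P 0%N.
  exists (fun=> 0) => [x y|x y _]; first by rewrite subr0.
  by apply/rowP; case.
have Pbound r : `[< P r >] -> (r <= B)%N.
  move=> /asboolP [f _ /V_bound]; apply: leq_trans; exact/ltnW/ltn_expl.
have exP : exists r, `[< P r >] by exists 0%N; exact/asboolP.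
case: (ex_maxnP exP Pbound) => r /asboolP [f fB f_inj] r_max.
exists r, f; split=> //.
have f_surj v : exists u, f u = v.
  apply: contrapT => nv; suff : P r.+1 by move/asboolP/r_max; rewrite ltnn.
  have f0 : f 0 = 0 by have := fB 0 0; rewrite !subrr.
  have fN w : f (- w) = - f w by rewrite -[- w]sub0r fB f0 sub0r.
  have fD x y : f (x + y) = f x + f y by rewrite -{1}[y]opprK fB fN opprK.
  pose g (u : 'rV['F_2]_(1 + r)) : V := v *+ (u 0 0) + f (rsubmx u).
  have gB : zmod_morphism g.
    apply: additive_of_addr => x y; rewrite /g mxE mulrn_F2D.
    by rewrite linearD fD; zmod.
  exists g => // x y gxy; apply/eqP; rewrite -subr_eq0.
  have : g (x - y) = 0 by rewrite gB gxy subrr.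
  move: (x - y : 'rV['F_2]_(1 + r)) => u; rewrite /g => gu0.
  have u00 : u 0 0 = 0.
    move: gu0; case: (u 0 0) => -[|[|//]] u0 /=; first by move=> _; exact/val_inj.
    rewrite mulr1n => /eqP; rewrite addr_eq0 => /eqP vE.
    by case: nv; exists (- rsubmx u); rewrite fN.
  move: gu0; rewrite u00 mulr0n add0r -f0 => /f_inj ru0.
  rewrite -[u]hsubmxK ru0; apply/eqP/rowP => i.
  rewrite [RHS]mxE mxE; case: splitP => k _; last by rewrite mxE.
  by rewrite mxE (ord1 k) -[RHS]u00; congr (u 0 _); apply/val_inj.
have [f' f'K] : {f' : V -> 'rV['F_2]_r & forall v, f (f' v) = v} by exact: choice f_surj.
exists f' => // u; exact/f_inj/f'K.
Qed.

End F2Basis.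

Section F2Count.
Variables (H : finZmodType).

Lemma F2_basis_surj (V : zmodType) (pr : {additive H -> V}) :
  (forall v, exists h, v = pr h) -> (forall v : V, v + v = 0) ->
  exists r (f : 'rV['F_2]_r -> V) (g : {additive H -> 'rV['F_2]_r}),
    [/\ zmod_morphism f, bijective f, forall h, f (g h) = pr h
      & #|H| = (#|[set h | (pr h == 0)%R]%SET| * 2 ^ r)%N].
Proof.
move=> pr_surj V2.
have bound r (f : 'rV['F_2]_r -> V) : injective f -> (2 ^ r <= #|H|)%N.
  move=> f_inj; have [s sK] := choice pr_surj.
  have sf_inj : injective (s \o f) by move=> x y /= E; apply: f_inj; rewrite (sK (f x)) E -sK.
  by have := leq_card _ sf_inj; rewrite card_mx mul1n card_Fp.
have [r [f [fB bij_f]]] := F2_basis V2 bound.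
have [f' fK f'K] := bij_f.
have gB : zmod_morphism (f' \o pr).
  by move=> x y; apply: (bij_inj bij_f); rewrite fB /= !f'K raddfB.
pose g : {additive H -> 'rV['F_2]_r} := HB.pack (f' \o pr) (GRing.isZmodMorphism.Build _ _ _ gB).
exists r, f, g; split=> //; first by move=> h; exact: f'K.
pose sH : zmodClosed H := HB.pack (predT : pred H)
  (GRing.isZmodClosed.Build H predT (conj isT (fun _ _ _ _ => isT))).
have f0 : f 0 = 0 by have := fB 0 0; rewrite !subrr.
have := card_additive sH g.
rewrite (_ : [set x in sH]%SET = [set: H]%SET); last by apply/setP => x; rewrite !inE.
rewrite cardsT => ->; congr (_ * _)%N.
  apply: eq_card => x; rewrite !inE /= -[RHS](inj_eq (can_inj f'K)).
  by rewrite -[0 in RHS]f0 fK.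
rewrite (_ : [set g x | x in sH]%SET = [set: 'rV['F_2]_r]%SET).
  by rewrite cardsT card_mx mul1n card_Fp.
apply/setP => u; rewrite inE; apply/imsetP.
have [h hE] := pr_surj (f u); exists h => //=.
by rewrite -hE fK.
Qed.

(* Indicator functions of subgroups of index at most two. *)
Definition xor_additive (D : {ffun H -> bool}) : Prop :=
  forall x y, D (x + y) = (D x == D y).

(** Such [D] are the kernels of the linear forms on the F_2-space H/W, and the dual space has as
    many elements as H/W. *)
Lemma card_xor_additive (W : pred H) : zmod_closed W -> (forall h, W (h + h)) ->
  (#|[set D : {ffun H -> bool} | `[< xor_additive D /\ forall w, W w -> D w >]]%SET| *
    #|[set h | W h]%SET| = #|H|)%N.
Proof.
move=> cW W2.
have pr_surj (v : zquot cW) : exists h, v = zproj cW h by exact: zproj_surj.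
have V2 (v : zquot cW) : v + v = 0.
  by have [h ->] := pr_surj v; apply/eqP; rewrite -raddfD zproj_eq0; exact: W2.
have [r [f [g [fB bij_f gE ->]]]] := F2_basis_surj pr_surj V2.
have [f' fK f'K] := bij_f.
have f0 : f 0 = 0 by have := fB 0 0; rewrite !subrr.
have g_surj u : exists h, g h = u.
  have [h hE] := pr_surj (f u); exists h.
  by apply: (bij_inj bij_f); rewrite hE; exact: gE.
have gW h : (g h == 0) = W h.
  by rewrite -(inj_eq (bij_inj bij_f)) gE f0 zproj_eq0.
rewrite mulnC; congr (_ * _)%N; first by apply: eq_card => h; rewrite !inE zproj_eq0.
pose E (b : 'cV['F_2]_r) : {ffun H -> bool} := [ffun h => (g h *m b) 0 0 == 0].
have F2eq (a b : 'F_2) : (a + b == 0) = ((a == 0) == (b == 0)).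
  by case: a => -[|[|//]] ?; case: b => -[|[|//]] ?.
have E_inj : injective E.
  move=> b b' /ffunP bb'; apply/colP => i.
  have [h hE] := g_surj (delta_mx 0 i); have := bb' h.
  rewrite !ffunE hE -!rowE !mxE.
  by case: (b i 0) => -[|[|//]] ?; case: (b' i 0) => -[|[|//]] ? // _; exact/val_inj.
have <- : #|[set: 'cV['F_2]_r]%SET| = (2 ^ r)%N by rewrite cardsT card_mx muln1 card_Fp.
rewrite -(card_imset _ E_inj); apply: eq_card => D; rewrite !inE.
apply/asboolP/imsetP => [[Dx DW]|[b _ ->]]; last first.
  split=> [x y|w]; first by rewrite !ffunE raddfD mulmxDl mxE F2eq.
  by rewrite -gW ffunE => /eqP ->; rewrite mul0mx mxE.
have [s sE] := choice g_surj.
exists (\col_i (if D (s (delta_mx 0 i)) then 0 else 1)) => //.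
set b := \col_i _; have D0 w : g w = 0 -> D w by move=> /eqP; rewrite gW; exact: DW.
have DN y : D (- y) = D y.
  by have := Dx (- y) y; rewrite addNr (D0 0) ?raddf0 // => /esym/eqP.
have Ds h : D h = D (s (g h)).
  by apply/esym/eqP; rewrite -DN -Dx; apply: D0; rewrite raddfD raddfN sE addNr.
have DsD u u' : D (s (u + u')) = (D (s u) == D (s u')).
  by rewrite -Dx [RHS]Ds raddfD !sE.
have DsE u : D (s u) = ((u *m b) 0 0 == 0).
  rewrite [u in LHS]matrix_sum_delta [u in RHS]matrix_sum_delta big_ord1.
  apply: (big_ind (fun u => D (s u) = ((u *m b) 0 0 == 0))) => [|x y Px Py|i _].
  - by rewrite mul0mx mxE eqxx; apply: D0; rewrite sE.
  - by rewrite DsD Px Py mulmxDl [in RHS]mxE F2eq.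
  - case: (u 0 i) => -[|[|//]] ui.
      rewrite (_ : Ordinal ui = 0); last exact/val_inj.
      by rewrite scale0r mul0mx mxE eqxx; apply: D0; rewrite sE.
    rewrite (_ : Ordinal ui = 1); last exact/val_inj.
    by rewrite scale1r -rowE !mxE; case: (D _).
by apply/ffunP => h; rewrite ffunE -DsE -Ds.
Qed.

Lemma rank_d_card :
  (#|[set (x + x)%R | x in [set: H]]%SET| * 2 ^ rank_d 2 H)%N = #|H|.
Proof.
pose cW := @multiple_closed H 2.
have V2 (v : zquot cW) : v + v = 0.
  have [h ->] := zproj_surj v; apply/eqP; rewrite -raddfD zproj_eq0.
  by apply/asboolP; exists h; rewrite mulr2n.
have [r [f [g [fB bij_f _ ->]]]] := F2_basis_surj (@zproj_surj _ _ cW) V2.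
rewrite /rank_d (Fp_dimE fB bij_f); congr (_ * _)%N; apply: eq_card => h.
rewrite inE zproj_eq0; apply/imsetP/asboolP => [[x _ ->]|[x ->]]; by exists x.
Qed.

End F2Count.

HB.instance Definition _ (H : finZmodType) := [Finite of two_torsion H by <:].

Lemma rank_t_card (H : finZmodType) :
  (#|[set x : H | (x + x == 0)%R & x \in [set (y + y)%R | y in [set: H]]%SET]%SET| *
    2 ^ rank_t H = #|[set x : H | (x + x == 0)%R]%SET|)%N.
Proof.
pose T : finZmodType := two_torsion H.
pose cW := @two_torsion_multiple_closed H.
have T2 (x : T) : x + x = 0.
  by apply/val_inj; case: x => x /= /eqP; rewrite mulr2n.
have V2 (v : zquot cW) : v + v = 0.
  by have [h ->] := zproj_surj v; rewrite -raddfD T2 raddf0.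
have cardT : #|T| = #|[set x : H | (x + x == 0)%R]%SET|.
  rewrite card_sig; apply: eq_card => x; rewrite !inE.
  by rewrite /torsion mulr2n.
have [r [f [g [fB bij_f _]]]] := @F2_basis_surj T _ _ (@zproj_surj _ _ cW) V2.
rewrite -cardT => ->; rewrite /rank_t (Fp_dimE fB bij_f); congr (_ * _)%N.
rewrite -(card_imset _ val_inj); apply: eq_card => x; rewrite inE.
apply/andP/imsetP => [[x2 /imsetP [y _ xy]]|[u]].
  have xT : torsion 2 x by rewrite /torsion mulr2n.
  exists (exist _ x xT : T) => //; rewrite inE zproj_eq0; apply/asboolP.
  by exists y; rewrite mulr2n.
rewrite inE zproj_eq0 => /asboolP [y yE] ->; split.
  by have := congr1 val (T2 u) => /= ->.
by apply/imsetP; exists y => //; rewrite yE mulr2n.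
Qed.

Section IndexTwo.
Variable H : finZmodType.
Implicit Type D : {ffun H -> bool}.

Lemma coset_type_xor D : zmod_closed D -> coset_type D (base D) -> xor_additive D.
Proof.
move=> cD [[DT _]|[nD D2 Dc]] x y; first by rewrite !DT.
pose sD := subgroup cD; set h := base D in nD D2 Dc.
have memD z : D z = (z \in sD) by [].
have [Dx|Dx] := boolP (D x).
  by rewrite !memD; rewrite memD in Dx; rewrite rpredDl.
have [Dy|Dy] := boolP (D y).
  by rewrite memD in Dy; rewrite !memD rpredDr // -memD (negPf Dx).
have [] := (Dc x, Dc y) => -[]; first by rewrite (negPf Dx).
move=> Dxh []; first by rewrite (negPf Dy).
move=> Dyh; rewrite eqxx (_ : x + y = (x - h) + (y - h) + (h + h)); last by zmod.
by apply: (@rpredD _ sD) => //; apply: (@rpredD _ sD).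
Qed.

Lemma xor_coset_type D : xor_additive D ->
  zmod_closed D /\ coset_type D (base D).
Proof.
move=> Dx; have D0 : D 0 by have := Dx 0 0; rewrite addr0 eqxx.
have DN x : D (- x) = D x by have := Dx (- x) x; rewrite addNr D0 => /esym/eqP.
split; first by split=> // x y xD yD; rewrite -[_ \in _]/(D (x - y)) Dx DN; apply/eqP; rewrite [LHS]xD [RHS]yD.
rewrite /base; case: pickP => [h nh|DT]; [right|left].
  split=> // [|x]; first by rewrite Dx eqxx.
  case: (boolP (D x)) => [|nx]; [by left|right].
  by rewrite Dx DN (negPf nx) (negPf nh).
by split=> // h; move/negbFE: (DT h).
Qed.

Lemma base_full D : (forall h, D h) <-> D (base D).
Proof.
split=> [//|]; rewrite /base; case: pickP => [h /negPf -> //|DT _ h].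
by move/negbFE: (DT h).
Qed.

Let H2 : {set H} := [set x : H | (x + x == 0)%R]%SET.
Let dH : {set H} := [set (x + x)%R | x in [set: H]]%SET.
Let dbl (x : H) : H := x + x.
Let dbl_additive : zmod_morphism dbl. Proof. by move=> x y; rewrite /dbl; zmod. Qed.
Let dA : {additive H -> H} := HB.pack dbl (GRing.isZmodMorphism.Build _ _ dbl dbl_additive).

Let card_dbl (S : pred H) (cS : zmod_closed S) :
  (#|[set x | S x]%SET| =
   #|[set x | S x & (x + x == 0)%R]%SET| * #|[set (x + x)%R | x in [set x | S x]]%SET|)%N.
Proof.
have := card_additive (subgroup cS) dA.
have -> : [set x in subgroup cS]%SET = [set x | S x]%SET by apply/setP => x; rewrite !inE.
have -> : [set x in subgroup cS | dA x == 0%R]%SET = [set x | S x & (x + x == 0)%R]%SET.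
  by apply/setP => x; rewrite !inE.
move=> ->; congr (_ * _)%N; apply: eq_card => y.
by apply/imsetP/imsetP => -[x xS ->]; exists x => //; move: xS; rewrite inE.
Qed.

Let predT_closed : zmod_closed (predT : pred H). Proof. by []. Qed.

(** The kernel and the cokernel of doubling on a finite group have the same order. *)
Lemma card_torsion : #|H2| = (2 ^ rank_d 2 H)%N.
Proof.
have := card_dbl predT_closed.
have -> : [set x : H | predT x]%SET = [set: H]%SET by apply/setP => x; rewrite !inE.
rewrite cardsT -/dH -rank_d_card -/dH mulnC => /eqP.
rewrite eqn_pmul2r; last by apply/card_gt0P; exists (0 + 0); apply/imsetP; exists 0.
by move/eqP=> ->; apply: eq_card => x; rewrite !inE.
Qed.

Let multiple2 (x : H) : multiple 2 x = (x \in dH).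
Proof.
by apply/asboolP/imsetP => [[y ->]|[y _ ->]]; exists y.
Qed.

Lemma card_xor : #|[set D : {ffun H -> bool} | `[< xor_additive D >]]%SET| = (2 ^ rank_d 2 H)%N.
Proof.
have W2 h : @multiple H 2 (h + h) by apply/asboolP; exists h.
have := card_xor_additive (@multiple_closed H 2) W2.
rewrite -[RHS]rank_d_card mulnC => /eqP.
rewrite (_ : #|[set h | multiple 2 h]%SET| = #|dH|); last first.
  by apply: eq_card => h; rewrite inE multiple2.
rewrite eqn_pmul2l; last by apply/card_gt0P; exists (0 + 0); apply/imsetP; exists 0.
move/eqP => <-; apply: eq_card => D; rewrite !inE; apply/asboolP/asboolP => [Dx|[]//].
by split=> // w; rewrite multiple2 => /imsetP [x _ ->]; rewrite Dx eqxx.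
Qed.

Definition xor_torsion D := `[< xor_additive D /\ forall t, t + t = 0 -> D t >].

Lemma card_xor_torsion :
  (#|[set D : {ffun H -> bool} | xor_torsion D]%SET| * 2 ^ rank_t H = 2 ^ rank_d 2 H)%N.
Proof.
(* W = 2H + H[2], so |W| = |H[2]| |4H|. Comparing with |2H| = |2H[2]| |4H|, where 2H[2] is the
   2-torsion of 2H, and |H| = 2^d |2H| gives |H/W| = 2^(d-t). *)
pose W (x : H) := `[< exists y t, t + t = 0 /\ x = y + y + t >].
have cW : zmod_closed W.
  split=> [|_ _ /asboolP [y [t [t2 ->]]] /asboolP [y' [t' [t2' ->]]]]; apply/asboolP.
    by exists 0, 0; rewrite !addr0.
  exists (y - y'), (t - t'); split; last by zmod.
  by rewrite addrACA t2 -opprD t2' subr0.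
have W2 h : W (h + h) by apply/asboolP; exists h, 0; rewrite !addr0.
have := card_xor_additive cW W2.
rewrite (_ : [set D : {ffun H -> bool} | _]%SET = [set D : {ffun H -> bool} | xor_torsion D]%SET); last first.
  apply/setP => D; rewrite !inE; apply/asboolP/asboolP => -[Dx Dt]; split=> //.
    by move=> t t2; apply: Dt; apply/asboolP; exists 0, t; rewrite !add0r.
  by move=> _ /asboolP [y [t [t2 ->]]]; rewrite !Dx eqxx (Dt _ t2).
pose ddH := [set (x + x)%R | x in dH]%SET.
have cardW : #|[set h | W h]%SET| = (#|H2| * #|ddH|)%N.
  rewrite (card_dbl cW); congr (_ * _)%N; apply: eq_card => x; rewrite ?inE.
    apply: andb_idl => /eqP x2; apply/asboolP; exists 0, x.
    by rewrite !add0r.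
  apply/imsetP/imsetP => -[z].
    rewrite inE => /asboolP [y [t [t2 ->]]] ->; exists (y + y); first by apply/imsetP; exists y.
    by rewrite addrACA t2 addr0.
  by move=> /imsetP [y _ ->] ->; exists (y + y) => //; rewrite inE.
have carddH : #|dH| = (#|[set x in dH | (x + x == 0)%R]%SET| * #|ddH|)%N.
  have := card_dbl (@multiple_closed H 2).
  have -> : [set x | multiple 2 x]%SET = dH by apply/setP => x; rewrite inE multiple2.
  by move=> ->; congr (_ * _)%N; apply: eq_card => x; rewrite !inE multiple2.
have := rank_t_card H; rewrite -/dH -/H2.
rewrite (_ : [set x | _ & _]%SET = [set x in dH | (x + x == 0)%R]%SET); last first.
  by apply/setP => x; rewrite !inE andbC.
have ddH_gt0 : (0 < #|ddH|)%N.
  apply/card_gt0P; exists (0 + 0); apply/imsetP; exists 0 => //.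
  by apply/imsetP; exists 0; rewrite ?addr0.
move=> rt; rewrite cardW -[RHS]rank_d_card -/dH carddH -rt => /eqP E.
have k_gt0 : (0 < #|[set x in dH | (x + x == 0)%R]%SET|)%N.
  by apply/card_gt0P; exists 0; rewrite inE addr0 eqxx andbT; apply/imsetP; exists 0; rewrite ?addr0.
apply/eqP; move: E; set k := #|[set x in _ | _]%SET|; set w := #|ddH|.
have kw : (0 < k * w)%N by rewrite muln_gt0 k_gt0.
by move=> /eqP E; rewrite -(eqn_pmul2l kw) -E mulnCA [(k * w * _)%N]mulnAC.
Qed.

(** If some 2-torsion element lies outside [D], translation by it exchanges the parts of H[2] inside
    and outside [D]. *)
Lemma card_xor_half D : xor_additive D ->
  (#|[set x | D x & (x + x == 0)%R]%SET| * (if xor_torsion D then 1 else 2) = #|H2|)%N.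
Proof.
move=> Dx; rewrite /xor_torsion; case: asboolP => [[_ Dt]|nD].
  by rewrite muln1; apply: eq_card => x; rewrite !inE; apply: andb_idl => /eqP /Dt.
have [t t2 nDt] : exists2 t, t + t = 0 & ~~ D t.
  apply: contrapT => nt; apply: nD; split=> // t t2; apply: contrapT => /negP nDt.
  by apply: nt; exists t.
rewrite -(cardsID [set x | D x]%SET H2) muln2 -addnn; congr (_ + _)%N.
  by apply: eq_card => x; rewrite !inE andbC.
rewrite -[LHS](card_imset _ (addrI t)); apply: eq_card => x; rewrite !inE.
apply/imsetP/andP => [[y]|[nDx /eqP x2]].
  by rewrite inE => /andP [Dy /eqP y2] ->; rewrite Dx Dy (negPf nDt) addrACA t2 y2 addr0 eqxx.
exists (t + x); last by rewrite addrA t2 add0r.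
by rewrite inE Dx (negPf nDt) (negPf nDx) addrACA t2 x2 addr0 !eqxx.
Qed.

(** By [card_xor_half], 2^d / |D[2]| is the weight [wt D], 1 or 2. Over all 2^d subgroups the
    weights add up to 2 * 2^d minus the number of those containing H[2]; D = H, of weight 1, is then
    removed. The identity is arranged without subtraction or division. *)
Lemma sum_index_two (g : nat) (cnt : {ffun H -> bool} -> nat) :
  (forall D, xor_additive D -> ~~ D (base D) ->
     cnt D * 4 * #|[set x | D x & (x + x == 0)%R]%SET| = g)%N ->
  (4 * 2 ^ rank_d 2 H *
     (\sum_(D | `[< xor_additive D >] && ~~ D (base D)) cnt D)
   + g * (#|[set D : {ffun H -> bool} | xor_torsion D]%SET|).+1 = g * 2 * 2 ^ rank_d 2 H)%N.
Proof.
move=> cntE; pose wt D := if xor_torsion D then 1%N else 2%N.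
have term D : `[< xor_additive D >] && ~~ D (base D) ->
    (4 * 2 ^ rank_d 2 H * cnt D = g * wt D)%N.
  move=> /andP [/asboolP Dx nD]; rewrite -card_torsion -(card_xor_half Dx) -(cntE D Dx nD).
  by rewrite /wt; ring.
rewrite big_distrr /= (eq_bigr _ term) -big_distrr /= -mulnA -mulnDr; congr (_ * _)%N.
rewrite -card_xor; pose DT : {ffun H -> bool} := [ffun=> true].
have wT D : `[< xor_additive D >] = (`[< xor_additive D >] && ~~ D (base D)) || (D == DT).
  have [->|DnT] := eqVneq D DT.
    by rewrite orbT; apply/asboolP => x y; rewrite !ffunE.
  rewrite orbF andb_idr // => _; apply/negP => /base_full DD; case/eqP: DnT.
  by apply/ffunP => x; rewrite ffunE DD.
have xT : xor_torsion DT by apply/asboolP; split=> [x y|t _]; rewrite !ffunE.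
have sumall : (\sum_(D | `[< xor_additive D >]) wt D =
    \sum_(D | `[< xor_additive D >] && ~~ D (base D)) wt D + 1)%N.
  rewrite (bigD1 DT) /=; last by apply/asboolP => x y; rewrite !ffunE.
  rewrite /wt xT addnC; congr (_ + _)%N; apply: eq_bigl => D.
  rewrite [in LHS]wT; have [->|_] := eqVneq D DT; last by rewrite orbF andbT.
  by rewrite andbF; apply/esym/negbTE; rewrite negb_and negbK ffunE orbT.
have : (\sum_(D | `[< xor_additive D >]) wt D + #|[set D : {ffun H -> bool} | xor_torsion D]%SET| =
    2 * #|[set D : {ffun H -> bool} | `[< xor_additive D >]]%SET|)%N.
  rewrite -!sum1dep_card big_distrr /=.
  rewrite [X in (_ + X)%N](_ : _ = \sum_(D | `[< xor_additive D >]) xor_torsion D)%N; last first.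
    rewrite [RHS]big_mkcond [LHS]big_mkcond; apply: eq_bigr => D _.
    rewrite /xor_torsion; case: (asboolP (_ /\ _)) => [[Dx Dt]|_]; last by case: asboolP.
    by rewrite asboolT.
  by rewrite -big_split; apply: eq_bigr => D _; rewrite /wt; case: xor_torsion.
by rewrite sumall addn1 addSn -addnS.
Qed.

End IndexTwo.

(** * Finiteness of [Gamma H] and the number of orbits *)

Section GammaFinite.
Variables (H : finZmodType) (e : nat).
Hypothesis e_gt0 : (0 < e)%N.
Hypothesis eG : forall g : Gamma H, g *+ e = 0.

Definition gamma_enum : seq (Gamma H) :=
  undup [seq \sum_x gamma x *+ (c x : nat) | c : {ffun H -> 'I_e} <- enum {: {ffun H -> 'I_e}}].

Lemma gamma_enum_uniq : uniq gamma_enum. Proof. exact: undup_uniq. Qed.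

Lemma mem_gamma_enum g : g \in gamma_enum.
Proof.
have [u ->] := gamma_gen g; rewrite mem_undup; apply/mapP.
have e0 : (e%:Z != 0)%R by lia.
have uP x : (`|(u x %% e)%Z| < e)%N.
  by rewrite -ltz_nat gez0_abs ?modz_ge0 // ltz_pmod //; lia.
exists [ffun x => Ordinal (uP x)]; first by rewrite mem_enum.
apply: eq_bigr => x _; rewrite ffunE /=.
rewrite {1}(divz_eq (u x) e) mulrzDr mulrC mulrzA -pmulrn eG mul0rz add0r.
by rewrite pmulrn gez0_abs ?modz_ge0.
Qed.

Definition gamma_fin : finZmodType := fin_zmod gamma_enum_uniq mem_gamma_enum.

Lemma gamma_universal : universal_quadratic (@gamma H : H -> gamma_fin).
Proof.
split; first exact: gamma_quadratic; first exact: gamma_ind.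
move=> A q /Gamma_universal [g [[gB gq] _]].
by exists (HB.pack g (GRing.isZmodMorphism.Build _ _ g gB) : {additive gamma_fin -> A}).
Qed.

Lemma counting_gamma (R : realType) :
  counting [set: Gamma H] = #|gamma_fin|%:R%:E :> \bar R.
Proof.
rewrite (@counting_seq _ _ (enum gamma_fin)) ?enum_uniq // => [|g].
  by rewrite -cardE.
by split=> // _; rewrite (mem_enum (gamma_fin : {pred gamma_fin})).
Qed.

End GammaFinite.

Section OrbitCount.
Variables (R : realType) (p : nat) (H : finZmodType) (K : nat).
Hypothesis p_prime : prime p.
Let ex := (p ^ K.+1)%N.
Hypothesis pH : forall h : H, h *+ ex = 0.
Hypothesis pG : forall g : Gamma H, g *+ ex = 0.

Let ex_gt0 : (0 < ex)%N := ltnW (expp_gt1 p_prime K).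
Local Notation G := (gamma_fin ex_gt0 pG).
Let gm : H -> G := @gamma H.
Let uq : universal_quadratic gm. Proof. exact: gamma_universal. Qed.

(** The first term is the contribution of D = H, the sum that of the subgroups of index two. *)
Definition orbit_number : nat := (#|G| +
  \sum_(D : {ffun H -> bool} | `[< xor_additive D >] && ~~ D (base D))
    #|coset_steps gm ex D (base D)|)%N.

Let X n (F : {ffun 'I_n -> H}) : bool := `[< full (tseq F) >].
Let iota n (F : {ffun 'I_n -> H}) : {ffun H -> bool} * G :=
  (span (tseq F), \sum_i gm (F i)).

Lemma card_invariants n : (#|H| * ex.+1 + 2 <= n)%N ->
  #|[set iota F | F in X (n := n)]%SET| = orbit_number.
Proof.
move=> nn; have n1 : (1 < n)%N by apply: leq_trans nn; rewrite addnC.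
pose I := [set iota F | F in X (n := n)]%SET.
have fiber D : xor_additive D ->
    #|[set u in I | u.1 == D]%SET| = #|coset_steps gm ex D (base D)|.
  move=> /xor_coset_type [cD tD].
  pose tr (s : G) : {ffun H -> bool} * G := (D, s + gm (base D) *+ n).
  have tr_inj : injective tr by move=> s s' [/addIr].
  rewrite -[RHS](card_imset _ tr_inj); apply: eq_card => -[D' g]; rewrite !inE /=.
  apply/andP/imsetP => [[/imsetP [F /asboolP fF [-> ->]] /eqP FD]|[s sS [-> ->]]].
    exists (\sum_i gm (F i) - gm (base D) *+ n); last by rewrite /tr subrK FD.
    exact: (attained_sub gm ex_gt0 pG n1 fF FD).
  split=> //; have [|F [fF FD Fg]] := attained_sup (gm := gm) (g := s + gm (base D) *+ n) ex_gt0 pG cD tD nn.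
    by rewrite addrK.
  apply/imsetP; exists F; first exact/asboolP.
  by rewrite /iota FD Fg.
have fiber0 D : ~ xor_additive D -> #|[set u in I | u.1 == D]%SET| = 0%N.
  move=> nD; apply: eq_card0 => -[D' g]; rewrite !inE /=; apply/negP.
  move=> /andP [/imsetP [F /asboolP fF [-> _]] /eqP FD]; apply: nD.
  rewrite -FD; apply: coset_type_xor; first exact: span_closed.
  by apply: (span_coset fF _).1; rewrite size_tseq.
rewrite -/I -sum1_card (partition_big fst predT) //=.
rewrite (eq_bigr (fun D => #|[set u in I | u.1 == D]%SET|)); last first.
  by move=> D _; rewrite -sum1dep_card.
pose DT : {ffun H -> bool} := [ffun=> true].
have xT : xor_additive DT by move=> x y; rewrite !ffunE.
have bT : DT (base DT) by rewrite ffunE.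
rewrite (bigD1 DT) //= fiber // (card_coset_steps_full uq ex_gt0 pG (xor_coset_type xT).2); last first.
  by move=> h; rewrite ffunE.
rewrite /orbit_number; congr (_ + _)%N; rewrite [RHS]big_mkcond [LHS]big_mkcond.
  apply: eq_bigr => D _; case: asboolP => [Dx|nD]; last by rewrite fiber0 // if_same.
  rewrite /= fiber //; congr (if _ then _ else _).
  congr (~~ _); apply/eqP/idP => [-> //|/base_full DD].
  by apply/ffunP => x; rewrite ffunE DD.
Qed.

Lemma expectation_orbit_number : exists N, forall n, (N <= n)%N ->
  forall (e : ensemble) d (T : measurableType d) (P : probability T R)
    (A : {RV P >-> 'M[padic_int p]_n}), haar_random e A ->
  (\int[P]_w counting (Sur (cok (A w - 1%:M)) H) = (orbit_number%:R)%:E)%E.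
Proof.
have [n0 n0P] := orth_classification p_prime pH.
(* The summands serve, in order, the classification of orbits, the realisation of all invariants,
   and n > |H| for passing from O_n to SO_n. *)
exists (n0 + (#|H| * ex.+1 + 2) + #|H|)%N => n nn e d T P A hA.
rewrite -(@card_invariants n); last by lia.
apply: (expectation_orbits p_prime pH) hA; first by lia.
  move=> F E /asboolP fF /asboolP fE [FE gE].
  by apply: (orth_eqv_special p_prime pH); [lia|apply: n0P => //; lia].
move=> F B /asboolP fF oB.
have FE : orth_eqv p K F [ffun i => mact K F B i].
  by exists B => // j; rewrite ffunE.
split; first exact/asboolP/(orth_eqv_full p_prime pH FE).
rewrite /iota -(orth_eqv_span p_prime pH fF FE); congr (_, _).
exact: esym (orth_eqv_gamma p_prime pG FE).
Qed.

End OrbitCount.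

(** * [Sym2] and [Gamma] for odd exponent *)

Section SymmetricSquare.
Variables (H : finZmodType) (e : nat).
Hypothesis e_odd : odd e.
Hypothesis eH : forall h : H, h *+ e = 0.
Hypothesis eG : forall g : Gamma H, g *+ e = 0.

Lemma zproj_generated (V : zmodType) (E : set V) v :
  E v -> zproj (generated_closed E) v = 0.
Proof. by move=> Ev; apply/eqP; rewrite zproj_eq0; exact: generated_mem. Qed.

Lemma generated_lift (V A : zmodType) (E : set V) (f : {additive V -> A}) :
  (forall v, E v -> f v = 0) ->
  exists g : {additive zquot (generated_closed E) -> A},
    forall v, g (zproj (generated_closed E) v) = f v.
Proof.
move=> Ef; pose pr := zproj (generated_closed E).
have f0 v : pr v = 0 -> f v = 0.
  move=> /eqP; rewrite zproj_eq0 => vE.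
  have cS : zmod_closed (fun v => f v == 0).
    split=> [|x y]; rewrite /in_mem /= ?raddf0 // raddfB => /eqP -> /eqP ->.
    by rewrite subr0.
  by apply/eqP; apply: generated_sub cS _ v vE => w /Ef wE; apply/eqP.
pose g (c : zquot (generated_closed E)) := f (repr c).
have gE v : g (pr v) = f v.
  apply/eqP; rewrite -subr_eq0 -raddfB; apply/eqP/f0.
  rewrite /pr raddfB; apply/eqP; rewrite subr_eq0; apply/eqP.
  exact: (@reprK _ {ideal_quot (subgroup (generated_closed E))}).
have gB : zmod_morphism g.
  move=> x y; have [u ->] := zproj_surj x; have [v ->] := zproj_surj y.
  by rewrite -raddfB !gE raddfB.
by exists (HB.pack g (GRing.isZmodMorphism.Build _ _ g gB) : {additive _ -> A}).
Qed.

Lemma equalizer_closed (V W : zmodType) (f g : V -> W) :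
  zmod_morphism f -> zmod_morphism g -> zmod_closed (fun v => f v == g v).
Proof.
move=> fB gB; split=> [|x y /eqP xE /eqP yE]; apply/eqP.
  by rewrite -(subrr 0) fB gB !subrr.
by rewrite fB gB xE yE.
Qed.

Let s (x y : H) : Sym2 H := zproj (generated_closed (@sym_rel H)) (tens x y).

Lemma tens_biadditive : biadditive (@tens H).
Proof.
split=> x y z; apply/eqP; rewrite -subr_eq0 opprD addrA -!raddfB; apply/eqP;
  apply: zproj_generated; [left|right]; by exists x, y, z.
Qed.

Lemma sym_biadditive : biadditive s.
Proof.
have [Dl Dr] := tens_biadditive.
by split=> x y z; rewrite /s ?Dl ?Dr raddfD.
Qed.

Lemma sym_comm x y : s x y = s y x.
Proof.
apply/eqP; rewrite -subr_eq0 /s -raddfB; apply/eqP/zproj_generated.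
by exists x, y.
Qed.

Lemma sym_gen (P : pred (Sym2 H)) :
  zmod_closed P -> (forall x y, P (s x y)) -> forall v, P v.
Proof.
move=> cP Ps v; have [t ->] := zproj_surj v; have [u ->] := zproj_surj t.
rewrite [u]free_sum !raddf_sum; pose sP := subgroup cP.
apply: (@rpred_sum _ sP) => -[x y] _; rewrite !raddfMz.
by apply: (@rpredMz _ sP); exact: Ps.
Qed.

Let sMl n x y : s (x *+ n) y = s x y *+ n.
Proof.
have [Dl _] := sym_biadditive; have s0 : s 0 y = 0.
  by have := Dl 0 0 y; rewrite addr0 => /eqP; rewrite -subr_eq0 opprD addrA subrr sub0r oppr_eq0 => /eqP.
by elim: n => [|n IHn]; rewrite ?mulr0n // !mulrSr Dl IHn.
Qed.

Let sq (x : H) : Sym2 H := s x x.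

Let polar_sq x y : polar sq x y = s x y *+ 2.
Proof.
have [Dl Dr] := sym_biadditive; rewrite /polar /sq Dl !Dr (sym_comm y x).
by zmod.
Qed.

Lemma square_quadratic : homogeneous_quadratic sq.
Proof.
have [Dl Dr] := sym_biadditive; apply: quadratic_of_even.
  split=> x y z; rewrite !polar_sq ?Dl ?Dr; zmod.
move=> x; have NN y : s (- x) y = - s x y.
  apply/eqP; rewrite -addr_eq0 -Dl addNr; apply/eqP.
  by rewrite -[0 in LHS](mulr0n 0) sMl mulr0n.
by rewrite /sq NN sym_comm NN opprK.
Qed.

(** gamma(x) goes to the square of x, and the class of x tensor y goes back to half the polar form
    of gamma at (x, y). The factor c = (e + 1)/2 is one half modulo [e]. *)
Lemma Sym2_Gamma_bijection : exists f : Gamma H -> Sym2 H, bijective f.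
Proof.
have [f0 [[f0B f0E] _]] := Gamma_universal square_quadratic.
pose f : {additive Gamma H -> Sym2 H} :=
  HB.pack f0 (GRing.isZmodMorphism.Build _ _ f0 f0B).
have fE x : f (gamma x) = s x x by exact: esym (f0E x).
pose c := e.+1./2; have c2 : (2 * c)%N = e.+1 by rewrite /c; lia.
have mulc (V : zmodType) (v : V) : v *+ e = 0 -> v *+ 2 *+ c = v.
  by move=> ve; rewrite -mulrnA c2 mulrS ve addr0.
have [[pDl pDr] qZ] := gamma_quadratic H.
have bc : biadditive (fun x y => polar (@gamma H) x y *+ c).
  by split=> x y z; rewrite ?pDl ?pDr mulrnDl.
have [t0 [[t0B t0E] _]] := tensor_square_universal bc.
pose t : {additive tensor_square H -> Gamma H} :=
  HB.pack t0 (GRing.isZmodMorphism.Build _ _ t0 t0B).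
have tE x y : t (tens x y) = polar (@gamma H) x y *+ c by exact: t0E.
have [|g gE] := generated_lift (E := @sym_rel H) (f := t).
  move=> _ [x [y ->]]; rewrite raddfB !tE {1}/polar [x + y]addrC.
  by rewrite (_ : gamma (y + x) - gamma x - gamma y = polar (@gamma H) y x) ?subrr // /polar; zmod.
have gs x y : g (s x y) = polar (@gamma H) x y *+ c by rewrite gE.
have polar_xx x : polar (@gamma H) x x = gamma x *+ 2.
  have := qZ 2 x; rewrite -[x *~ 2]/(x *+ 2) mulr2n /polar => ->.
  by rewrite -[_ *~ _]/(gamma x *+ 4); zmod.
exists f, g => [v|v].
  apply/eqP; apply: (@gamma_ind H (fun v => g (f v) == v)) => [|x].
    by apply: equalizer_closed => // x y; rewrite !raddfB.
  by rewrite fE gs polar_xx mulc.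
apply/eqP; apply: (@sym_gen (fun v => f (g v) == v)) => [|x y].
  by apply: equalizer_closed => // x y; rewrite !raddfB.
rewrite gs raddfMn !raddfB !fE -[_ - _ - _]/(polar sq x y) polar_sq mulc //.
by rewrite -sMl eH -(mulr0n 0) sMl mulr0n.
Qed.

End SymmetricSquare.

Lemma counting_bij (R : realType) (U V : choiceType) (f : U -> V) (s : seq U) :
  uniq s -> (forall u, u \in s) -> bijective f ->
  counting [set: V] = counting [set: U] :> \bar R.
Proof.
move=> us sU [g fK gK].
rewrite (counting_seq _ us) => [|u]; last by split.
rewrite (@counting_seq _ _ (map f s)) ?size_map // ?map_inj_uniq //.
  exact: can_inj fK.
by move=> v; split=> // _; rewrite -[v]gK map_f.
Qed.

(** In a group of odd order every element is a double, and doubles lie in [D]. *)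
Lemma xor_additive_odd (H : finZmodType) (D : {ffun H -> bool}) :
  odd #|H| -> xor_additive D -> D (base D).
Proof.
move=> oH Dx; apply/base_full => h.
rewrite (_ : h = h *+ (#|H|.+1./2) + h *+ (#|H|.+1./2)) ?Dx //.
rewrite -mulrnDr (_ : _ + _ = #|H|.+1)%N; last by lia.
by rewrite mulrS card_finZmod_mulrn addr0.
Qed.

Theorem theorem1p1 (R : realType) (p : nat) (H : finZmodType)
    (p_prime : prime p) (H_pgroup : p.-nat #|H|) :
  (odd p -> exists N : nat, forall n : nat, (N <= n)%N ->
     forall (e : ensemble) (d : measure_display) (T : measurableType d)
       (P : probability T R) (A : {RV P >-> 'M[padic_int p]_n}),
     haar_random e A ->
     (\int[P]_w counting (Sur (cok (A w - 1%:M)) H) =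
      counting [set: Sym2 H])%E) /\
  (p = 2%N -> exists N : nat, forall n : nat, (N <= n)%N ->
     forall (e : ensemble) (d : measure_display) (T : measurableType d)
       (P : probability T R) (A : {RV P >-> 'M[padic_int p]_n}),
     haar_random e A ->
     (\int[P]_w counting (Sur (cok (A w - 1%:M)) H) =
      counting [set: Gamma H] *
      (3 / 2 - 2 ^- (rank_t H + 2) - 2 ^- (rank_d p H + 2))%:E)%E).
Proof.
have [m cardH] := p_natP H_pgroup.
have pmH (h : H) : h *+ (p ^ m) = 0 by rewrite -cardH card_finZmod_mulrn.
(* [p ^ m] kills [H], but only its square is known to kill [Gamma H]. *)
pose K := (m + m)%N; pose ex := (p ^ K.+1)%N.
have pH (h : H) : h *+ ex = 0.
  by rewrite /ex expnSr /K expnD -mulnA mulrnA pmH mul0rn.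
have pG (g : Gamma H) : g *+ ex = 0.
  by rewrite /ex expnSr /K expnD mulrnA (gamma_exponent pmH) mul0rn.
have [N NP] := expectation_orbit_number R p_prime pH pG.
pose ex_gt0 : (0 < ex)%N := ltnW (expp_gt1 p_prime K).
split=> [p_odd|p2]; exists N => n Nn e d T P A hA; rewrite (NP n Nn e d T P A hA).
  have ex_odd : odd ex by rewrite oddX p_odd orbT.
  have [f bij_f] := Sym2_Gamma_bijection ex_odd pH pG.
  rewrite (counting_bij _ (gamma_enum_uniq H ex) (mem_gamma_enum ex_gt0 pG) bij_f).
  rewrite (counting_gamma ex_gt0 pG) /orbit_number big_pred0 ?addn0 // => D.
  apply/negbTE; rewrite negb_and negbK -implybE; apply/implyP => /asboolP Dx.
  by apply: xor_additive_odd Dx; rewrite cardH oddX p_odd orbT.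
subst p; rewrite (counting_gamma ex_gt0 pG) -EFinM; congr (_%:E).
rewrite /orbit_number; set g := #|_|; set S := (\sum_(D | _) _)%N.
have cnt (D : {ffun H -> bool}) : xor_additive D -> ~~ D (base D) ->
    (#|coset_steps (@gamma H : H -> gamma_fin ex_gt0 pG) ex D (base D)| * 4 *
      #|[set x | D x & (x + x == 0)%R]%SET| = g)%N.
  move=> /xor_coset_type [cD tD] nD.
  by rewrite (card_coset_steps (gamma_universal ex_gt0 pG) ex_gt0 pG cD tD nD).
have := sum_index_two cnt; rewrite -/S.
have := card_xor_torsion H; set nt := #|_|; set a := (2 ^ rank_d 2 H)%N.
set b := (2 ^ rank_t H)%N => ntb gS.
have a0 : (a%:R : R) != 0 by rewrite pnatr_eq0 /a expn_eq0.
have b0 : (b%:R : R) != 0 by rewrite pnatr_eq0 /b expn_eq0.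
have aE : (2 : R) ^- (rank_d 2 H + 2) = (a%:R * 4)^-1.
  by rewrite exprD /a natrX; congr (_ * _)^-1; rewrite -natrX.
have bE : (2 : R) ^- (rank_t H + 2) = (b%:R * 4)^-1.
  by rewrite exprD /b natrX; congr (_ * _)^-1; rewrite -natrX.
rewrite aE bE natrD.
have ntE : (nt%:R : R) = a%:R / b%:R by rewrite -ntb natrM mulfK.
(* This solves [sum_index_two] for the contribution of index two, with a = 2^d, b = 2^t and [nt] =
   a/b the number of subgroups containing H[2]. *)
have SE : (S%:R : R) = (g%:R * 2 * a%:R - g%:R * (nt%:R + 1)) / (4 * a%:R).
  have /(congr1 (fun k => k%:R : R)) := gS.
  rewrite natrD !natrM => E.
  rewrite natr1 -E addrK mulrAC mulfV ?mul1r //.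
  by rewrite mulf_neq0 // pnatr_eq0.
by rewrite SE ntE; field; rewrite a0 b0.
Qed.
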